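(* Let $p\in\mathbb{N}$ and let $T$ be a closed operator with compact resolvent in a separable Hilbert space $\mathcal{H}$ satisfying conditions (i)–(v) in the context (with constants $R$, $\epsilon_0$, $K$, $N$, $R_0$, $c$, $\kappa$). Assume that the Riesz projections $Q_\lambda$ of $T$ satisfy $$\|Q_\lambda\|\le\exp\left(\gamma|\lambda|^{p\varrho}(1+o(1))\right),\qquad \lambda\in\sigma(T),\ |\lambda|\to+\infty,$$ for some $\gamma>0$ and $\varrho>0$. If either $\varrho<\frac12$, or $$\varrho=\frac12\quad\text{and}\quad N<-1+\frac1{2p},$$ then for any $\epsilon_1\in(0,1]$ and any $\delta>0$ there exist $C=C(\epsilon_1,\delta)>0$ and $r=r(\epsilon_1,\delta)>0$ such that for all $z\in\rho(T)$ satisfying $|z|>r$ and $|\arg z|\le(1-\epsilon_1)\pi/p$, $$\|(z-T)^{-1}\|\le\frac{C}{\mathrm{dist}(z,\sigma(T))}\exp\left((1+\delta)\,\gamma\,\frac{\cos(p\varrho\arg z)}{\cos\left((1-\epsilon_0)\pi\varrho\right)}\,|z|^{p\varrho}\right).$$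
   Context: $\mathbb{N}=\{1,2,\dots\}$; $\arg$ takes values in $(-\pi,\pi]$; $B_R(0)$ is the open disc of radius $R$ around $0$ in $\mathbb{C}$. $T$ is a closed operator with compact resolvent in a separable Hilbert space $\mathcal{H}$, with eigenvalues $\lambda_n$, $n\in\mathbb{N}$ (repeated according to algebraic multiplicity, ordered so that $|\lambda_{n+1}|\ge|\lambda_n|$). The Riesz projections are $$Q_\lambda=\frac1{2\pi i}\int_{|z-\lambda|=\delta_\lambda}(z-T)^{-1}\,dz,\qquad \delta_\lambda=\tfrac12\,\mathrm{dist}(\lambda,\sigma(T)\setminus\{\lambda\}),\quad \lambda\in\sigma(T).$$ The conditions on $T$ (for the given $p\in\mathbb{N}$) are: (i) for some $R>0$ and $\epsilon_0\in(0,1]$, $\sigma(T)\subset B_R(0)\cup\{z\in\mathbb{C}:|\arg z|\le(1-\epsilon_0)\frac{\pi}{p}\}$; (ii) for some $K\ge1$ and $N\in[-1,\infty)$, $\|(re^{i\frac{\pi}{p}(1+2k)}-T)^{-1}\|\le Kr^N$ for all $r\ge R+1$ and $k=0,1,\dots,p-1$; (iii) there exists $R_0>R>0$ such that the geometric and algebraic multiplicities coincide for all $\lambda\in\sigma(T)$ with $|\lambda|>R_0$; (iv) the system of spectral projections $Q_\lambda$, $\lambda\in\sigma(T)$, is complete in $\mathcal{H}$, i.e. the linear span of the ranges of the $Q_\lambda$ is dense in $\mathcal{H}$; (v) $|\lambda_n|\ge cn^\kappa$ for all $n\in\mathbb{N}$, with some $c,\kappa>0$. *)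

(* Defs.v *)
From HB Require Import structures.
From mathcomp Require Import all_boot all_order all_algebra complex.
From mathcomp Require Import all_classical all_reals all_analysis.

Set Implicit Arguments.
Unset Strict Implicit.
Unset Printing Implicit Defensive.

Import Order.TTheory GRing.Theory Num.Theory.
Import numFieldNormedType.Exports.

Local Open Scope classical_set_scope.
Local Open Scope ring_scope.
Local Open Scope complex_scope.

(* Over [R[i]] the library norm [`|x|] is a complex number with zero imaginary
   part; this is its real value. *)
Definition rnorm (R : realType) (V : normedZmodType R[i]) (x : V) : R :=
  complex.Re `|x|.

(* The principal argument in ]-pi, pi]; its value at 0 is irrelevant. *)
Definition arg (R : realType) (z : R[i]) : R :=
  let t := acos (complex.Re z / rnorm z) in
  if 0 <= complex.Im z then t else - t.

Definition expi (R : realType) (t : R) : R[i] := cos t +i* sin t.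

Definition dist (R : realType) (z : R[i]) (A : set R[i]) : R :=
  inf [set rnorm (z - w) | w in A].

Definition is_hilbert (R : realType) (H : completeNormedModType R[i])
    (dot : {dot H for Num.conj}) : Prop :=
  forall x : H, `|x| ^+ 2 = dot x x.

Definition separable (T : topologicalType) : Prop :=
  exists2 A : set T, countable A & dense A.

Section LinearAlgebra.
Context {R : realType} {V : lmodType R[i]}.

Definition linear_span (A : set V) : set V :=
  [set x | exists n (a : 'I_n -> R[i]) (v : 'I_n -> V),
     (forall i, A (v i)) /\ x = \sum_(i < n) a i *: v i].

(* [S] is a linear subspace of dimension [m]: it has a basis of [m] vectors. *)
Definition has_dim (S : set V) (m : nat) : Prop :=
  exists b : 'I_m -> V,
    (forall a : 'I_m -> R[i],
       \sum_(i < m) a i *: b i = 0 -> forall i, a i = 0) /\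
    S = [set x | exists a : 'I_m -> R[i], x = \sum_(i < m) a i *: b i].

(* The values of [op_fun] outside [op_dom] are never used. *)
Record operator := Operator {
  op_dom : set V;
  op_fun : V -> V;
  op_dom0 : op_dom 0;
  op_domP : forall (a : R[i]) (x y : V),
    op_dom x -> op_dom y -> op_dom (a *: x + y);
  op_linear : forall (a : R[i]) (x y : V),
    op_dom x -> op_dom y -> op_fun (a *: x + y) = a *: op_fun x + op_fun y }.

Definition resolvent (T : operator) (z : R[i]) (y : V) : V :=
  xget 0 [set x | op_dom T x /\ z *: x - op_fun T x = y].

Definition eigenspace_of (T : operator) (l : R[i]) : set V :=
  [set x | op_dom T x /\ op_fun T x = l *: x].

(* The kernel of [(T - l)^k] on its maximal domain. *)
Fixpoint ker_pow (T : operator) (l : R[i]) (k : nat) : set V :=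
  if k is k'.+1 then
    [set x | op_dom T x /\ ker_pow T l k' (op_fun T x - l *: x)]
  else [set 0].

Definition root_space (T : operator) (l : R[i]) : set V :=
  \bigcup_(k in [set: nat]) ker_pow T l k.

Definition geom_mult (T : operator) (l : R[i]) (m : nat) : Prop :=
  has_dim (eigenspace_of T l) m.

Definition alg_mult (T : operator) (l : R[i]) (m : nat) : Prop :=
  has_dim (root_space T l) m.

(* [lam n] is the (n+1)-st eigenvalue: every complex number occurs in the
   sequence as often as its algebraic multiplicity (so never if it is 0). *)
Definition eigenvalue_seq (T : operator) (lam : nat -> R[i]) : Prop :=
  (forall mu : R[i],
     exists2 m, alg_mult T mu m & ([set n | lam n = mu] #= `I_m)%card) /\
  (forall n, rnorm (lam n) <= rnorm (lam n.+1)).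

End LinearAlgebra.
Arguments operator {R} V.

Section Spectrum.
Context {R : realType} {V : normedModType R[i]}.

Definition opnorm (A : V -> V) : \bar R :=
  ereal_sup [set (rnorm (A x))%:E | x in [set x : V | rnorm x <= 1]].

Definition closed_operator (T : operator V) : Prop :=
  closed [set xy : V * V | op_dom T xy.1 /\ op_fun T xy.1 = xy.2].

Definition resolvent_set (T : operator V) : set R[i] :=
  [set z | (forall y, exists! x, op_dom T x /\ z *: x - op_fun T x = y) /\
           (opnorm (resolvent T z) < +oo)%E].

Definition spectrum (T : operator V) : set R[i] := ~` resolvent_set T.

Definition compact_operator (A : V -> V) : Prop :=
  precompact (A @` [set x : V | rnorm x <= 1]).

Definition has_compact_resolvent (T : operator V) : Prop :=
  exists2 z, resolvent_set T z & compact_operator (resolvent T z).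

Definition tagged_partition (a b d : R) (n : nat) (s t : nat -> R) : Prop :=
  [/\ s 0%N = a, s n = b &
      forall i, (i < n)%N ->
        [/\ s i <= t i, t i <= s i.+1 & s i.+1 - s i < d]].

(* [Q] is the Riemann integral of the operator-valued [f] over [a, b], in the
   operator norm.  Linearity is required because [opnorm] only sees the values
   on the unit ball. *)
Definition is_op_RInt (f : R -> V -> V) (a b : R) (Q : V -> V) : Prop :=
  linear Q /\
  forall e : R, 0 < e -> exists2 d : R, 0 < d &
    forall n s t, tagged_partition a b d n s t ->
      (opnorm (fun x =>
         ((\sum_(i < n) (s i.+1 - s i)%:C *: f (t i) x) - Q x)%R)
       <= e%:E)%E.

Definition op_RInt (f : R -> V -> V) (a b : R) : V -> V :=
  xget (fun=> 0) [set Q | is_op_RInt f a b Q].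

(* The integral of [f z dz] over the positively oriented circle
   [z = c + r e^{i t}], 0 <= t <= 2 pi. *)
Definition circle_int (f : R[i] -> V -> V) (c : R[i]) (r : R) : V -> V :=
  op_RInt (fun t x => (r%:C * 'i%C * expi t) *: f (c + r%:C * expi t) x)
    0 (2 * pi).

Definition riesz_proj (T : operator V) (l : R[i]) : V -> V :=
  let delta := dist l (spectrum T `\ l) / 2 in
  fun x => ((2 * pi)%:C * 'i%C)^-1 *: circle_int (resolvent T) l delta x.

Definition complete_projections (T : operator V) : Prop :=
  dense (linear_span (\bigcup_(l in spectrum T) range (riesz_proj T l))).

End Spectrum.

(* Main.v *)
(* On the span of the ranges of the Riesz projections [P_l], consider, with [q = p rho] and
   [a = (1 + delta) gamma / cos ((1 - eps0) pi rho)],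
     [g(z) = exp (- a z^q) (z - T)^-1 x - sum_l exp (- a l^q) / (z - l) P_l x],
   the sum running over the large eigenvalues that occur in [x].  Since large eigenvalues
   are semisimple, [g] has no poles in the sector [|arg z| <= pi / p] beyond some radius.
   The choice of [a] makes [exp (- a l^q) P_l] at most [exp (- d |l|^q)] in norm, which is
   summable over all eigenvalues, so the sum is [O (1 / dist z (spectrum T))] uniformly in
   the number of terms.  Near the edges of the sector the resolvent bound on the rays is
   compensated by [exp (- a z^q)]: for [rho = 1/2] the edges are bent inwards by the angle
   [c0 |z|^- (N + 1)], which keeps half of the resolvent bound and, as [q > N + 1], leaves
   [Re z^q] growing like a power of [|z|].  For fixed [x], [z g(z)] is bounded, so the
   maximum principle, in the logarithmic coordinate, bounds [z g(z)] by its boundary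
   values, that is by a constant times [|x|] that does not depend on [x].  Solving for the
   resolvent and completeness of the projections give the claim.

   Holomorphy is only used through a finite Taylor expansion at every point, and the facts
   on Riesz projections through the Riemann sums at the [n]-th roots of unity, for which
   the resolvent identity gives exact algebraic identities. *)

Require Import Defs.
From HB Require Import structures.
From mathcomp Require Import all_boot all_order all_algebra complex.
From mathcomp Require Import all_classical all_reals all_analysis.
From mathcomp Require Import ring lra.

Set Implicit Arguments.
Unset Strict Implicit.
Unset Printing Implicit Defensive.

Import Order.TTheory GRing.Theory Num.Theory.
Import numFieldNormedType.Exports.

Local Open Scope classical_set_scope.
Local Open Scope ring_scope.
Local Open Scope complex_scope.

(** * Complex analysis *)

(** No growth bound for the resolvent inside the sector is assumed, so the argument runs on one
    vector [x] of the dense span at a time. There the equation [z v - T v = x] has an explicit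
    solution, rational in [z] and [O(1 / |z|)] with a constant depending on [x]. This qualitative
    bound closes the sector at infinity and then disappears, leaving only boundary constants. On the
    boundary, points need not be known to lie in the resolvent set: a lower bound for [z - T]
    suffices, since a solution is already at hand. The edges get it from the two neighbouring rays,
    the arc [|z| = r1] from compactness, with [r1] placed in a gap of the eigenvalue moduli.
    Function theory is applied only to the pairings with a fixed [y], so no vector-valued
    analyticity occurs. *)

Section RealNorm.
Context {R : realType}.

Lemma rnormE (V : normedZmodType R[i]) (x : V) : `|x| = (rnorm x)%:C.
Proof.
have /ger0_Im : 0 <= `|x| by exact: normr_ge0.
by rewrite /rnorm; case: (`|x|) => a b /= ->.
Qed.

Lemma rnorm_ge0 (V : normedZmodType R[i]) (x : V) : 0 <= rnorm x.
Proof. by rewrite -lecR -rnormE normr_ge0. Qed.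

Lemma rnormD (V : normedZmodType R[i]) (x y : V) : rnorm (x + y) <= rnorm x + rnorm y.
Proof. by rewrite -lecR rmorphD /= -!rnormE ler_normD. Qed.

Lemma rnormN (V : normedZmodType R[i]) (x : V) : rnorm (- x) = rnorm x.
Proof. by rewrite /rnorm normrN. Qed.

Lemma rnorm0 (V : normedZmodType R[i]) : rnorm (0 : V) = 0.
Proof. by rewrite /rnorm normr0. Qed.

Lemma rnorm_eq0 (V : normedZmodType R[i]) (x : V) : (rnorm x == 0) = (x == 0).
Proof. by rewrite -(inj_eq (@complexI R)) -rnormE normr_eq0. Qed.

Lemma rnorm_gt0 (V : normedZmodType R[i]) (x : V) : (0 < rnorm x) = (x != 0).
Proof. by rewrite lt_neqAle rnorm_ge0 andbT eq_sym rnorm_eq0. Qed.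

Lemma rdistC (V : normedZmodType R[i]) (x y : V) : rnorm (x - y) = rnorm (y - x).
Proof. by rewrite -rnormN opprB. Qed.

Lemma rnormB (V : normedZmodType R[i]) (x y : V) : rnorm (x - y) <= rnorm x + rnorm y.
Proof. by rewrite -(rnormN y) rnormD. Qed.

Lemma lerB_rnorm (V : normedZmodType R[i]) (x y : V) : rnorm x - rnorm y <= rnorm (x - y).
Proof. by have := rnormD (x - y) y; rewrite subrK; lra. Qed.

Lemma rnorm_sum (V : normedZmodType R[i]) (I : Type) (r : seq I) (P : pred I) (F : I -> V) :
  rnorm (\sum_(i <- r | P i) F i) <= \sum_(i <- r | P i) rnorm (F i).
Proof.
elim/big_rec2: _ => [|i y x _ IH]; first by rewrite rnorm0.
by apply: le_trans (rnormD _ _) _; rewrite lerD2l.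
Qed.

Lemma rnormZ (V : normedModType R[i]) (a : R[i]) (x : V) :
  rnorm (a *: x) = rnorm a * rnorm x.
Proof. by apply: (@complexI R); rewrite rmorphM /= -!rnormE normrZ. Qed.

Lemma rnormM (a b : R[i]) : rnorm (a * b) = rnorm a * rnorm b.
Proof. by apply: (@complexI R); rewrite rmorphM /= -!rnormE normrM. Qed.

Lemma rnorm1 : rnorm (1 : R[i]) = 1.
Proof. by rewrite /rnorm normr1. Qed.

Lemma rnormX (a : R[i]) n : rnorm (a ^+ n) = rnorm a ^+ n.
Proof. by elim: n => [|n IH]; rewrite ?expr0 ?rnorm1 // !exprS rnormM IH. Qed.

Lemma rnormV (a : R[i]) : rnorm a^-1 = (rnorm a)^-1.
Proof.
have [->|a0] := eqVneq a 0; first by rewrite invr0 rnorm0 invr0.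
have n0 : rnorm a != 0 by rewrite rnorm_eq0.
by apply: (mulfI n0); rewrite divff // -rnormM divff // rnorm1.
Qed.

Lemma rnorm_real (x : R) : rnorm (x%:C : R[i]) = `|x|.
Proof. by rewrite /rnorm normc_def /= expr0n /= addr0 sqrtr_sqr. Qed.

Lemma sqr_rnorm (z : R[i]) : rnorm z ^+ 2 = complex.Re z ^+ 2 + complex.Im z ^+ 2.
Proof. by rewrite /rnorm normc_def /= sqr_sqrtr // addr_ge0 ?sqr_ge0. Qed.

Lemma Re_le_rnorm (z : R[i]) : `|complex.Re z| <= rnorm z.
Proof.
rewrite -(@ler_pXn2r _ 2) ?nnegrE ?rnorm_ge0 // sqr_rnorm real_normK ?num_real //.
by rewrite lerDl sqr_ge0.
Qed.

Lemma Im_le_rnorm (z : R[i]) : `|complex.Im z| <= rnorm z.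
Proof.
rewrite -(@ler_pXn2r _ 2) ?nnegrE ?rnorm_ge0 // sqr_rnorm real_normK ?num_real //.
by rewrite lerDr sqr_ge0.
Qed.

Lemma rnorm_le_ReIm (z : R[i]) : rnorm z <= `|complex.Re z| + `|complex.Im z|.
Proof.
rewrite -(@ler_pXn2r _ 2) ?nnegrE ?rnorm_ge0 // ?addr_ge0 // sqr_rnorm.
rewrite sqrrD !real_normK ?num_real // [leRHS]addrAC lerDl.
by rewrite mulrn_wge0 // mulr_ge0.
Qed.

Lemma rnormi : rnorm ('i%C : R[i]) = 1.
Proof. by rewrite /rnorm normc_def /= expr0n expr1n /= add0r sqrtr1. Qed.

End RealNorm.

(** * The complex exponential, the principal argument and the logarithm *)

Section ComplexExp.
Context {R : realType}.

Definition cexp (z : R[i]) : R[i] := (expR (complex.Re z))%:C * expi (complex.Im z).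

Lemma expiD (s t : R) : expi (s + t) = expi s * expi t.
Proof. by rewrite /expi cosD sinD; simpc; congr (_ +i* _); ring. Qed.

Lemma expi0 : expi (0 : R) = 1.
Proof. by rewrite /expi cos0 sin0. Qed.

Lemma rnorm_expi (t : R) : rnorm (expi t) = 1.
Proof. by rewrite /rnorm normc_def /= cos2Dsin2 sqrtr1. Qed.

Lemma expiMn (t : R) n : expi (t *+ n) = expi t ^+ n.
Proof. by elim: n => [|n IH]; rewrite ?mulr0n ?expi0 // mulrS expiD IH exprS. Qed.

Lemma expi2pi : expi (2 * pi : R) = 1.
Proof. by rewrite mulr_natl /expi cos2pi sin2pi. Qed.

Lemma expiDpi (t : R) : expi (t + pi) = - expi t.
Proof. by rewrite /expi cosDpi sinDpi. Qed.

Lemma expiD2pi (t : R) : expi (t + 2 * pi) = expi t.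
Proof. by rewrite expiD expi2pi mulr1. Qed.

Lemma cexpD (z w : R[i]) : cexp (z + w) = cexp z * cexp w.
Proof.
case: z w => [a b] [c d]; rewrite /cexp /= expRD expiD rmorphM /=.
by rewrite -!mulrA; congr (_ * _); rewrite mulrCA.
Qed.

Lemma cexp0 : cexp 0 = 1.
Proof. by rewrite /cexp /= expR0 expi0 mulr1. Qed.

Lemma rnorm_cexp (z : R[i]) : rnorm (cexp z) = expR (complex.Re z).
Proof. by rewrite /cexp rnormM rnorm_expi mulr1 rnorm_real ger0_norm // expR_ge0. Qed.

Lemma cexp_neq0 (z : R[i]) : cexp z != 0.
Proof. by rewrite -rnorm_eq0 rnorm_cexp gt_eqF // expR_gt0. Qed.

Lemma cos_eq1 (y : R) : `|y| < 2 * pi -> cos y = 1 -> y = 0.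
Proof.
wlog y0 : y / 0 <= y.
  move=> H; have [y0|y0] := leP 0 y; first exact: H.
  rewrite -normrN -cosN => h1 h2; apply/eqP; rewrite -oppr_eq0; apply/eqP.
  by apply: H => //; lra.
rewrite ger0_norm // => ylt c1; apply/eqP; rewrite eq_le y0 andbT leNgt; apply/negP => yp.
have := @sin_gt0_pi R (y / 2); rewrite divr_gt0 //= => /(_ _)/wrap[].
  by rewrite ltr_pdivrMr // mulrC.
have := cos_mulr2n (y / 2); rewrite -[_ *+ 2]mulr_natr divfK // c1 cos2sin2.
by move=> h; have : sin (y / 2) ^+ 2 = 0 by [lra]; move/eqP; rewrite sqrf_eq0 => /eqP ->; rewrite ltxx.
Qed.

(** The half-width [2 * pi] accommodates the difference of two logarithms with imaginary parts in
    [[-pi, pi]], one of them strictly inside; [expm1_div] does not vanish there. *)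
Lemma cexp_eq1 (z : R[i]) : `|complex.Im z| < 2 * pi -> cexp z = 1 -> z = 0.
Proof.
case: z => a b /= blt E.
have a0 : a = 0.
  have := congr1 (@rnorm R _) E; rewrite rnorm_cexp rnorm1 /= -(@expR0 R).
  exact: expR_inj.
move: E; rewrite /cexp /expi /= a0 expR0; simpc => -[cb _].
by rewrite (cos_eq1 blt cb).
Qed.

Lemma rnorm_polar (r l s t : R) :
  rnorm (r%:C * expi s - l%:C * expi t) ^+ 2 =
  r ^+ 2 + l ^+ 2 - 2 * (r * l) * cos (s - t).
Proof.
rewrite sqr_rnorm /expi cosB; simpc => /=.
have := cos2Dsin2 s; have := cos2Dsin2 t => ht hs.
have -> : r ^+ 2 = r ^+ 2 * (cos s ^+ 2 + sin s ^+ 2) by rewrite hs mulr1.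
have -> : l ^+ 2 = l ^+ 2 * (cos t ^+ 2 + sin t ^+ 2) by rewrite ht mulr1.
ring.
Qed.

Lemma polar_arg (z : R[i]) : z != 0 -> z = (rnorm z)%:C * expi (arg z).
Proof.
move=> z0; have n0 : 0 < rnorm z by rewrite rnorm_gt0.
have le1 : -1 <= complex.Re z / rnorm z <= 1.
  by rewrite -ler_norml normrM normfV (ger0_norm (ltW n0)) ler_pdivrMr // mul1r Re_le_rnorm.
have Es : sin (acos (complex.Re z / rnorm z)) = `|complex.Im z| / rnorm z.
  rewrite sin_acos //; apply/eqP; rewrite -(@eqrXn2 _ 2) ?sqrtr_ge0 ?divr_ge0 ?rnorm_ge0 //.
  have := sqr_rnorm z => h.
  have E : 1 - (complex.Re z / rnorm z) ^+ 2 = (complex.Im z / rnorm z) ^+ 2.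
    by rewrite !expr_div_n -[complex.Im z ^+ 2](addKr (complex.Re z ^+ 2)) -h;
      field; rewrite gt_eqF.
  by rewrite sqr_sqrtr E ?sqr_ge0 // !expr_div_n real_normK ?num_real.
have Ec : cos (acos (complex.Re z / rnorm z)) = complex.Re z / rnorm z by rewrite acosK.
rewrite /arg /expi; case: ifPn => im0; rewrite ?cosN ?sinN Es Ec; simpc.
  rewrite ger0_norm // ![rnorm z * _]mulrC !divfK ?gt_eqF //.
  by case: (z).
rewrite ltr0_norm ?ltNge // mulNr mulrN opprK ![rnorm z * _]mulrC !divfK ?gt_eqF //.
by case: (z).
Qed.

Definition clog (z : R[i]) : R[i] := ln (rnorm z) +i* arg z.

Lemma clogK (z : R[i]) : z != 0 -> cexp (clog z) = z.
Proof.
move=> z0; rewrite [RHS]polar_arg // /cexp /clog /=.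
by rewrite lnK // posrE rnorm_gt0.
Qed.

End ComplexExp.

(** * Finite Taylor expansions and their calculus *)

Section Jets.
Context {R : realType}.
Local Notation C := R[i].
Implicit Types (f g : C -> C) (w t : C) (k : nat).

(* Carathéodory form of the Taylor expansion at [w] up to an error
   [O(|t|^k)]; it makes stability under composition and inversion algebraic. *)
Fixpoint jet k f w : Prop :=
  if k is k'.+1 then exists f1,
    (exists2 r : R, 0 < r &
       forall t, rnorm t < r -> f (w + t) = f w + t * f1 (w + t)) /\ jet k' f1 w
  else exists M r : R, 0 < r /\ forall t, rnorm t < r -> rnorm (f (w + t)) <= M.

Lemma jet_ext k f g w : (exists2 r : R, 0 < r &
    forall t, rnorm t < r -> f (w + t) = g (w + t)) -> jet k f w -> jet k g w.
Proof.
case: k => [|k] [r r0 E] /=.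
  move=> [M [r' [r'0 H]]]; exists M, (Num.min r r'); split; first by rewrite lt_min r0.
  by move=> t; rewrite lt_min => /andP[h1 h2]; rewrite -E // H.
move=> [f1 [[r' r'0 H] J]]; exists f1; split=> //.
exists (Num.min r r'); first by rewrite lt_min r0.
move=> t; rewrite lt_min => /andP[h1 h2]; rewrite -E // H //; congr (_ + _).
by rewrite -[in LHS](addr0 w) E ?rnorm0 // addr0.
Qed.

Lemma jetW k f w : jet k.+1 f w -> jet k f w.
Proof.
elim: k f => [|k IH] f /= [f1 [[r r0 H] J]]; last first.
  by exists f1; split; [exists r | apply: IH].
move: J => [M [r' [r'0 H']]]; exists (rnorm (f w) + r * M), (Num.min r r').
split; first by rewrite lt_min r0.
move=> t; rewrite lt_min => /andP[h1 h2]; rewrite H //.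
apply: le_trans (rnormD _ _) _; rewrite lerD2l rnormM.
by rewrite ler_pM ?rnorm_ge0 ?H' // ltW.
Qed.

Lemma jet_leq k m f w : (k <= m)%N -> jet m f w -> jet k f w.
Proof.
elim: m => [|m IH]; first by rewrite leqn0 => /eqP ->.
by rewrite leq_eqVlt => /orP[/eqP -> //|km] /jetW; apply: IH.
Qed.

Lemma jet_continuous f w : jet 1 f w -> forall e : R, 0 < e ->
  exists2 r : R, 0 < r & forall t, rnorm t < r -> rnorm (f (w + t) - f w) < e.
Proof.
move=> /= [f1 [[r r0 H] [M [r' [r'0 H']]]]] e e0.
have M1 : 0 < `|M| + 1 by rewrite ltr_wpDl.
exists (Num.min (Num.min r r') (e / (`|M| + 1))); first by rewrite !lt_min r0 r'0 divr_gt0.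
move=> t; rewrite !lt_min -andbA => /and3P[h1 h2 h3]; rewrite H // addrAC subrr add0r rnormM.
move: h3; rewrite ltr_pdivlMr // => h3; apply: le_lt_trans h3.
by rewrite ler_wpM2l ?rnorm_ge0 // (le_trans (H' _ h2)) // (le_trans (ler_norm M)) // lerDl.
Qed.

Lemma jet_cst k (c : C) w : jet k (fun=> c) w.
Proof.
elim: k c => [|k IH] c /=; first by exists (rnorm c), 1.
by exists (fun=> 0); split=> //; exists 1 => // t _; rewrite mulr0 addr0.
Qed.

Lemma jet_id k w : jet k id w.
Proof.
case: k => [|k] /=.
  exists (rnorm w + 1), 1; split=> // t h.
  by rewrite (le_trans (rnormD _ _)) // lerD2l ltW.
by exists (fun=> 1); split; [exists 1 => // t _; rewrite mulr1 | apply: jet_cst].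
Qed.

Lemma jetD k f g w : jet k f w -> jet k g w -> jet k (fun z => f z + g z) w.
Proof.
elim: k f g => [|k IH] f g /=.
  move=> [M [r [r0 H]]] [M' [r' [r'0 H']]]; exists (M + M'), (Num.min r r').
  split; first by rewrite lt_min r0.
  move=> t; rewrite lt_min => /andP[h1 h2].
  by rewrite (le_trans (rnormD _ _)) // lerD ?H ?H'.
move=> [f1 [[r r0 H] J]] [g1 [[r' r'0 H'] J']].
exists (fun z => f1 z + g1 z); split; last exact: IH.
exists (Num.min r r'); first by rewrite lt_min r0.
by move=> t; rewrite lt_min => /andP[h1 h2]; rewrite H // H' //; ring.
Qed.

Lemma jetM k f g w : jet k f w -> jet k g w -> jet k (fun z => f z * g z) w.
Proof.
elim: k f g => [|k IH] f g.
  move=> /= [M [r [r0 H]]] [M' [r' [r'0 H']]]; exists (M * M'), (Num.min r r').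
  split; first by rewrite lt_min r0.
  move=> t; rewrite lt_min => /andP[h1 h2].
  by rewrite rnormM ler_pM ?rnorm_ge0 ?H ?H'.
move=> [f1 [[r r0 H] J]] Jg; have Jg0 := jetW Jg; case: Jg => g1 [[r' r'0 H'] J'].
exists (fun z => f1 z * g z + f w * g1 z); split; last first.
  by apply: jetD; apply: IH => //; apply: jet_cst.
exists (Num.min r r'); first by rewrite lt_min r0.
move=> t; rewrite lt_min => /andP[h1 h2]; rewrite H // mulrDl H' //; ring.
Qed.

Lemma jetZ k (c : C) f w : jet k f w -> jet k (fun z => c * f z) w.
Proof. by move=> J; apply: jetM => //; apply: jet_cst. Qed.

Lemma jetN k f w : jet k f w -> jet k (fun z => - f z) w.
Proof.
move=> /(jetZ (-1)); apply: jet_ext; exists 1 => // t _; by rewrite mulN1r.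
Qed.

Lemma jetB k f g w : jet k f w -> jet k g w -> jet k (fun z => f z - g z) w.
Proof. by move=> Jf Jg; apply: jetD => //; apply: jetN. Qed.

Lemma jet_sum k (I : Type) (s : seq I) (f : I -> C -> C) w :
  (forall i, jet k (f i) w) -> jet k (fun z => \sum_(i <- s) f i z) w.
Proof.
move=> J; elim: s => [|i s IH].
  by apply: jet_ext (jet_cst k 0 w); exists 1 => // t _; rewrite big_nil.
by apply: jet_ext (jetD (J i) IH); exists 1 => // t _; rewrite big_cons.
Qed.

(** The separate hypothesis [jet 1 g w] gives continuity of [g] at [w], which [jet 0] does not. *)
Lemma jet_comp k f g w : jet k f (g w) -> jet 1 g w -> jet k g w -> jet k (f \o g) w.
Proof.
move=> Jf Jg1; elim: k f Jf => [|k IH] f.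
  move=> /= [M [r [r0 H]]] _.
  have [r' r'0 H'] := jet_continuous Jg1 r0.
  by exists M, r'; split=> // t /H' h; rewrite -[g _](subrK (g w)) addrC H.
move=> [f1 [[r r0 H] J]] Jg; have Jg0 := jetW Jg; case: Jg => g1 [[r1 r10 H1] J1].
have [r' r'0 H'] := jet_continuous Jg1 r0.
exists (fun z => g1 z * f1 (g z)); split; last by apply: jetM => //; apply: IH.
exists (Num.min r1 r'); first by rewrite lt_min r10.
move=> t; rewrite lt_min => /andP[h1 h2] /=.
have := H _ (H' _ h2); rewrite [g w + _]addrC subrK => ->.
by rewrite {1}H1 // [g w + _]addrC addrK mulrA.
Qed.

(** The difference [1 / f - 1 / f w] is [t] times [- f1 / (f w * f)]. This factor contains [1 / f]
    itself, but to one order less, so the induction applies. *)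
Lemma jetV k f w : f w != 0 -> jet 1 f w -> jet k f w -> jet k (fun z => (f z)^-1) w.
Proof.
move=> f0 J1; have n0 : 0 < rnorm (f w) / 2 by rewrite divr_gt0 // rnorm_gt0.
have [r r0 H] := jet_continuous J1 n0.
have lb t : rnorm t < r -> rnorm (f w) / 2 <= rnorm (f (w + t)).
  move=> /H h; have := lerB_rnorm (f w) (f (w + t)); rewrite rdistC; lra.
have nz t : rnorm t < r -> f (w + t) != 0.
  by move=> /lb h; rewrite -rnorm_gt0; lra.
elim: k => [|k IH] Jf.
  exists (rnorm (f w) / 2)^-1, r; split=> // t /lb h.
  by rewrite rnormV lef_pV2 ?posrE //; apply: lt_le_trans h.
have {}IH := IH (jetW Jf); case: Jf => f1 [[r1 r10 H1] J].
exists (fun z => - (f w)^-1 * (f1 z * (f z)^-1)); split; last exact/jetZ/jetM.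
exists (Num.min r r1); first by rewrite lt_min r0.
move=> t; rewrite lt_min => /andP[h1 h2].
have := nz _ h1; have := H1 _ h2; move: (f (w + t)) (f1 (w + t)) => F G E F0.
have -> : t * (- (f w)^-1 * (G / F)) = - ((t * G) * ((f w)^-1 / F)) by ring.
have -> : t * G = F - f w by rewrite E; ring.
by field; rewrite f0 F0.
Qed.

End Jets.
Arguments jet : simpl never.

(** * Third-order expansions of the exponential *)

Section ExpJet.
Context {R : realType}.
Local Notation C := R[i].

(** The mean value theorem in place of integration: [|g x| = |g1 d| |x|] with [|d| <= |x|]. Only the
    factor [1 / (k + 1)] of the integral is given up. *)
Lemma le_pow_integral (g g1 : R -> R) (c : R) (k : nat) : g 0 = 0 ->
  (forall x : R, is_derive x (1 : R) g (g1 x)) ->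
  (forall x : R, `|x| <= 1 -> `|g1 x| <= c * `|x| ^+ k) ->
  forall x : R, `|x| <= 1 -> `|g x| <= c * `|x| ^+ k.+1.
Proof.
move=> g0 dg H x x1.
have c0 : 0 <= c by have := H 1; rewrite normr1 expr1n mulr1 => /(_ (lexx _)); apply: le_trans.
have cg a b : {within `[a, b], continuous g}.
  apply: continuous_subspaceT => y.
  by apply: differentiable_continuous; apply/derivable1_diffP; have [] := dg y.
have [x0|x0|->] := ltgtP x 0; last by rewrite g0 normr0 expr0n /= mulr0.
- have [d /andP[d1 d2]] := MVT x0 (fun y _ => dg y) (cg x 0).
  rewrite g0 !sub0r => E; rewrite -normrN E normrM normrN exprSr mulrA ler_wpM2r //.
  have dx : `|d| <= `|x| by rewrite !ltr0_norm // lerN2 ltW.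
  rewrite (le_trans (H _ (le_trans dx x1))) // ler_wpM2l // lerXn2r // nnegrE //.
- have [d /andP[d1 d2]] := MVT x0 (fun y _ => dg y) (cg 0 x).
  rewrite g0 !subr0 => E; rewrite E normrM exprSr mulrA ler_wpM2r //.
  have dx : `|d| <= `|x| by rewrite !gtr0_norm // ltW.
  by rewrite (le_trans (H _ (le_trans dx x1))) // ler_wpM2l // lerXn2r // nnegrE.
Qed.

Lemma expR_taylor3 (x : R) : `|x| <= 1 ->
  `|expR x - (1 + x + x ^+ 2 / 2 + x ^+ 3 / 6)| <= expR 1 * `|x| ^+ 4.
Proof.
pose g1 (y : R) := expR y - 1.
pose g2 (y : R) := expR y - (1 + y).
pose g3 (y : R) := expR y - (1 + y + y ^+ 2 / 2).
pose g4 (y : R) := expR y - (1 + y + y ^+ 2 / 2 + y ^+ 3 / 6).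
apply: (@le_pow_integral g4 g3).
- by rewrite /g4 expR0; ring.
- by move=> y; apply: is_derive_eq; rewrite /g3 /GRing.scale /=; field.
apply: (@le_pow_integral g3 g2).
- by rewrite /g3 expR0; ring.
- by move=> y; apply: is_derive_eq; rewrite /g2 /GRing.scale /=; field.
apply: (@le_pow_integral g2 g1).
- by rewrite /g2 expR0; ring.
- by move=> y; apply: is_derive_eq; rewrite /g1 /GRing.scale /=; field.
apply: (@le_pow_integral g1 expR).
- by rewrite /g1 expR0; ring.
- by move=> y; apply: is_derive_eq; rewrite /GRing.scale /=; ring.
move=> y; rewrite ler_norml => /andP[_ h]; rewrite expr0 mulr1 ger0_norm ?expR_ge0 //.
by rewrite ler_expR.
Qed.

Lemma sin_cos_taylor (x : R) : `|x| <= 1 ->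
  `|cos x - (1 - x ^+ 2 / 2)| <= `|x| ^+ 4 /\ `|sin x - (x - x ^+ 3 / 6)| <= `|x| ^+ 5.
Proof.
pose s1 (y : R) := sin y.
pose c2 (y : R) := cos y - 1.
pose s3 (y : R) := sin y - y.
pose c4 (y : R) := cos y - (1 - y ^+ 2 / 2).
pose s5 (y : R) := sin y - (y - y ^+ 3 / 6).
have b1 : forall y : R, `|y| <= 1 -> `|s1 y| <= 1 * `|y| ^+ 1.
  apply: (@le_pow_integral s1 cos); first by rewrite /s1 sin0.
  by move=> y _; rewrite expr0 mulr1 cos_max.
have b2 : forall y : R, `|y| <= 1 -> `|c2 y| <= 1 * `|y| ^+ 2.
  apply: (@le_pow_integral c2 (fun y => - s1 y)); first by rewrite /c2 cos0 subrr.
    by move=> y; apply: is_derive_eq; rewrite subr0.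
  by move=> y /b1; rewrite normrN.
have b3 : forall y : R, `|y| <= 1 -> `|s3 y| <= 1 * `|y| ^+ 3.
  apply: (@le_pow_integral s3 c2); first by rewrite /s3 sin0 subrr.
  exact: b2.
have b4 : forall y : R, `|y| <= 1 -> `|c4 y| <= 1 * `|y| ^+ 4.
  apply: (@le_pow_integral c4 (fun y => - s3 y)); first by rewrite /c4 cos0; ring.
    by move=> y; apply: is_derive_eq; rewrite /s3 /GRing.scale /=; field.
  by move=> y /b3; rewrite normrN.
have b5 : forall y : R, `|y| <= 1 -> `|s5 y| <= 1 * `|y| ^+ 5.
  apply: (@le_pow_integral s5 c4); first by rewrite /s5 sin0; ring.
    by move=> y; apply: is_derive_eq; rewrite /c4 /GRing.scale /=; field.
  exact: b4.
by move=> x1; rewrite -[X in _ <= X /\ _]mul1r -[X in _ /\ _ <= X]mul1r b4 ?b5.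
Qed.

(** The error is taken to fourth order because [expm1_div] loses one order in the division by [t]
    and must still have a jet of order 3. *)
Lemma cexp_taylor3 : exists M : R, forall t : R[i], rnorm t < 1 ->
  rnorm (cexp t - (1 + t + t ^+ 2 / 2 + t ^+ 3 / 6)) <= M * rnorm t ^+ 4.
Proof.
exists (expR 1 * 2 + 3 + 1 + expR 1 * 2 + 3 + 1) => -[x y] t1.
set t := x +i* y in t1 *; set n := rnorm t in t1 *.
have n0 : 0 <= n by exact: rnorm_ge0.
have xn : `|x| <= n by exact: (Re_le_rnorm t).
have yn : `|y| <= n by exact: (Im_le_rnorm t).
have x1 : `|x| <= 1 by lra.
have y1 : `|y| <= 1 by lra.
have pw k m (u : R) : `|u| <= n -> (m <= k)%N -> `|u| ^+ k <= n ^+ m.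
  move=> un mk; apply: le_trans (_ : n ^+ k <= _); first by rewrite lerXn2r // nnegrE.
  by apply: ler_wiXn2l => //; exact: ltW.
have := expR_taylor3 x1; set r1 := expR x - _ => h1.
have [] := sin_cos_taylor y1; set r2 := cos y - _ => h2; set r3 := sin y - _ => h3.
have mx (u v c d : R) : `|u| <= c -> `|v| <= d * n ^+ 4 -> `|u * v| <= c * d * n ^+ 4.
  by move=> hu hv; rewrite normrM -mulrA ler_pM.
have m4 i j : (4 <= i + j)%N -> `|x ^+ i * y ^+ j| <= 1 * n ^+ 4.
  move=> ij; rewrite normrM !normrX mul1r.
  apply: le_trans (_ : n ^+ (i + j) <= _).
    by rewrite exprD ler_pM ?exprn_ge0 ?lerXn2r ?nnegrE.
  by apply: ler_wiXn2l => //; exact: ltW.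
have T3 : `|1 + x + x ^+ 2 / 2 + x ^+ 3 / 6| <= 3.
  have x2 : `|x ^+ 2| <= 1 by rewrite normrX exprn_ile1.
  have x3 : `|x ^+ 3| <= 1 by rewrite normrX exprn_ile1.
  by move: x1 x2 x3; rewrite !ler_norml; lra.
have r1n : `|r1| <= expR 1 * n ^+ 4.
  by apply: le_trans h1 _; rewrite ler_wpM2l ?expR_ge0 // pw.
have r2n : `|r2| <= 1 * n ^+ 4 by rewrite mul1r; apply: le_trans h2 _; rewrite pw.
have r3n : `|r3| <= 1 * n ^+ 4 by rewrite mul1r; apply: le_trans h3 _; rewrite pw.
(* All monomials of degree below 4 cancel: what remains are bounded factors times the remainders
   [r1], [r2], [r3], and monomials of degree at least 4. *)
have E : cexp t - (1 + t + t ^+ 2 / 2 + t ^+ 3 / 6) =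
   (cos y * r1 + (1 + x + x ^+ 2 / 2 + x ^+ 3 / 6) * r2
     - 4^-1 * (x ^+ 2 * y ^+ 2) - 12^-1 * (x ^+ 3 * y ^+ 2)) +i*
   (sin y * r1 + (1 + x + x ^+ 2 / 2 + x ^+ 3 / 6) * r3 + 6^-1 * (x ^+ 3 * y ^+ 1)
     - 6^-1 * (x ^+ 1 * y ^+ 3) - 12^-1 * (x ^+ 2 * y ^+ 3) - 36^-1 * (x ^+ 3 * y ^+ 3)).
  have n2 : (2 : R[i])^-1 = (2^-1 : R)%:C by rewrite fmorphV /= rmorph_nat.
  have n6 : (6 : R[i])^-1 = (6^-1 : R)%:C by rewrite fmorphV /= rmorph_nat.
  rewrite n2 n6 /cexp /expi /t /r1 /r2 /r3 /= !exprS !expr0; simpc.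
  congr (_ +i* _); by field.
rewrite E; apply: le_trans (rnorm_le_ReIm _) _ => /=.
set N4 := n ^+ 4 in mx m4 r1n r2n r3n *.
have := mx _ _ _ _ (cos_max y) r1n; have := mx _ _ _ _ T3 r2n.
have := mx _ _ _ _ (sin_max y) r1n; have := mx _ _ _ _ T3 r3n.
have ge (a : R) : 0 <= a -> `|a^-1| <= a^-1 by move=> a0; rewrite ger0_norm ?invr_ge0.
have := mx _ _ _ _ (ge 4 (ler0n _ _)) (m4 2 2 erefl).
have := mx _ _ _ _ (ge 12 (ler0n _ _)) (m4 3 2 erefl).
have := mx _ _ _ _ (ge 6 (ler0n _ _)) (m4 3 1 erefl).
have := mx _ _ _ _ (ge 6 (ler0n _ _)) (m4 1 3 erefl).
have := mx _ _ _ _ (ge 12 (ler0n _ _)) (m4 2 3 erefl).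
have := mx _ _ _ _ (ge 36 (ler0n _ _)) (m4 3 3 erefl).
have N0 : 0 <= N4 by rewrite exprn_ge0.
move: (cos y * r1) (_ * r2) (sin y * r1) (_ * r3) (4^-1 * _) (12^-1 * _)
  (6^-1 * (x ^+ 3 * _)) (6^-1 * (x ^+ 1 * _)) (12^-1 * (x ^+ 2 * _)) (36^-1 * _).
move=> u1 u2 u3 u4 u5 u6 u7 u8 u9 u10; rewrite !mul1r !mulr1 => k1 k2 k3 k4 k5 k6 k7 k8 k9 k10.
apply: le_trans (_ : (`|u1| + `|u2| + `|u5| + `|u6|) + (`|u3| + `|u4| + `|u7| + `|u8| + `|u9| + `|u10|) <= _).
  by rewrite lerD // !(le_trans (ler_normB _ _)) ?lerD // ?(le_trans (ler_normB _ _)) ?lerD // ?ler_normD // ?(le_trans (ler_normB _ _)) ?lerD // ?(le_trans (ler_normD _ _)) ?lerD // ler_normD.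
have : 0 <= expR 1 * N4 by rewrite mulr_ge0 ?expR_ge0.
lra.
Qed.

Definition expm1_div (t : R[i]) : R[i] := if t == 0 then 1 else (cexp t - 1) / t.

Lemma expm1_divE t : cexp t = 1 + t * expm1_div t.
Proof.
rewrite /expm1_div; case: eqVneq => [->|t0]; first by rewrite cexp0 mul0r addr0.
by rewrite mulrC divfK // addrC subrK.
Qed.

Lemma jet_expm1_div0 : jet 3 expm1_div (0 : R[i]).
Proof.
have [M HM] := cexp_taylor3.
pose b (t : R[i]) := if t == 0 then 0 else (cexp t - (1 + t + t ^+ 2 / 2 + t ^+ 3 / 6)) / t ^+ 4.
pose f2 (t : R[i]) := 6^-1 + t * b t.
pose f1 (t : R[i]) := 2^-1 + t * f2 t.
exists f1; split.
  exists 1 => // t _; rewrite add0r /expm1_div eqxx /f1 /f2 /b.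
  by case: eqVneq => [->|t0]; [rewrite mul0r addr0|field].
exists f2; split; first by exists 1 => // t _; rewrite add0r {2}/f1 mul0r addr0.
exists b; split; first by exists 1 => // t _; rewrite add0r {2}/f2 mul0r addr0.
exists `|M|, 1; split=> // t t1; rewrite add0r /b.
case: eqVneq => [_|t0]; first by rewrite rnorm0.
have n0 : 0 < rnorm t ^+ 4 by rewrite exprn_gt0 // rnorm_gt0.
rewrite rnormM rnormV rnormX ler_pdivrMr // (le_trans (HM _ t1)) //.
by rewrite ler_wpM2r ?ler_norm // ltW.
Qed.

(** The functional equation moves the expansion from 0 to [w]. Order 3 is where the expansion at 0
    stops, and what [max_principle] asks for. *)
Lemma jet_cexp k w : (k <= 3)%N -> jet k cexp (w : R[i]).
Proof.
move=> k3; apply: (@jet_leq _ k 3) => // {k k3}.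
have J : jet 3 (fun t => 1 + t * expm1_div t) (0 : R[i]).
  by apply: jetD; [apply: jet_cst | apply: jetM; [apply: jet_id | apply: jet_expm1_div0]].
have sub k z : jet k (fun u : R[i] => u - w) z.
  by apply: jetB; [apply: jet_id | apply: jet_cst].
apply: (@jet_ext _ _ (fun z => cexp w * ((fun t => 1 + t * expm1_div t) \o (fun u => u - w)) z)).
  by exists 1 => // t _ /=; rewrite -expm1_divE -cexpD addrC subrK.
by apply: jetZ; apply: jet_comp; rewrite ?subrr.
Qed.

Lemma jet_expm1_div k w : (k <= 3)%N -> jet k expm1_div (w : R[i]).
Proof.
move=> k3; have [->|w0] := eqVneq w 0; first exact: jet_leq k3 jet_expm1_div0.
apply: (@jet_ext _ _ (fun z => (cexp z - 1) * z^-1)).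
  exists (rnorm w); first by rewrite rnorm_gt0.
  move=> t tw; rewrite /expm1_div ifF //; apply/negbTE/eqP => E.
  by move: tw; rewrite -[t](addKr w) E addr0 rnormN ltxx.
apply: jetM; first by apply: jetB; [apply: jet_cexp | apply: jet_cst].
by apply: (@jetV _ k id) => //; apply: jet_id.
Qed.

End ExpJet.

(** * The maximum principle for functions with third-order expansions *)

Section MaximumPrinciple.
Context {R : realType}.
Local Notation C := R[i].

Lemma rnorm_sqr_ge (x y : C) :
  rnorm x ^+ 2 - 2 * rnorm x * rnorm y <= rnorm (x + y) ^+ 2.
Proof.
have [xy|xy] := leP (rnorm y) (rnorm x).
  have := lerB_rnorm x (- y); rewrite opprK rnormN => h.
  apply: le_trans (_ : (rnorm x - rnorm y) ^+ 2 <= _).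
    by have := sqr_ge0 (rnorm y); nra.
  by rewrite lerXn2r // nnegrE ?rnorm_ge0 // subr_ge0.
apply: le_trans (sqr_ge0 _); have := rnorm_ge0 x; nra.
Qed.

(* The first order terms cancel by [t + (- t) = 0] and the second order ones by
   [t ^+ 2 + ('i t) ^+ 2 = 0]. *)
Lemma four_point_sum (a b c : C) (h : R) :
  4 * rnorm a ^+ 2 <=
    rnorm (a + h%:C * (b + h%:C * c)) ^+ 2 + rnorm (a + - h%:C * (b + - h%:C * c)) ^+ 2 +
    rnorm (a + 'i%C * h%:C * (b + 'i%C * h%:C * c)) ^+ 2 +
    rnorm (a + - ('i%C * h%:C) * (b + - ('i%C * h%:C) * c)) ^+ 2.
Proof.
rewrite !sqr_rnorm; case: a b c => [a1 a2] [b1 b2] [c1 c2].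
simpc => /=.
(* The four increments are [h] times the fourth roots of unity, so by Parseval the excess is exactly
   four times the sum of these two terms. *)
have b0 := mulr_ge0 (sqr_ge0 h) (addr_ge0 (sqr_ge0 b1) (sqr_ge0 b2)).
have c0 := mulr_ge0 (sqr_ge0 (h ^+ 2)) (addr_ge0 (sqr_ge0 c1) (sqr_ge0 c2)).
lra.
Qed.

(** If a value [m] exceeded [B], then [|f| ^ 2 + eta * |w| ^ 2] would, for small [eta], take its
    maximum over [K] at an interior point. There the mean over four points at distance [h] exceeds
    the centre value by at least [eta * h ^ 2 - O(h ^ 3)], which is positive for small [h]. *)
Lemma max_principle (K : set (R * R)) (f : C -> C) (B : R) : compact K ->
  (forall s t, K (s, t) -> jet 3 f (s +i* t)) ->
  (forall s t, K (s, t) -> rnorm (f (s +i* t)) <= B \/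
     exists2 r : R, 0 < r &
       forall z : C, rnorm z < r -> K (s + complex.Re z, t + complex.Im z)) ->
  forall s t, K (s, t) -> rnorm (f (s +i* t)) <= B.
Proof.
move=> cK Jf HB s0 t0 K0; rewrite leNgt; apply/negP => Blt.
pose g (q : R * R) := rnorm (f (q.1 +i* q.2)).
pose l (q : R * R) := q.1 ^+ 2 + q.2 ^+ 2.
have K0' : K !=set0 by exists (s0, t0).
have cl : continuous l.
  move=> q; apply: cvgD; rewrite /GRing.exp /=; apply: cvgM; (exact: cvg_fst || exact: cvg_snd).
have cg : {in K, continuous g}.
  move=> [s t]; rewrite inE => /Jf J; apply/cvgrPdist_le => e e0.
  have [r r0 H] := jet_continuous (jet_leq (isT : (1 <= 3)%N) J) e0.
  exists (ball s (r / 2), ball t (r / 2)) => /=.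
    by split; apply: nbhsx_ballx; rewrite divr_gt0.
  move=> [s' t'] [] /= ; rewrite /ball /= => h1 h2.
  rewrite /g /=; have := H ((s' +i* t') - (s +i* t)); rewrite [s +i* t + _]addrC subrK.
  move=> /(_ _)/wrap[].
    apply: le_lt_trans (rnorm_le_ReIm _) _; rewrite /= -normrN opprB.
    by rewrite -(normrN (t' - t)) opprB; lra.
  move=> h; rewrite ler_norml.
  have := lerB_rnorm (f (s' +i* t')) (f (s +i* t)).
  have := lerB_rnorm (f (s +i* t)) (f (s' +i* t')); rewrite (rdistC (f (s +i* t))); lra.
have [pL _ HL] := compact_EVT_max K0' cK (continuous_subspaceT cl).
have {}HL q : K q -> l q <= l pL by move=> Kq; apply: HL; rewrite inE.
have l0 : 0 <= l pL by rewrite addr_ge0 ?sqr_ge0.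
set m := rnorm (f _) in Blt.
have m0 : 0 <= m by exact: rnorm_ge0.
(* Small enough that the perturbation cannot lift a point with [|f| <= B] to the level [m ^ 2]. For
   negative [B] there is no such point, and any [eta] will do. *)
have [eta eta0 Heta] : exists2 eta : R, 0 < eta & 0 <= B -> B ^+ 2 + eta * l pL < m ^+ 2.
  have [Bp|Bn] := leP 0 B; last by exists 1.
  have d0 : 0 < m ^+ 2 - B ^+ 2 by rewrite subr_gt0 ltr_pXn2r ?nnegrE.
  exists ((m ^+ 2 - B ^+ 2) / (l pL + 1)); first by rewrite divr_gt0 // ltr_wpDl.
  by move=> _; rewrite -ltrBrDl mulrAC ltr_pdivrMr ?ltr_wpDl // ltr_pM2l // ltrDl.
pose u q := g q ^+ 2 + eta * l q.
have cu : {within K, continuous u}.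
  apply: continuous_in_subspaceT => q Kq; apply: cvgD.
    by rewrite /GRing.exp /=; apply: cvgM; apply: cg.
  by apply: cvgM; [exact: cvg_cst | exact: cl].
have [s [t [Kst Hmax]]] : exists s t : R, K (s, t) /\ forall q, K q -> u q <= u (s, t).
  have [[s t]] := compact_EVT_max K0' cK cu; rewrite inE => Kst Hmax.
  by exists s, t; split=> // q Kq; apply: Hmax; rewrite inE.
have um : m ^+ 2 <= u (s, t).
  apply: le_trans (Hmax _ K0); rewrite /u lerDl mulr_ge0 ?(ltW eta0) //.
  by rewrite addr_ge0 ?sqr_ge0.
case: (HB _ _ Kst) => [le|[r r0 Hr]].
  have Bp : 0 <= B := le_trans (rnorm_ge0 _) le.
  have lt := Heta Bp.
  have : u (s, t) <= B ^+ 2 + eta * l pL.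
    by apply: lerD; [rewrite lerXn2r ?nnegrE ?rnorm_ge0 | rewrite ler_wpM2l ?(ltW eta0) ?HL].
  by move=> h; have := le_lt_trans um (le_lt_trans h lt); rewrite ltxx.
have [f1 [[r1 r10 H1] [f2 [[r2 r20 H2] [f3 [[r3 r30 H3] [M [r4 [r40 H4]]]]]]]]] := Jf _ _ Kst.
set w := s +i* t in H1 H2 H3 H4.
set a := f w in H1; set b := f1 w in H2; set c := f2 w in H3.
have expand z : rnorm z < r1 -> rnorm z < r2 -> rnorm z < r3 ->
   f (w + z) = a + z * (b + z * c) + z ^+ 3 * f3 (w + z).
  by move=> *; rewrite H1 // H2 // H3 //; ring.
pose A := rnorm a + rnorm b + rnorm c.
have A0 : 0 <= A by rewrite !addr_ge0 ?rnorm_ge0.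
pose D := 2 * A * `|M| + 1.
have D0 : 0 < D by rewrite ltr_wpDl // !mulr_ge0.
(* Below [mn] every expansion is valid, and [eta / D] makes the cubic error [2 * A * |M| * h ^ 3]
   smaller than the gain [eta * h ^ 2]. *)
pose mn := Num.min (Num.min 1 (Num.min r (Num.min r1 r2))) (Num.min (Num.min r3 r4) (eta / D)).
have mn0 : 0 < mn by rewrite !lt_min ltr01 r0 r10 r20 r30 r40 divr_gt0.
pose h : R := mn / 2.
have h0 : 0 < h by rewrite divr_gt0.
have : h < mn by rewrite /h; lra.
rewrite !lt_min => /andP[/and4P[h_1 h_r h_r1 h_r2] /andP[/andP[h_r3 h_r4] h_D]].
have key (z : C) : rnorm z = h ->
   rnorm (a + z * (b + z * c)) ^+ 2 - h ^+ 2 * (h * (2 * A * `|M|)) + eta * l (s + complex.Re z, t + complex.Im z) <= u (s, t).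
  move=> zh; apply: le_trans (Hmax _ (Hr z _)); last by rewrite zh.
  rewrite /u lerD2r /g /=.
  have -> : (s + complex.Re z) +i* (t + complex.Im z) = w + z by case: (z).
  rewrite expand ?zh //; apply: le_trans (rnorm_sqr_ge _ _); rewrite lerD2l lerN2.
  have -> : h ^+ 2 * (h * (2 * A * `|M|)) = (2 * A) * (h ^+ 3 * `|M|) by ring.
  apply: ler_pM; rewrite ?mulr_ge0 ?rnorm_ge0 // ?ler_wpM2l //.
    apply: le_trans (rnormD _ _) _; rewrite /A -addrA lerD2l rnormM zh.
    apply: le_trans (_ : rnorm (b + z * c) <= _).
      by rewrite ler_piMl ?rnorm_ge0 // ltW.
    apply: le_trans (rnormD _ _) _; rewrite lerD2l rnormM zh.
    by rewrite ler_piMl ?rnorm_ge0 // ltW.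
  rewrite rnormM rnormX zh ler_wpM2l ?exprn_ge0 // ?(ltW h0) //.
  by apply: le_trans (ler_norm _); apply: H4; rewrite zh.
have nh : rnorm (h%:C : C) = h by rewrite rnorm_real gtr0_norm.
have nih : rnorm ('i%C * h%:C : C) = h by rewrite rnormM rnormi mul1r.
have := key _ nh; have := key (- h%:C); rewrite rnormN => /(_ nh).
have := key _ nih; have := key (- ('i%C * h%:C)); rewrite rnormN => /(_ nih).
have /= := four_point_sum a b c h.
have : h * (2 * A * `|M|) < eta.
  move: h_D; rewrite ltr_pdivlMr // /D mulrDr mulr1; lra.
rewrite /l /= /u /g /= -/w -/a !(mul0r, mul1r, addr0, add0r, subr0, sub0r, oppr0, mulr0).
move: (h * (2 * A * `|M|)) => e e_eta.
have : h ^+ 2 * e < h ^+ 2 * eta by rewrite ltr_pM2l // exprn_gt0.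
rewrite (_ : l (s, t) = s ^+ 2 + t ^+ 2) //.
move: (rnorm a) (rnorm (a + _)) (rnorm (a + _)) (rnorm (a + _)) (rnorm (a + _)) => *.
lra.
Qed.

End MaximumPrinciple.

(** * Resolvents and Riesz projections *)

Section LinearMaps.
Context {R : realType} {V W : lmodType R[i]} (A : V -> W) (lA : linear A).

Lemma linear_map0 : A 0 = 0.
Proof. by have := lA (-1) 0 0; rewrite scaler0 addr0 scaleN1r addNr. Qed.

Lemma linear_mapZ a x : A (a *: x) = a *: A x.
Proof. by have := lA a x 0; rewrite linear_map0 !addr0. Qed.

Lemma linear_mapD x y : A (x + y) = A x + A y.
Proof. by have := lA 1 x y; rewrite !scale1r. Qed.

Lemma linear_mapB x y : A (x - y) = A x - A y.
Proof. by rewrite -(scaleN1r y) linear_mapD linear_mapZ scaleN1r. Qed.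

Lemma linear_map_sum (I : Type) (r : seq I) (F : I -> V) :
  A (\sum_(i <- r) F i) = \sum_(i <- r) A (F i).
Proof.
elim: r => [|i r IH]; first by rewrite !big_nil linear_map0.
by rewrite !big_cons linear_mapD IH.
Qed.

End LinearMaps.

(** * Unbounded operators and their resolvents *)

Section Operators.
Context {R : realType} {H : normedModType R[i]}.
Local Notation C := R[i].
Implicit Types (T : operator H) (x y v : H) (z w mu : C).

Lemma opnorm_leP (A : H -> H) (M : R) : scalable A -> (opnorm A <= M%:E)%E ->
  forall x, rnorm (A x) <= M * rnorm x.
Proof.
move=> sA hA x.
have [->|x0] := eqVneq x 0.
  by rewrite -(scale0r (0 : H)) sA !scale0r !rnorm0 mulr0.
have n0 : 0 < rnorm x by rewrite rnorm_gt0.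
have u1 : rnorm ((rnorm x)^-1%:C *: x) <= 1.
  by rewrite rnormZ rnorm_real ger0_norm ?invr_ge0 ?rnorm_ge0 // mulVf // gt_eqF.
have : ((rnorm (A ((rnorm x)^-1%:C *: x)))%:E <= M%:E)%E.
  by apply: le_trans hA; apply: ereal_sup_ubound; exists ((rnorm x)^-1%:C *: x).
rewrite lee_fin sA rnormZ rnorm_real ger0_norm ?invr_ge0 ?rnorm_ge0 //.
by rewrite mulrC ler_pdivrMr.
Qed.

Lemma opnorm_le_fin (A : H -> H) (M : R) :
  (forall x, rnorm x <= 1 -> rnorm (A x) <= M) -> (opnorm A <= M%:E)%E.
Proof. by move=> h; apply: ub_ereal_sup => _ [x x1 <-]; rewrite lee_fin h. Qed.

Lemma opnorm_fin_bound (A : H -> H) : scalable A -> (opnorm A < +oo)%E ->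
  exists2 M : R, 0 < M & forall x, rnorm (A x) <= M * rnorm x.
Proof.
move=> sA hA.
have h0 : (0%:E <= opnorm A)%E.
  apply: ereal_sup_ubound; exists 0; first by rewrite /= rnorm0.
  by rewrite -(scale0r (0 : H)) sA scale0r rnorm0.
exists (fine (opnorm A) + 1).
  by apply: ltr_wpDl; [|exact: ltr01]; apply: fine_ge0.
move=> x; apply: (le_trans (@opnorm_leP A (fine (opnorm A)) sA _ x)).
  by rewrite fineK // ge0_fin_numE.
by rewrite ler_wpM2r ?rnorm_ge0 // lerDl.
Qed.

Section OneOperator.
Variable T : operator H.
Local Notation Rs := (resolvent T).

Lemma op_domZ a x : op_dom T x -> op_dom T (a *: x).
Proof. by move=> dx; rewrite -[a *: x]addr0; apply: op_domP => //; apply: op_dom0. Qed.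

Lemma op_domD x y : op_dom T x -> op_dom T y -> op_dom T (x + y).
Proof. by move=> dx dy; rewrite -[x]scale1r; apply: op_domP. Qed.

Lemma op_fun0 : op_fun T 0 = 0.
Proof.
have := op_linear (-1) (op_dom0 T) (op_dom0 T).
by rewrite scaler0 addr0 scaleN1r addNr.
Qed.

Lemma op_funZ a x : op_dom T x -> op_fun T (a *: x) = a *: op_fun T x.
Proof.
by move=> dx; rewrite -[a *: x]addr0 (op_linear a dx (op_dom0 T)) op_fun0 addr0.
Qed.

Lemma op_funD x y : op_dom T x -> op_dom T y -> op_fun T (x + y) = op_fun T x + op_fun T y.
Proof. by move=> dx dy; rewrite -[x in LHS]scale1r op_linear // scale1r. Qed.

(** A relation in place of the function [resolvent], because single equations are also solved at
    points [z] not known to lie in the resolvent set. *)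
Definition resolves z y x := op_dom T x /\ z *: x - op_fun T x = y.

Lemma resolvesP z y y' x x' a : resolves z y x -> resolves z y' x' ->
  resolves z (a *: y + y') (a *: x + x').
Proof.
move=> [dx <-] [dx' <-]; split; first exact: op_domP.
rewrite op_linear // scalerDr scalerBr opprD [RHS]addrACA !scalerA mulrC.
done.
Qed.

Lemma resolvent_sol z y : resolvent_set T z -> resolves z y (Rs z y).
Proof. by move=> [/(_ y)[x [hx _]] _]; apply: xgetPex; exists x. Qed.

Lemma resolvent_uniq z y x : resolvent_set T z -> resolves z y x -> x = Rs z y.
Proof.
move=> rz hx; have := resolvent_sol y rz; case: rz => [/(_ y)[u [_ hu]] _] hy.
by rewrite -(hu _ hx) -(hu _ hy).
Qed.

Lemma resolvent_linear z : resolvent_set T z -> linear (Rs z).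
Proof.
by move=> rz a x y; apply/esym/resolvent_uniq => //; apply: resolvesP; apply: resolvent_sol.
Qed.

Lemma resolvent_bound z : resolvent_set T z ->
  exists2 M : R, 0 < M & forall x, rnorm (Rs z x) <= M * rnorm x.
Proof.
move=> rz; apply: opnorm_fin_bound; last by case: rz.
exact/linear_mapZ/resolvent_linear.
Qed.

Lemma resolvent_id z w x : resolvent_set T z -> resolvent_set T w ->
  Rs z x = Rs w x + (w - z) *: Rs w (Rs z x).
Proof.
move=> rz rw; rewrite addrC -resolvent_linear //; apply: resolvent_uniq => //.
have [dz Ez] := resolvent_sol x rz; split=> //.
by rewrite -[X in _ = _ + X]Ez scalerBl addrA subrK.
Qed.

Lemma resolvent_comm z w x : resolvent_set T z -> resolvent_set T w ->
  Rs z (Rs w x) = Rs w (Rs z x).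
Proof.
move=> rz rw; have [->//|zw] := eqVneq z w.
have h1 := resolvent_id x rz rw; have h2 := resolvent_id x rw rz.
have wz : w - z != 0 by rewrite subr_eq0 eq_sym.
apply: (scalerI wz); apply: (addrI (Rs w x)); rewrite -h1.
by rewrite {1}h2 -addrA -scalerDl addrA subrK subrr scale0r addr0.
Qed.

Lemma eigenvector_spectrum mu v : v != 0 -> op_dom T v -> op_fun T v = mu *: v ->
  spectrum T mu.
Proof.
move=> v0 dv ev rmu; move/eqP: v0; apply.
rewrite (@resolvent_uniq mu 0 v) //; last by split=> //; rewrite ev subrr.
apply/esym/resolvent_uniq => //; split; first exact: op_dom0.
by rewrite op_fun0 scaler0 subrr.
Qed.

Lemma resolvent_eigenvector z mu v : resolvent_set T z -> op_dom T v ->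
  op_fun T v = mu *: v -> z - mu != 0 -> Rs z v = (z - mu)^-1 *: v.
Proof.
move=> rz dv ev zmu; apply/esym/resolvent_uniq => //; split; first exact: op_domZ.
by rewrite op_funZ // ev scalerA mulrC -scalerA -scalerBr -scalerBl scalerA mulVf // scale1r.
Qed.

End OneOperator.
End Operators.

Section RootsOfUnity.
Context {R : realType}.
Local Notation C := R[i].

Definition omega (n : nat) : C := expi (2 * pi / n%:R).

Lemma omegaX n : (0 < n)%N -> omega n ^+ n = 1.
Proof.
move=> n0; rewrite /omega -expiMn -[_ *+ n]mulr_natr divfK ?expi2pi //.
by rewrite pnatr_eq0 -lt0n.
Qed.

Lemma omega_neq1 n m : (0 < m < n)%N -> omega n ^+ m != 1.
Proof.
move=> /andP[m0 mn]; have n0 : (0 < n)%N by apply: leq_trans mn.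
rewrite /omega -expiMn; apply/eqP => -[cE _].
have h : 0 < (2 * pi / n%:R) *+ m :> R.
  by rewrite -mulr_natr mulr_gt0 ?divr_gt0 ?mulr_gt0 ?pi_gt0 ?ltr0n.
have := @cos_eq1 R _ _ cE; rewrite gtr0_norm // => /(_ _)/wrap[].
  rewrite -[_ *+ m]mulr_natr mulrAC ltr_pdivrMr ?ltr0n // ltr_pM2l ?ltr_nat //.
  by rewrite mulr_gt0 ?pi_gt0.
by move=> E; rewrite E ltxx in h.
Qed.

Lemma sum_omega n m : (0 < m < n)%N -> \sum_(k < n) (omega n ^+ k) ^+ m = 0.
Proof.
move=> mn; have /negPf o1 := omega_neq1 mn.
have n0 : (0 < n)%N by case/andP: mn => _; apply: leq_trans.
have /eqP : (omega n ^+ m) ^+ n - 1 = 0 by rewrite -exprM mulnC exprM omegaX // expr1n subrr.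
rewrite subrX1 mulf_eq0 subr_eq0 o1 /= => /eqP E.
by rewrite -[RHS]E; apply: eq_bigr => k _; rewrite -!exprM mulnC.
Qed.

(** Write [u / (u - c)] as [(u ^ n - c ^ n) ^ -1] times the sum of [u ^ (n - i) * c ^ i]. The first
    factor is the same at all nodes, since [u ^ n = v ^ n], and summing over the roots of unity
    removes every term except [i = 0]. *)
Lemma circle_average n (v c : C) : (0 < n)%N -> v ^+ n != c ^+ n ->
  n%:R^-1 * (\sum_(k < n) v * omega n ^+ k / (v * omega n ^+ k - c)) =
  v ^+ n / (v ^+ n - c ^+ n).
Proof.
move=> n0 vc; have D0 : v ^+ n - c ^+ n != 0 by rewrite subr_eq0.
have nn : n%:R != 0 :> C by rewrite pnatr_eq0 -lt0n.
pose u k := v * omega n ^+ k.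
have un k : u k ^+ n = v ^+ n by rewrite exprMn -exprM mulnC exprM omegaX // expr1n mulr1.
have E k : u k / (u k - c) = (v ^+ n - c ^+ n)^-1 * \sum_(i < n) u k ^+ (n - i) * c ^+ i.
  have uc : u k - c != 0.
    by apply: contraNneq vc => /eqP; rewrite subr_eq0 => /eqP <-; rewrite un.
  have -> : (v ^+ n - c ^+ n)^-1 = (u k - c)^-1 / (\sum_(i < n) u k ^+ (n.-1 - i) * c ^+ i).
    by rewrite -(un k) subrXX invfM.
  have S0 : \sum_(i < n) u k ^+ (n.-1 - i) * c ^+ i != 0.
    by move: D0; rewrite -(un k) subrXX mulf_eq0 negb_or => /andP[].
  have -> : \sum_(i < n) u k ^+ (n - i) * c ^+ i =
      u k * \sum_(i < n) u k ^+ (n.-1 - i) * c ^+ i.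
    rewrite mulr_sumr; apply: eq_bigr => i _; rewrite mulrA -exprS.
    by congr (_ ^+ _ * _); rewrite -subSn ?prednK // -ltnS prednK.
  by field; rewrite uc S0.
under eq_bigr => k _ do rewrite -/(u k) E.
rewrite -mulr_sumr exchange_big /=.
have -> : \sum_(i < n) \sum_(k < n) u k ^+ (n - i) * c ^+ i = n%:R * v ^+ n.
  rewrite (bigD1 (Ordinal n0)) //= [X in _ + X]big1 => [|i i0]; last first.
    rewrite -mulr_suml; apply/eqP; rewrite mulf_eq0; apply/orP; left; apply/eqP.
    under eq_bigr => k _ do rewrite /u exprMn.
    rewrite -mulr_sumr sum_omega ?mulr0 //.
    rewrite subn_gt0 ltn_ord /= ltn_subrL n0 andbT.
    by rewrite lt0n; apply: contraNneq i0 => h; apply/eqP/val_inj.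
  under eq_bigr => k _ do rewrite subn0 expr0 mulr1 un.
  by rewrite addr0 sumr_const card_ord mulr_natl.
by field; rewrite D0 nn.
Qed.

End RootsOfUnity.

Section CompactOperators.
Context {R : realType} {H : normedModType R[i]}.
Local Notation C := R[i].

Lemma normr_lt_rnorm (x : H) (e : R) : (`|x| < e%:C) = (rnorm x < e).
Proof. by rewrite rnormE ltcR. Qed.

Lemma compact_operator_net (S : H -> H) : compact_operator S -> forall e : R, 0 < e ->
  exists s : seq H, forall x, rnorm x <= 1 -> exists2 c, c \in s & rnorm (S x - c) < e.
Proof.
rewrite /compact_operator precompactE compact_cover => cS e e0.
have e0' : 0 < e%:C :> C by rewrite ltcR.
have := cS H setT (fun c => ball c e%:C) => -[c _|y _|s _ Hs].
- exact: ball_open.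
- by exists y => //; exact: ballxx.
exists (finmap.enum_fset s) => x x1.
have := Hs (S x) => -[|c cs].
  by apply: subset_closure; exists x.
rewrite -ball_normE /= distrC normr_lt_rnorm => h; by exists c.
Qed.

End CompactOperators.

Section BoundedMaps.
Context {R : realType} {H : normedModType R[i]}.
Implicit Types A B : H -> H.

Definition bounded_map A := exists2 M : R, 0 < M & forall x, rnorm (A x) <= M * rnorm x.

Lemma bounded_id : bounded_map id.
Proof. by exists 1 => // x; rewrite mul1r. Qed.

Lemma bounded_scale (a : R[i]) A : bounded_map A -> bounded_map (fun x => a *: A x).
Proof.
move=> [M M0 h]; have a1 : 0 < rnorm a + 1 by rewrite ltr_wpDl ?rnorm_ge0.
exists ((rnorm a + 1) * M) => [|x]; first by rewrite mulr_gt0.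
by rewrite rnormZ -mulrA ler_pM ?rnorm_ge0 // lerDl.
Qed.

Lemma bounded_add A B : bounded_map A -> bounded_map B -> bounded_map (fun x => A x + B x).
Proof.
move=> [M M0 hA] [M' M'0 hB]; exists (M + M') => [|x]; first by rewrite addr_gt0.
by rewrite mulrDl (le_trans (rnormD _ _)) // lerD.
Qed.

Lemma bounded_sum n (A : 'I_n -> H -> H) : (forall k, bounded_map (A k)) ->
  bounded_map (fun x => \sum_k A k x).
Proof.
elim: n A => [|n IH] A hA.
  by exists 1 => // x; rewrite big_ord0 rnorm0 mul1r rnorm_ge0.
have [M M0 h] := bounded_add (hA ord0) (IH _ (fun k => hA (lift ord0 k))).
by exists M => // x; rewrite big_ord_recl.
Qed.

End BoundedMaps.

(** * Algebraic identities for the Riemann sums of the Riesz integral *)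

Section Average.
Context {R : realType} {H : normedModType R[i]} (T : operator H).
Local Notation C := R[i].
Local Notation Rs := (resolvent T).
Implicit Types (l v z mu : C) (x : H).

(* With [v ^+ n = d ^+ n] and [|v| = d], the Riemann sum of the Riesz integral over
   the circle [|z - l| = d]; formally it equals
   [v ^+ n / (v ^+ n - (T - l) ^+ n)]. *)
Definition circle_sum l v n x : H :=
  n%:R^-1 *: \sum_(k < n) (v * omega n ^+ k) *: Rs (l + v * omega n ^+ k) x.

Definition circle_free l v := forall t : R, resolvent_set T (l + v * expi t).

Lemma circle_freeX l v n k : circle_free l v -> resolvent_set T (l + v * omega n ^+ k).
Proof. by move=> cf; rewrite /omega -expiMn. Qed.

Lemma circle_sum_bound l v n : circle_free l v -> bounded_map (circle_sum l v n).
Proof.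
move=> cf; apply/bounded_scale/bounded_sum => k; apply: bounded_scale.
exact/resolvent_bound/circle_freeX.
Qed.

(** The resolvent identity writes [Rs w] as [Rs z] after [1 + (z - w) Rs w]. When [Rs z] is compact,
    this makes the Riemann sum compact. *)
Lemma circle_sum_factor l v n z : circle_free l v -> resolvent_set T z ->
  exists2 A : H -> H, bounded_map A & forall x, circle_sum l v n x = Rs z (A x).
Proof.
move=> cf rz; have lz := resolvent_linear rz.
pose w k := l + v * omega n ^+ k.
exists (fun x => n%:R^-1 *: \sum_(k < n) (v * omega n ^+ k) *: (x + (z - w k) *: Rs (w k) x)).
  apply/bounded_scale/bounded_sum => k; apply/bounded_scale/bounded_add.
    exact: bounded_id.
  exact/bounded_scale/resolvent_bound/circle_freeX.
move=> x; rewrite (linear_mapZ lz) (linear_map_sum lz); congr (_ *: _).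
apply: eq_bigr => k _; rewrite (linear_mapZ lz) (linear_mapD lz) (linear_mapZ lz).
by rewrite -resolvent_id //; apply: circle_freeX.
Qed.

Lemma circle_sum_comm l v n z x : circle_free l v -> resolvent_set T z ->
  circle_sum l v n (Rs z x) = Rs z (circle_sum l v n x).
Proof.
move=> cf rz; have lz := resolvent_linear rz.
rewrite /circle_sum (linear_mapZ lz) (linear_map_sum lz); congr (_ *: _); apply: eq_bigr => k _.
by rewrite (linear_mapZ lz) resolvent_comm //; apply: circle_freeX.
Qed.

Lemma circle_sum_eigenvector l v n mu x : circle_free l v -> (0 < n)%N ->
  op_dom T x -> op_fun T x = mu *: x -> v ^+ n != (mu - l) ^+ n ->
  circle_sum l v n x = (v ^+ n / (v ^+ n - (mu - l) ^+ n)) *: x.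
Proof.
move=> cf n0 dx ex vm; rewrite -circle_average // /circle_sum -scalerA; congr (_ *: _).
rewrite scaler_suml; apply: eq_bigr => k _.
have E : l + v * omega n ^+ k - mu = v * omega n ^+ k - (mu - l) by rewrite opprB addrC addrA addrAC -addrA addrC; ring.
rewrite (@resolvent_eigenvector _ _ _ _ mu) // ?E; first by rewrite scalerA.
  exact: circle_freeX.
apply: contraNneq vm => /eqP; rewrite subr_eq0 => /eqP <-.
by rewrite exprMn -exprM mulnC exprM omegaX // expr1n mulr1.
Qed.

(** Formally, with [X = (T - l) ^ n / u ^ n], this is the partial fraction [1 / ((1 - X) (1 + X)) =
    (1 / (1 - X) + 1 / (1 + X)) / 2]. The condition on [v] keeps the two sets of nodes disjoint, so
    the resolvent identity applies to every pair of nodes, and [circle_average] evaluates the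
    resulting weights. *)
Lemma circle_sumM l u v n x : circle_free l u -> circle_free l v -> (0 < n)%N ->
  u != 0 -> v ^+ n = - u ^+ n ->
  circle_sum l u n (circle_sum l v n x) =
  2^-1 *: (circle_sum l u n x + circle_sum l v n x).
Proof.
move=> cu cv n0 u0 uv.
have un0 : u ^+ n != 0 by rewrite expf_neq0.
pose U (j : 'I_n) := u * omega n ^+ j; pose V (k : 'I_n) := v * omega n ^+ k.
have Un j : U j ^+ n = u ^+ n by rewrite exprMn -exprM mulnC exprM omegaX // expr1n mulr1.
have Vn j : V j ^+ n = v ^+ n by rewrite exprMn -exprM mulnC exprM omegaX // expr1n mulr1.
have two : 2 * u ^+ n != 0 by rewrite mulf_neq0 // pnatr_eq0.
have UV j k : V k - U j != 0.
  rewrite subr_eq0; apply/eqP => E; move/eqP: two; apply.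
  by rewrite mulr_natl mulr2n -{1}(Un j) -E Vn uv addNr.
have hV j : n%:R^-1 * (\sum_k V k / (V k - U j)) = 2^-1.
  rewrite circle_average // ?Un uv; last first.
    by rewrite -subr_eq0 -opprD oppr_eq0 -mulr2n -mulr_natl.
  have -> : - u ^+ n - u ^+ n = - (2 * u ^+ n) by ring.
  by field; rewrite ?un0 ?pnatr_eq0.
have hU k : n%:R^-1 * (\sum_j U j / (V k - U j)) = - 2^-1.
  have -> : \sum_j U j / (V k - U j) = - \sum_j U j / (U j - V k).
    by rewrite -sumrN; apply: eq_bigr => j _; rewrite -(opprB (U j)) invrN mulrN.
  rewrite mulrN circle_average // ?Vn uv; last first.
    by rewrite -subr_eq0 opprK -mulr2n -mulr_natl.
  have -> : u ^+ n - - u ^+ n = 2 * u ^+ n by ring.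
  by field; rewrite ?un0 ?pnatr_eq0.
have RR j k : Rs (l + U j) (Rs (l + V k) x) = (V k - U j)^-1 *: (Rs (l + U j) x - Rs (l + V k) x).
  have ru : resolvent_set T (l + U j) by apply: circle_freeX.
  have rv : resolvent_set T (l + V k) by apply: circle_freeX.
  have := resolvent_id x ru rv; rewrite resolvent_comm // => ->.
  by rewrite addrAC subrr add0r opprD addrACA subrr add0r scalerA mulVf // scale1r.
have Rl j (F : 'I_n -> H) (a : 'I_n -> C) :
    Rs (l + U j) (\sum_k a k *: F k) = \sum_k a k *: Rs (l + U j) (F k).
  have lz := resolvent_linear (circle_freeX n j cu).
  by rewrite (linear_map_sum lz); apply: eq_bigr => k _; rewrite (linear_mapZ lz).
rewrite {1 2}/circle_sum.
under eq_bigr => j _ do rewrite (linear_mapZ (resolvent_linear (circle_freeX n j cu))) Rl.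
have -> : \sum_(j < n) U j *: (n%:R^-1 *: \sum_(k < n) V k *: Rs (l + U j) (Rs (l + V k) x)) =
  \sum_(j < n) \sum_(k < n) ((n%:R^-1 * U j * V k / (V k - U j)) *: Rs (l + U j) x) -
  \sum_(k < n) \sum_(j < n) ((n%:R^-1 * V k * U j / (V k - U j)) *: Rs (l + V k) x).
  rewrite [X in _ = _ - X]exchange_big -sumrB; apply: eq_bigr => j _.
  rewrite !scaler_sumr -sumrB; apply: eq_bigr => k _.
  rewrite RR !scalerA scalerBr; congr (_ *: _ - _ *: _); ring.
under eq_bigr => j _ do rewrite -scaler_suml.
under [X in _ - X]eq_bigr => j _ do rewrite -scaler_suml.
have -> : \sum_(j < n) (\sum_(k < n) n%:R^-1 * U j * V k / (V k - U j)) *: Rs (l + U j) x =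
   2^-1 *: \sum_(j < n) U j *: Rs (l + U j) x.
  rewrite scaler_sumr; apply: eq_bigr => j _; rewrite scalerA -(hV j); congr (_ *: _).
  by rewrite mulr_sumr mulr_suml; apply: eq_bigr => k _; ring.
have -> : \sum_(k < n) (\sum_(j < n) n%:R^-1 * V k * U j / (V k - U j)) *: Rs (l + V k) x =
   - (2^-1 *: \sum_(k < n) V k *: Rs (l + V k) x).
  rewrite scaler_sumr -sumrN; apply: eq_bigr => k _.
  rewrite scalerA -scaleNr -mulNr -(hU k); congr (_ *: _).
  by rewrite mulr_sumr mulr_suml; apply: eq_bigr => j _; ring.
by rewrite opprK /circle_sum -!scalerDr !scalerA mulrC.
Qed.

End Average.

Section Dist.
Context {R : realType}.
Local Notation C := R[i].
Implicit Types (A : set C) (z w : C).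

Lemma dist_le z w A : A w -> dist z A <= rnorm (z - w).
Proof.
move=> Aw; apply: ge_inf; last by exists w.
by exists 0 => _ [v _ <-]; apply: rnorm_ge0.
Qed.

Lemma dist_ge0 z A : 0 <= dist z A.
Proof.
have [[w Aw]|nA] := pselect (exists w, A w).
  by apply: lb_le_inf => [|_ [v _ <-]]; [exists (rnorm (z - w)), w | apply: rnorm_ge0].
rewrite /dist (_ : [set _ | _ in A] = set0) ?inf0 //.
by apply/seteqP; split=> // x [w Aw _]; apply: nA; exists w.
Qed.

End Dist.

(** Limits are taken through this lemma; the restriction [e <= 1] lets products of errors be
    estimated linearly in [e]. *)
Lemma le0_eps (R : realType) (a M : R) :
  (forall e, 0 < e -> e <= 1 -> a <= e * M) -> a <= 0.
Proof.
move=> h; rewrite leNgt; apply/negP => a0.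
have M0 : 0 < M by have := h 1 ltr01 (lexx _); rewrite mul1r; apply: lt_le_trans.
pose e := Num.min 1 (a / M / 2).
have e0 : 0 < e by rewrite lt_min ltr01 !divr_gt0.
have := h e e0; rewrite ge_min lexx /= => /(_ isT).
have : e * M <= a / 2.
  by rewrite -ler_pdivlMr // mulrAC /e ge_min lexx orbT.
lra.
Qed.

(** * Riesz projections as limits of Riemann sums *)

Section RieszProjection.
Context {R : realType} {H : normedModType R[i]} (T : operator H).
Local Notation C := R[i].
Local Notation Rs := (resolvent T).
Implicit Types (l v z mu : C) (x : H).

(** Convergence is asked uniformly in the rotation [tau] of the nodes by a fraction of the mesh:
    idempotence compares the sums for [tau = 0] and [tau = 1 / 2]. *)
Definition riesz_limit l (d : R) (P : H -> H) :=
  forall e : R, 0 < e -> exists n0, forall n, (n0 <= n)%N -> forall tau : R, 0 <= tau <= 1 ->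
    forall x, rnorm (circle_sum T l (d%:C * expi (2 * pi * tau / n%:R)) n x - P x) <= e * rnorm x.

(** Rotating the nodes moves each tag inside its own cell and leaves the partition as it is, so all
    rotated sums are Riemann sums of one fine partition. *)
Lemma uniform_partition (e : R) : 0 < e -> exists n0, forall n, (n0 <= n)%N ->
  (0 < n)%N /\ forall tau : R, 0 <= tau <= 1 -> tagged_partition 0 (2 * pi) e n
    (fun i => 2 * pi * i%:R / n%:R) (fun i => 2 * pi * tau / n%:R + 2 * pi * i%:R / n%:R).
Proof.
move=> e0; have pi0 := pi_gt0 R.
exists (Num.bound (2 * pi / e)).+1 => n hn; have n0 : (0 < n)%N by apply: leq_trans hn.
have nR : 0 < n%:R :> R by rewrite ltr0n.
split=> // tau /andP[t0 t1]; split.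
- by rewrite mulr0 mul0r.
- by rewrite mulfK // gt_eqF.
move=> i _; have c0 : 0 <= 2 * pi / n%:R :> R by rewrite divr_ge0 // ?mulr_ge0 // ltW.
have -> : 2 * pi * tau / n%:R = (2 * pi / n%:R) * tau by rewrite mulrAC.
have E j : 2 * pi * j%:R / n%:R = (2 * pi / n%:R) * j%:R :> R by rewrite mulrAC.
have ce : 2 * pi / n%:R < e.
  rewrite ltr_pdivrMr // -ltr_pdivrMl // mulrC.
  apply: lt_le_trans (_ : (Num.bound (2 * pi / e))%:R <= _); last by rewrite ler_nat ltnW.
  by apply: archi_boundP; rewrite divr_ge0 // ?mulr_ge0 // ltW.
rewrite !E; move: (2 * pi / n%:R) c0 ce => c c0 ce; rewrite -[i.+1%:R]natr1 mulrDr mulr1; split.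
- by rewrite lerDr mulr_ge0.
- by rewrite addrC lerD2l ler_piMr.
- by rewrite addrAC subrr add0r.
Qed.

Lemma spectrum_dist l mu : spectrum T mu -> mu != l ->
  dist l (spectrum T `\ l) <= rnorm (mu - l).
Proof. by move=> smu ml; rewrite rdistC; apply: dist_le; split=> //; apply/eqP. Qed.

Lemma riesz_circle_free l (d : R) : d = dist l (spectrum T `\ l) / 2 -> 0 < d ->
  circle_free T l d%:C.
Proof.
move=> dE d0 t; apply: contrapT => nr.
have tn : rnorm (d%:C * expi t) = d by rewrite rnormM rnorm_expi mulr1 rnorm_real gtr0_norm.
have := @spectrum_dist l (l + d%:C * expi t) nr.
rewrite addrAC subrr add0r tn -subr_eq0 addrAC subrr add0r -rnorm_eq0 tn gt_eqF // => /(_ isT).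
lra.
Qed.

(** The integral is not shown to exist. If it does not, the default value of [op_RInt] makes the
    projection 0; so does a radius 0, which occurs for instance when [spectrum T] has no other
    point, the infimum of the empty set being 0. What is needed later holds trivially for 0. *)
Lemma riesz_proj_dichotomy l (d : R) : d = dist l (spectrum T `\ l) / 2 ->
  (forall x, riesz_proj T l x = 0) \/
  [/\ 0 < d, linear (riesz_proj T l) & riesz_limit l d (riesz_proj T l)].
Proof.
move=> dE; rewrite /riesz_proj -dE.
have d0 : 0 <= d by rewrite dE divr_ge0 ?dist_ge0.
rewrite /circle_int /op_RInt; pose g (t : R) (x : H) := (d%:C * 'i%C * expi t) *: Rs (l + d%:C * expi t) x.
rewrite -/g.
have [[Q hQ]|nQ] := pselect (exists Q, is_op_RInt g 0 (2 * pi) Q); last first.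
  by left=> x; rewrite xgetPN ?scaler0 // => Q hQ; apply: nQ; exists Q.
have {hQ} [lQ hQ] : is_op_RInt g 0 (2 * pi) (xget (fun=> 0) [set Q | is_op_RInt g 0 (2 * pi) Q]).
  by apply: (@xgetPex _ _ [set Q | is_op_RInt g 0 (2 * pi) Q]); exists Q.
move: (xget _ _) lQ hQ => {}Q lQ hQ.
have lg t : linear (g t).
  have [d00|dn] := eqVneq d 0.
    by move=> a x y; rewrite /g d00 !mul0r !scale0r scaler0 addr0.
  move=> a x y; rewrite /g (resolvent_linear (riesz_circle_free dE _ t)); last by rewrite lt_neqAle eq_sym dn.
  by rewrite scalerDr !scalerA mulrC.
have approx (e : R) : 0 < e -> exists n0, forall n, (n0 <= n)%N -> (0 < n)%N /\
    forall tau : R, 0 <= tau <= 1 -> forall x,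
    rnorm (\sum_(i < n) (2 * pi / n%:R)%:C *: g (2 * pi * tau / n%:R + 2 * pi * i%:R / n%:R) x - Q x)
      <= e * rnorm x.
  move=> e0; have [del del0 Hdel] := hQ _ e0.
  have [n0 Hn0] := uniform_partition del0.
  exists n0 => n /Hn0[n1 Hn]; split=> // tau t1 x.
  have sA s t : scalable (fun y => \sum_(i < n) (s i.+1 - s i : R)%:C *: g (t i) y - Q y).
    move=> a y; rewrite (linear_mapZ lQ) scalerBr; congr (_ - _).
    rewrite scaler_sumr; apply: eq_bigr => i _.
    by rewrite (linear_mapZ (lg _)) !scalerA [a * _]mulrC.
  apply: le_trans (opnorm_leP (sA _ _) (Hdel n _ _ (Hn tau t1)) x).
  rewrite le_eqVlt; apply/orP; left; apply/eqP; congr (rnorm (_ - _)).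
  apply: eq_bigr => i _; congr (_%:C *: _).
  by rewrite -mulrBl -mulrBr -[i.+1%:R]natr1 addrAC subrr add0r mulr1.
have c0 : (2 * pi)%:C * 'i%C != 0 :> C.
  by rewrite -rnorm_eq0 rnormM rnormi mulr1 rnorm_real normr_eq0 mulf_neq0 ?pnatr_eq0 // gt_eqF // pi_gt0.
have [d00|dn] := eqVneq d 0.
  left=> x; have Qx : Q x = 0.
    apply/eqP; rewrite -rnorm_eq0 eq_le rnorm_ge0 andbT.
    apply: (@le0_eps _ _ (rnorm x)) => e e0 _; have [n0 Hn0] := approx e e0.
    have [n1 /(_ 0)] := Hn0 _ (leqnn _); rewrite lexx ler01 => /(_ isT x).
    by rewrite big1 ?sub0r ?rnormN // => i _; rewrite /g d00 !mul0r scale0r scaler0.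
  by rewrite Qx scaler0.
have dp : 0 < d by rewrite lt_neqAle eq_sym dn.
right; split=> //.
  by move=> a x y; rewrite lQ scalerDr !scalerA mulrC.
move=> e e0; pose c := rnorm (((2 * pi)%:C * 'i%C)^-1 : C).
have cp : 0 < c by rewrite /c rnorm_gt0 invr_eq0.
have [n0 Hn0] := approx (e / c) (divr_gt0 e0 cp).
exists n0 => n /Hn0[n1 Hn] tau t1 x.
have := Hn tau t1 x; rewrite [e / c * _]mulrAC ler_pdivlMr // [_ * c]mulrC /c -rnormZ scalerBr => le.
apply: le_trans le; rewrite le_eqVlt; apply/orP; left; apply/eqP; congr (rnorm (_ - _)).
rewrite /circle_sum !scaler_sumr; apply: eq_bigr => i _.
have E : d%:C * expi (2 * pi * tau / n%:R) * omega n ^+ i =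
   d%:C * expi (2 * pi * tau / n%:R + 2 * pi * i%:R / n%:R).
  rewrite -mulrA expiD /omega -expiMn; congr (_ * (_ * expi _)).
  by rewrite -[_ *+ i]mulr_natr mulrAC.
rewrite E !scalerA; congr (_ *: _).
rewrite !rmorphM /= fmorphV /= !rmorph_nat.
have n2 : n%:R != 0 :> C by rewrite pnatr_eq0 -lt0n.
have pi2 : pi%:C != 0 :> C by rewrite -rnorm_eq0 rnorm_real normr_eq0 gt_eqF ?pi_gt0.
have i2 : 'i%C != 0 :> C by rewrite -rnorm_eq0 rnormi oner_neq0.
move: (expi _) (pi%:C) 'i%C (n%:R) pi2 i2 n2 => w a b m a0 b0 m0.
by field; rewrite m0 a0 b0.
Qed.

Section Limit.
Variables (l : C) (d : R) (P : H -> H).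
Hypotheses (dE : d = dist l (spectrum T `\ l) / 2) (d0 : 0 < d)
  (lP : linear P) (limP : riesz_limit l d P).

Let cf : circle_free T l d%:C := riesz_circle_free dE d0.

Lemma circle_free_rot s : circle_free T l (d%:C * expi s).
Proof. by move=> t; rewrite -mulrA -expiD. Qed.

Lemma riesz_limit0 (e : R) : 0 < e -> exists n0, forall n, (n0 <= n)%N ->
  forall x, rnorm (circle_sum T l d%:C n x - P x) <= e * rnorm x.
Proof.
move=> /limP[n0 Hn]; exists n0 => n /Hn /(_ 0); rewrite lexx ler01 => /(_ isT) h x.
by have := h x; rewrite mulr0 mul0r expi0 mulr1.
Qed.

Lemma riesz_bounded : bounded_map P.
Proof.
have [n0 /(_ n0 (leqnn _)) h] := riesz_limit0 ltr01.
have [M M0 HM] := circle_sum_bound n0 cf.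
exists (M + 1) => [|x]; first by rewrite addr_gt0.
have := h x; have := HM x; have := lerB_rnorm (P x) (circle_sum T l d%:C n0 x).
rewrite rdistC mulrDl; lra.
Qed.

(** For [tau = 1 / 2] the rotated nodes satisfy [v ^ n = - d ^ n], so [circle_sumM] turns the
    product of the two sums into their mean. In the limit the product gives [P P] and the mean gives
    [P]. *)
Lemma riesz_idem x : P (P x) = P x.
Proof.
have [M M0 HM] := riesz_bounded.
apply/eqP; rewrite -subr_eq0 -rnorm_eq0 eq_le rnorm_ge0 andbT.
apply: (@le0_eps _ _ ((2 * M + 2) * rnorm x)) => e e0 e1.
have [n0 Hn] := limP e0; pose n := n0.+1.
have t0 : 0 <= (0 : R) <= 1 by rewrite lexx ler01.
have t1 : 0 <= (2^-1 : R) <= 1 by lra.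
have := Hn n (leqnSn _) _ t0; have := Hn n (leqnSn _) _ t1.
rewrite mulr0 mul0r expi0 mulr1; set v := d%:C * expi _ => hv hu.
have vn : v ^+ n = - d%:C ^+ n.
  rewrite /v exprMn -expiMn -[_ *+ n]mulr_natr divfK ?pnatr_eq0 //.
  rewrite mulrAC divff ?pnatr_eq0 // mul1r.
  by rewrite -[pi]add0r expiDpi expi0 mulrN1.
have cv : circle_free T l v := @circle_free_rot _.
have dn0 : d%:C != 0 :> C by rewrite -rnorm_eq0 rnorm_real normr_eq0 gt_eqF.
have FG := circle_sumM x cf cv (isT : (0 < n)%N) dn0 vn.
set F := circle_sum T l d%:C n in FG hu; set G := circle_sum T l v n in FG hv.
have -> : P (P x) - P x = - P (G x - P x) - (F (G x) - P (G x))
    + 2^-1 *: ((F x - P x) + (G x - P x)).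
  have -> : 2^-1 *: ((F x - P x) + (G x - P x)) = F (G x) - P x.
    rewrite FG addrACA -opprD scalerDr scalerN -[P x + P x]mulr2n -[P x *+ 2]scaler_nat scalerA.
    by rewrite mulVf ?scale1r // pnatr_eq0.
  by rewrite (linear_mapB lP) !opprB !addrA !subrK.
apply: le_trans (rnormD _ _) _; rewrite rnormZ.
have h2 : rnorm (2^-1 : C) = 2^-1.
  by rewrite rnormV (_ : (2 : C) = 2%:C) ?rnorm_real ?ger0_norm // rmorph_nat.
rewrite h2.
have g1 := hv x; have g2 := hu x; have g3 := hu (G x).
have g4 := HM (G x - P x).
have g5 : rnorm (G x) <= (M + 1) * rnorm x.
  have := lerB_rnorm (G x) (P x); have := HM x; have := rnorm_ge0 x; rewrite mulrDl.
  by move: e1 g1; nra.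
have := rnormB (- P (G x - P x)) (F (G x) - P (G x)).
have := rnormD (F x - P x) (G x - P x).
rewrite rnormN; have := rnorm_ge0 x.
have : M * rnorm (G x - P x) <= M * (e * rnorm x) by rewrite ler_pM2l.
have : e * rnorm (G x) <= e * ((M + 1) * rnorm x) by rewrite ler_pM2l.
lra.
Qed.

Lemma riesz_comm z x : resolvent_set T z -> P (Rs z x) = Rs z (P x).
Proof.
move=> rz; have [M M0 HM] := resolvent_bound rz.
apply/eqP; rewrite -subr_eq0 -rnorm_eq0 eq_le rnorm_ge0 andbT.
apply: (@le0_eps _ _ (2 * M * rnorm x)) => e e0 _.
have [n0 /(_ n0 (leqnn _)) h] := riesz_limit0 e0.
have := h (Rs z x); rewrite circle_sum_comm //; have := h x; have := HM x.
have := HM (circle_sum T l d%:C n0 x - P x); rewrite (linear_mapB (resolvent_linear rz)).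
set y := Rs z (circle_sum _ _ _ _ _) => h1 h2 h3 h4.
have -> : P (Rs z x) - Rs z (P x) = (y - Rs z (P x)) - (y - P (Rs z x)).
  by rewrite opprB [RHS]addrC addrA subrK.
apply: le_trans (rnormB _ _) _.
have : e * rnorm (Rs z x) <= e * (M * rnorm x) by rewrite ler_pM2l.
have : M * rnorm (circle_sum T l d%:C n0 x - P x) <= M * (e * rnorm x) by rewrite ler_pM2l.
lra.
Qed.

(** As [d] is half a distance, [mu] is at least [2 * d] away from [l], so the Riemann sum multiplies
    [x] by at most [1 / (2 ^ n - 1) <= 1 / n]. *)
Lemma riesz_eigenvector0 mu x : op_dom T x -> op_fun T x = mu *: x -> mu != l -> P x = 0.
Proof.
move=> dx ex ml; have [->|x0] := eqVneq x 0; first exact: linear_map0.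
have := spectrum_dist (eigenvector_spectrum x0 dx ex) ml => hd.
have hd2 : 2 * d <= rnorm (mu - l) by rewrite dE; lra.
apply/eqP; rewrite -rnorm_eq0 eq_le rnorm_ge0 andbT.
apply: (@le0_eps _ _ (2 * rnorm x)) => e e0 _.
have [n0 Hn] := riesz_limit0 e0.
pose n := maxn n0 (Num.bound e^-1).+1.
have n1 : (0 < n)%N by rewrite leq_max orbT.
have ne : e^-1 < n%:R.
  apply: lt_le_trans (archi_boundP _) _; first by rewrite invr_ge0 ltW.
  by rewrite ler_nat leq_max leqnSn orbT.
have big : 2 ^+ n * d ^+ n <= rnorm ((mu - l) ^+ n).
  by rewrite rnormX -exprMn lerXn2r // nnegrE ?rnorm_ge0 // mulr_ge0 // ltW.
have dn : 0 < d ^+ n by rewrite exprn_gt0.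
have n2 : n%:R + 1 <= 2 ^+ n :> R.
  by rewrite -natrX -(natrD _ n 1) ler_nat addn1 ltn_expl.
have rd : rnorm (d%:C ^+ n : C) = d ^+ n by rewrite rnormX rnorm_real gtr0_norm.
have lb : n%:R * d ^+ n <= rnorm (d%:C ^+ n - (mu - l) ^+ n).
  have := lerB_rnorm ((mu - l) ^+ n) (d%:C ^+ n); rewrite rdistC rd.
  have : (n%:R + 1) * d ^+ n <= 2 ^+ n * d ^+ n by rewrite ler_pM2r.
  lra.
have np : 0 < n%:R * d ^+ n by rewrite mulr_gt0 // ltr0n.
have ne0 : d%:C ^+ n != (mu - l) ^+ n.
  by rewrite -subr_eq0 -rnorm_gt0; apply: lt_le_trans lb.
have := Hn n (leq_maxl _ _) x; rewrite (circle_sum_eigenvector cf n1 dx ex ne0).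
set a := _ / _ => h; have ha : rnorm a <= e.
  rewrite /a rnormM rnormV rd.
  apply: le_trans (_ : d ^+ n / (n%:R * d ^+ n) <= _).
    rewrite ler_pM2l // lef_pV2 ?posrE //; exact: lt_le_trans lb.
  rewrite invfM mulrCA divff ?gt_eqF // mulr1.
  by rewrite -[leRHS]invrK lef_pV2 ?posrE ?invr_gt0 ?ltr0n // ltW.
have := lerB_rnorm (P x) (a *: x); rewrite rdistC rnormZ.
have : rnorm a * rnorm x <= e * rnorm x by rewrite ler_wpM2r ?rnorm_ge0.
lra.
Qed.

End Limit.
End RieszProjection.

Section PolynomialAction.
Context {R : realType} {V : lmodType R[i]} (S : V -> V) (lS : linear S).
Local Notation C := R[i].
Implicit Types (p q : {poly C}) (x : V).

(** This is [p(S) x]. *)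
Definition pact p x : V := \sum_(i < size p) p`_i *: iter i S x.

Lemma pact_widen n p x : (size p <= n)%N -> pact p x = \sum_(i < n) p`_i *: iter i S x.
Proof.
move=> pn; rewrite /pact (big_ord_widen _ (fun i => p`_i *: iter i S x) pn).
rewrite big_mkcond; apply: eq_bigr => i _; case: ltnP => // h.
by rewrite nth_default // scale0r.
Qed.

Lemma iter_linear i : linear (iter i S).
Proof. by elim: i => [|i IH] a x y //; rewrite !iterS IH lS. Qed.

Lemma pact_linear p : linear (pact p).
Proof.
move=> a x y; rewrite /pact scaler_sumr -big_split; apply: eq_bigr => i _ /=.
by rewrite iter_linear scalerDr !scalerA mulrC.
Qed.

Lemma pactB p q x : pact (p - q) x = pact p x - pact q x.
Proof.
pose n := (size p + size q + size (p - q)%R)%N.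
have hp : (size p <= n)%N by rewrite /n -addnA leq_addr.
have hq : (size q <= n)%N by rewrite /n addnAC leq_addl.
have hpq : (size (p - q)%R <= n)%N by rewrite /n leq_addl.
rewrite (pact_widen x hp) (pact_widen x hq) (pact_widen x hpq) -sumrB.
by apply: eq_bigr => i _; rewrite coefB scalerBl.
Qed.

Lemma pactXM q x : pact ('X * q) x = pact q (S x).
Proof.
have sz : (size ('X * q)%R <= (size q).+1)%N.
  by rewrite (leq_trans (size_polyMleq _ _)) // size_polyX.
rewrite (pact_widen _ sz) big_ord_recl coefXM /= scale0r add0r.
by apply: eq_bigr => i _; rewrite coefXM /= -iterS iterSr.
Qed.

Lemma pactCM z q x : pact (z%:P * q) x = pact q (z *: x).
Proof.
have sz : (size (z%:P * q)%R <= size q)%N.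
  by rewrite mul_polyC size_scale_leq.
rewrite (pact_widen _ sz); apply: eq_bigr => i _.
by rewrite coefCM (linear_mapZ (iter_linear i)) scalerA mulrC.
Qed.

Lemma pact_XsubC q z x : pact (('X - z%:P) * q) x = pact q (S x - z *: x).
Proof. by rewrite mulrBl pactB pactXM pactCM (linear_mapB (pact_linear q)). Qed.

(** Over the complex numbers [p] splits into linear factors. A factor [S - s] with [s != s0] is
    injective on the invariant subspace [M] and cancels, leaving a power of [S - s0]. *)
Lemma pact_nilpotent (M : set V) (s0 : C) p x :
  (forall a x y, M x -> M y -> M (a *: x + y)) -> (forall x, M x -> M (S x)) ->
  (forall s v, s != s0 -> M v -> S v = s *: v -> v = 0) ->
  p != 0 -> M x -> pact p x = 0 -> exists k, iter k (fun v => S v - s0 *: v) x = 0.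
Proof.
move=> Mlin MS Mev p0 Mx; have [r E] := closed_field_poly_normal p.
have l0 : lead_coef p != 0 by rewrite lead_coef_eq0.
rewrite E -mul_polyC pactCM (linear_mapZ (pact_linear _)) => /eqP.
rewrite scaler_eq0 (negPf l0) /= => /eqP.
have MD z y : M y -> M (S y - z *: y).
  by move=> My; rewrite addrC -scaleNr; apply: Mlin => //; apply: MS.
have lD z : linear (fun v => S v - z *: v).
  by move=> a u v /=; rewrite lS scalerDr scalerBr !scalerA [z * a]mulrC opprD addrACA.
elim: r x Mx {p p0 l0 E} => [|z r IH] x Mx.
  by rewrite big_nil /pact size_poly1 big_ord1 coef1 scale1r => x0; exists 0.
rewrite big_cons pact_XsubC => /(IH _ (MD _ _ Mx))[k Hk].
have [zs|zs] := eqVneq z s0; first by exists k.+1; rewrite iterSr -zs -[RHS]Hk zs.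
exists k; apply: (Mev z) => //.
  by elim: (k) => [|j Mj] //=; apply: MD.
apply/eqP; rewrite -subr_eq0; apply/eqP; rewrite -[RHS]Hk.
elim: (k) => [|j Ej] //=; rewrite -Ej.
by rewrite !(linear_mapB lS) !(linear_mapZ lS) !scalerBr !scalerA !opprB [z * s0]mulrC
  addrACA [RHS]addrACA; congr (_ + _); exact: addrC.
Qed.

End PolynomialAction.

Section Hilbert.
Context {R : realType} {H : normedModType R[i]} (dot : {dot H for Num.conj}).
Local Notation C := R[i].
Hypothesis hH : forall x : H, `|x| ^+ 2 = dot x x.
Implicit Types (x y : H).

Lemma dot_sqr x : dot x x = (rnorm x ^+ 2)%:C.
Proof. by rewrite -hH rnormE rmorphXn. Qed.

Lemma dot_pythagoras x y : dot x y = 0 -> rnorm (x + y) ^+ 2 = rnorm x ^+ 2 + rnorm y ^+ 2.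
Proof.
move=> xy; apply: (@complexI R); rewrite rmorphD /= -!dot_sqr.
by rewrite (hnormDd xy).
Qed.

Lemma cauchy_schwarz x y : rnorm (dot x y) <= rnorm x * rnorm y.
Proof.
have [->|y0] := eqVneq y 0; first by rewrite linear0r !rnorm0 mulr0.
have n0 : 0 < rnorm y by rewrite rnorm_gt0.
pose a := dot x y / dot y y; pose u := x - a *: y.
have dy : dot y y != 0 by rewrite dot_sqr -rnorm_eq0 rnorm_real normr_eq0 expf_neq0 // gt_eqF.
have uy : dot u y = 0 by rewrite /u linearBl linearZl_LR /= divfK // subrr.
have uay : dot u (a *: y) = 0 by rewrite linearZr_LR /= uy mulr0.
have := dot_pythagoras uay; rewrite /u subrK => E.
have : rnorm (a *: y) ^+ 2 <= rnorm x ^+ 2 by rewrite E lerDr sqr_ge0.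
rewrite ler_pXn2r ?nnegrE ?rnorm_ge0 // rnormZ /a rnormM rnormV dot_sqr rnorm_real.
rewrite ger0_norm ?sqr_ge0 // expr2 invfM mulrA mulfVK ?gt_eqF //.
by rewrite ler_pdivrMr.
Qed.

Lemma rnorm_le_dot x (B : R) : 0 <= B ->
  (forall y, rnorm (dot x y) <= B * rnorm y) -> rnorm x <= B.
Proof.
move=> B0 h; have [->|x0] := eqVneq x 0; first by rewrite rnorm0.
have := h x; rewrite dot_sqr rnorm_real ger0_norm ?sqr_ge0 // expr2.
by rewrite ler_pM2r // rnorm_gt0.
Qed.

(** One vector more than conditions: the matrix of inner products has a nonzero left kernel. The
    combination may vanish, and then it is a linear relation between the [x k]. *)
Lemma orthogonal_combination (s : seq H) (x : nat -> H) :
  exists2 a : nat -> C, exists2 k, (k <= size s)%N & a k != 0 &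
    forall c, c \in s -> dot (\sum_(k < (size s).+1) a k *: x k) c = 0.
Proof.
set m := size s.
pose A : 'M[C]_(m.+1, m) := \matrix_(k, j) dot (x k) (nth 0 s j).
have : kermx A != 0.
  by rewrite kermx_eq0 /row_free neq_ltn ltnS rank_leq_col.
move=> /rowV0Pn[v /sub_kermxP vA v0].
have [k vk] : exists k, v 0 k != 0.
  by apply/existsP; apply: contraNT v0 => /existsPn h; apply/eqP/rowP => k; rewrite mxE; apply/eqP; rewrite -[_ == _]negbK h.
exists (fun k => v 0 (inord k)).
  by exists k; rewrite ?inord_val // -ltnS.
move=> c cs; have ic : (index c s < m)%N by rewrite index_mem.
have := congr1 (fun B : 'rV_m => B 0 (Ordinal ic)) vA; rewrite !mxE => E.
rewrite linear_sumlz -[RHS]E; apply: eq_bigr => i _.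
by rewrite linearZl_LR mxE /= nth_index // inord_val.
Qed.

End Hilbert.

(** * Ranges and kernels of Riesz projections in terms of root spaces *)

Section RootSpaces.
Context {R : realType} {H : normedModType R[i]} (dot : {dot H for Num.conj}).
Local Notation C := R[i].
Hypothesis hH : forall x : H, `|x| ^+ 2 = dot x x.
Variable T : operator H.
Local Notation Rs := (resolvent T).
Implicit Types (l z mu : C) (x y : H).

(* A unit vector orthogonal to all centres of a net is at distance at least 1
   from each of them, so a subspace with a finite 1-net of its sphere has finite
   dimension. *)
Lemma annihilating_poly (S : H -> H) (M : set H) (s : seq H) x :
  (forall a x y, M x -> M y -> M (a *: x + y)) -> (forall x, M x -> M (S x)) ->
  (forall u, M u -> rnorm u = 1 -> exists2 c, c \in s & rnorm (u - c) < 1) ->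
  M x -> exists2 p : {poly C}, p != 0 & pact S p x = 0.
Proof.
move=> Mlin MS Mnet Mx.
have [a [k ks ak] ort] := orthogonal_combination dot s (fun k => iter k S x).
pose p := \poly_(k < (size s).+1) a k.
have pk : p`_k = a k by rewrite coef_poly ltnS ks.
exists p; first by apply: contraNneq ak => p0; rewrite -pk p0 coef0.
rewrite (@pact_widen _ _ _ (size s).+1) ?size_poly //.
under eq_bigr => i _ do rewrite coef_poly ltn_ord.
set u := \sum_(i < _) _ in ort *.
have M0 : M 0 by have := Mlin (-1) _ _ Mx Mx; rewrite scaleN1r addNr.
have Mit i : M (iter i S x) by elim: i => [|i IH] //=; apply: MS.
have Mu : M u.
  rewrite /u; elim/big_rec: _ => [|i y _ My]; first exact: M0.
  exact: Mlin.
apply/eqP; apply: contraT => u0.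
have n0 : 0 < rnorm u by rewrite rnorm_gt0.
pose u1 := (rnorm u)^-1%:C *: u.
have u11 : rnorm u1 = 1.
  by rewrite rnormZ rnorm_real ger0_norm ?invr_ge0 ?rnorm_ge0 // mulVf // gt_eqF.
have Mu1 : M u1 by rewrite -[u1]addr0; apply: Mlin.
have [c cs] := Mnet _ Mu1 u11.
have uc : dot u1 (- c) = 0 by rewrite linearNr linearZl_LR /= ort // mulr0 oppr0.
have := dot_pythagoras hH uc; rewrite u11 rnormN => E.
rewrite -(@ltr_pXn2r _ 2) ?nnegrE ?rnorm_ge0 // E expr1n.
by have := sqr_ge0 (rnorm c); lra.
Qed.

(** With [D = Rs z - (z - l)^-1] one has [Rs z ((T - l) x) = (z - l) D x]. Since [Rs z] is
    injective, a power of [D] that kills [x] turns into a power of [T - l], one factor at a time. *)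
Lemma resolvent_root_vector z l k x : resolvent_set T z -> z != l ->
  iter k (fun v => Rs z v - (z - l)^-1 *: v) x = 0 -> ker_pow T l k x.
Proof.
move=> rz zl; set s0 := (z - l)^-1; set D := fun v => _.
have zl0 : z - l != 0 by rewrite subr_eq0.
have s00 : s0 != 0 by rewrite invr_eq0.
have lS := resolvent_linear rz.
have SD y : Rs z (D y) = D (Rs z y) by rewrite /D (linear_mapB lS) (linear_mapZ lS).
have SDk j y : Rs z (iter j D y) = iter j D (Rs z y) by elim: j => [|j IH] //=; rewrite SD IH.
have lD : linear D.
  by move=> a u v; rewrite /D lS scalerDr scalerBr !scalerA [s0 * a]mulrC opprD addrACA.
have inj y : Rs z y = 0 -> y = 0.
  by move=> y0; have [_ <-] := resolvent_sol y rz; rewrite y0 op_fun0 scaler0 subrr.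
have expand j y : exists y', iter j D y = (- s0) ^+ j *: y + Rs z y'.
  elim: j => [|j [y' E]]; first by exists 0; rewrite expr0 scale1r (linear_map0 lS) addr0.
  exists ((- s0) ^+ j *: y + Rs z y' - s0 *: y'); rewrite /= E {1}/D.
  rewrite [in RHS](linear_mapB lS) [in RHS](linear_mapZ lS) scalerDr scalerA opprD.
  by rewrite addrCA exprS mulNr scaleNr.
elim: k x => [|k IH] x //; rewrite iterSr => xk.
(* Expanding [D ^ (k + 1)] isolates a nonzero multiple of [x] from a vector in the range of [Rs z],
   that is, in the domain. *)
have dx : op_dom T x.
  have [y' E] := expand k.+1 x; rewrite iterSr xk in E.
  have : x = (- (- s0) ^- k.+1) *: Rs z y'.
    have c0 : (- s0) ^+ k.+1 != 0 by rewrite expf_neq0 // oppr_eq0.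
    apply: (scalerI c0); rewrite scalerA mulrN divff // scaleN1r.
    by apply/eqP; rewrite -addr_eq0 -E.
  by move=> ->; apply: op_domZ; have [] := resolvent_sol y' rz.
split=> //; apply: IH; apply: inj; rewrite SDk.
have -> : Rs z (op_fun T x - l *: x) = (z - l) *: D x.
  have -> : op_fun T x - l *: x = (z - l) *: x - (z *: x - op_fun T x).
    by rewrite scalerBl opprB [RHS]addrC addrA subrK.
  rewrite (linear_mapB lS) (linear_mapZ lS) -(resolvent_uniq rz (conj dx erefl)).
  by rewrite /D scalerBr scalerA divff // scale1r.
by rewrite (linear_mapZ (iter_linear lD k)) xk scaler0.
Qed.

(** On the range [M] of [P] the identity is close to a Riemann sum, which factors through the
    compact [Rs z]; hence each [x] in [M] is annihilated by a polynomial in [Rs z]. The only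
    possible eigenvalue of [Rs z] on [M] is [(z - l)^-1], since [P] kills eigenvectors of [T] at
    other points, so a power of [Rs z - (z - l)^-1] kills [x]. *)
Lemma riesz_range_root_space z l (d : R) (P : H -> H) :
  d = dist l (spectrum T `\ l) / 2 -> 0 < d -> linear P -> riesz_limit T l d P ->
  resolvent_set T z -> compact_operator (Rs z) -> z != l ->
  forall x, root_space T l (P x).
Proof.
move=> dE d0 lP limP rz cS zl y; pose x := P y.
have lS := resolvent_linear rz.
have Pidem := riesz_idem dE d0 lP limP.
have Pcomm := riesz_comm dE d0 limP _ rz.
pose M := [set v | P v = v].
have Mx : M x by apply: Pidem.
have Mlin a u v : M u -> M v -> M (a *: u + v) by rewrite /M /= lP => -> ->.
have MS v : M v -> M (Rs z v) by rewrite /M /= Pcomm => ->.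
have q0 : 0 < 4^-1 :> R by rewrite invr_gt0.
have [n0 /(_ n0 (leqnn _)) Hn] := riesz_limit0 limP q0.
have cf : circle_free T l d%:C := riesz_circle_free dE d0.
have [A [k k0 Ak] fA] := circle_sum_factor n0 cf rz.
(* Precision [(4 * k)^-1] becomes [1 / 4] after rescaling by [k]; with the error [1 / 4] of the
   Riemann sum it stays below the 1 that [annihilating_poly] allows. *)
have k4 : 0 < (4 * k)^-1 by rewrite invr_gt0 mulr_gt0.
have [s Hs] := compact_operator_net cS k4.
have [p p0 px] : exists2 p : {poly C}, p != 0 & pact (Rs z) p x = 0.
  apply: (@annihilating_poly _ M [seq k%:C *: c | c <- s]) => // u Mu u1.
  have ku1 : rnorm (k^-1%:C *: A u) <= 1.
    rewrite rnormZ rnorm_real ger0_norm ?invr_ge0 ?(ltW k0) // ler_pdivrMl // mulr1.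
    by rewrite (le_trans (Ak u)) // u1 mulr1.
  have [c cs hc] := Hs _ ku1; exists (k%:C *: c); first exact: map_f.
  have := Hn u; rewrite Mu u1 mulr1 fA rdistC => h1.
  have : rnorm (Rs z (A u) - k%:C *: c) <= 4^-1.
    have -> : Rs z (A u) - k%:C *: c = k%:C *: (Rs z (k^-1%:C *: A u) - c).
      rewrite (linear_mapZ lS) scalerBr scalerA -rmorphM /= divff ?gt_eqF //.
      by rewrite scale1r.
    rewrite rnormZ rnorm_real gtr0_norm //.
    apply: le_trans (_ : k * (4 * k)^-1 <= _); first by rewrite ler_pM2l // ltW.
    by rewrite invfM mulrCA divff ?mulr1 // gt_eqF.
  have := rnormD (u - Rs z (A u)) (Rs z (A u) - k%:C *: c); rewrite addrA subrK.
  lra.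
have [j Hj] : exists j, iter j (fun v => Rs z v - (z - l)^-1 *: v) x = 0.
  apply: (pact_nilpotent lS Mlin MS _ p0 Mx px) => s1 v s1l Mv vs.
  apply/eqP; apply: contraT => v0.
  have s10 : s1 != 0.
    apply: contraNneq v0 => s10; have [_ <-] := resolvent_sol v rz.
    by rewrite vs s10 scale0r op_fun0 scaler0 subrr.
  have [dv Ev] := resolvent_sol v rz.
  have dv' : op_dom T v by rewrite -[v](scalerK s10) -vs; apply: op_domZ.
  have Ev' : op_fun T v = (z - s1^-1) *: v.
    move: Ev; rewrite vs op_funZ // => Ev; apply: (scalerI s10).
    rewrite scalerA mulrBr divff // scalerBl scale1r [s1 * z]mulrC -scalerA.
    by rewrite -[X in _ = _ - X]Ev opprB [RHS]addrC subrK.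
  have ml : z - s1^-1 != l.
    apply: contra s1l => /eqP <-; apply/eqP.
    by rewrite opprB addrC subrK invrK.
  by move: v0; rewrite -Mv (riesz_eigenvector0 dE d0 lP limP dv' Ev' ml) eqxx.
by exists j => //; apply: resolvent_root_vector Hj.
Qed.

(** By induction [P] kills [(T - mu) x], so [P x] solves the eigenvalue equation at [mu]. Then [P]
    kills [P x], and [P (P x) = P x]. *)
Lemma riesz_kills_root_space z mu k x (P : H -> H) : resolvent_set T z ->
  linear P -> (forall y, P (P y) = P y) -> (forall y, P (Rs z y) = Rs z (P y)) ->
  (forall y, op_dom T y -> op_fun T y = mu *: y -> P y = 0) ->
  ker_pow T mu k x -> P x = 0.
Proof.
move=> rz lP Pidem Pcomm Pev; have lS := resolvent_linear rz.
elim: k x => [|k IH] x /=; first by move=> ->; apply: linear_map0.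
move=> [dx /IH]; set x' := _ - _ => Px'.
have xE : x = Rs z ((z - mu) *: x - x').
  by apply: resolvent_uniq => //; split=> //; rewrite /x' scalerBl opprB addrA subrK.
have PxE : P x = Rs z ((z - mu) *: P x).
  by rewrite {1}xE Pcomm (linear_mapB lP) (linear_mapZ lP) Px' subr0.
rewrite -Pidem; have [dP EP] := resolvent_sol ((z - mu) *: P x) rz.
rewrite -PxE in dP EP; apply: Pev => //.
have -> : op_fun T (P x) = z *: P x - (z *: P x - op_fun T (P x)) by rewrite opprB addrC subrK.
by rewrite EP -scalerBl opprB addrC subrK.
Qed.

Lemma riesz_proj_facts z l : resolvent_set T z -> compact_operator (Rs z) ->
  spectrum T l -> let P := riesz_proj T l in
  [/\ linear P, forall x, P (P x) = P x,
      forall x, root_space T l (P x) &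
      forall mu x, mu != l -> root_space T mu x -> P x = 0].
Proof.
move=> rz cS sl P; have zl : z != l by apply: contra_not_neq sl => <-.
have [P0|[d0 lP limP]] := riesz_proj_dichotomy (erefl (dist l (spectrum T `\ l) / 2)).
  have {}P0 x : P x = 0 := P0 x.
  split=> [a x y|x|x|mu x _ _]; rewrite ?P0 ?scaler0 ?addr0 //.
  by exists 0%N.
have Pid := riesz_idem erefl d0 lP limP.
split=> //; first exact: (riesz_range_root_space erefl d0 lP limP rz cS zl).
move=> mu x ml [k _ kx].
have Pcomm y : P (Rs z y) = Rs z (P y) := riesz_comm erefl d0 limP y rz.
have Pev y : op_dom T y -> op_fun T y = mu *: y -> P y = 0.
  by move=> dy ey; apply: (riesz_eigenvector0 erefl d0 lP limP dy ey).
exact: (riesz_kills_root_space rz lP Pid Pcomm Pev kx).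
Qed.

End RootSpaces.

Section Multiplicities.
Context {R : realType} {V : lmodType R[i]} (T : operator V).
Local Notation C := R[i].

(** The matrix expressing a basis of the eigenspace in a basis of the root space is square and
    injective, hence invertible. *)
Lemma equal_mult_eigenspace (l : C) (m : nat) : geom_mult T l m -> alg_mult T l m ->
  root_space T l `<=` eigenspace_of T l.
Proof.
move=> [b [bfree bE]] [c [_ cE]] x; rewrite cE bE => -[a ->].
have bc i : exists v : 'I_m -> C, b i = \sum_(j < m) v j *: c j.
  have : eigenspace_of T l (b i).
    rewrite bE; exists (fun j => (j == i)%:R); rewrite (bigD1 i) //= eqxx scale1r.
    by rewrite big1 ?addr0 // => j /negPf ->; rewrite scale0r.
  move=> [dbi ebi]; have : root_space T l (b i).
    by exists 1%N => //=; split=> //; rewrite ebi subrr.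
  by rewrite cE => -[v ->]; exists v.
pose A : 'M[C]_m := \matrix_(i, j) sval (cid (bc i)) j.
have bA i : b i = \sum_(j < m) A i j *: c j.
  by rewrite {1}(svalP (cid (bc i))); apply: eq_bigr => j _; rewrite mxE.
have comb (v : 'rV_m) : \sum_i v 0 i *: b i = \sum_j (v *m A) 0 j *: c j.
  under eq_bigr => i _ do rewrite bA scaler_sumr.
  rewrite exchange_big; apply: eq_bigr => j _; rewrite mxE scaler_suml.
  by apply: eq_bigr => i _; rewrite scalerA.
have uA : A \in unitmx.
  rewrite -row_free_unit -kermx_eq0; apply: contraT => /rowV0Pn[v /sub_kermxP vA].
  have v0 : \sum_i v 0 i *: b i = 0.
    by rewrite comb vA big1 // => j _; rewrite mxE scale0r.
  by case/eqP; apply/rowP => i; rewrite mxE; apply: (bfree (fun i => v 0 i)).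
pose r : 'rV[C]_m := \row_j a j.
exists (fun i => (r *m invmx A) 0 i).
by rewrite comb mulmxKV //; apply: eq_bigr => j _; rewrite mxE.
Qed.

Lemma root_vector_in_seq (lam : nat -> C) (l : C) (x : V) : eigenvalue_seq T lam ->
  root_space T l x -> x != 0 -> exists n, lam n = l.
Proof.
move=> [/(_ l)[m [b [_ bE]] card] _] rx x0; apply: contrapT => nl.
have m0 : m = 0%N.
  have e0 : [set n | lam n = l] = set0.
    by apply/seteqP; split=> // n /= h; apply: nl; exists n.
  by move: card; rewrite e0 -II0 => /card_eq_II.
move/eqP: x0; apply; move: rx; rewrite bE => -[a ->].
by rewrite big1 // => i _; exfalso; case: i => i; rewrite m0.
Qed.

End Multiplicities.

Section LowerBound.
Context {R : realType} {H : normedModType R[i]} (T : operator H).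
Local Notation C := R[i].
Local Notation Rs := (resolvent T).

Lemma continuous_expi_approx (t e : R) : 0 < e ->
  exists2 r : R, 0 < r & forall u, `|u - t| < r -> rnorm (expi u - expi t) < e.
Proof.
move=> e0; have J : jet 1 (@cexp R) (0 +i* t) by apply: jet_cexp.
have [r r0 h] := jet_continuous J e0; exists r => // u ut.
have E s : cexp (0 +i* s) = expi s by rewrite /cexp /= expR0 mul1r.
rewrite -!E; have := h (0 +i* (u - t)).
rewrite (_ : 0 +i* t + 0 +i* (u - t) = 0 +i* u); last by simpc; rewrite addrC subrK.
by apply; apply: le_lt_trans (rnorm_le_ReIm _) _; rewrite /= normr0 add0r.
Qed.

(** By contradiction: unit vectors [v_n] with [(z_n - T) v_n -> 0] on the circle satisfy
    [v_n = (z0 - z_n) Rs z0 v_n + o(1)]. By compactness [Rs z0 v_n] has a cluster point [u], which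
    solves the eigenvalue equation on the circle and so is 0, against [|v_n| = 1]. This bounds
    solutions on the arc [|z| = r1] without showing that the arc lies in the resolvent set. *)
Lemma circle_lower_bound (z0 : C) (r : R) : resolvent_set T z0 ->
  compact_operator (Rs z0) ->
  (forall t v, op_dom T v -> op_fun T v = (r%:C * expi t) *: v -> v = 0) ->
  exists2 c : R, 0 < c & forall t v, - pi <= t <= pi -> op_dom T v ->
    c * rnorm v <= rnorm ((r%:C * expi t) *: v - op_fun T v).
Proof.
move=> rz; rewrite /compact_operator precompactE => cS noev; apply: contrapT => nb.
have lS := resolvent_linear rz; have [M M0 HM] := resolvent_bound rz.
pose z (t : R) := r%:C * expi t.
have ex n : exists tv : R * H, [/\ - pi <= tv.1 <= pi, op_dom T tv.2, rnorm tv.2 = 1 &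
    rnorm (z tv.1 *: tv.2 - op_fun T tv.2) < n.+1%:R^-1].
  apply: contrapT => nex; apply: nb; exists n.+1%:R^-1; first by rewrite invr_gt0 ltr0n.
  move=> t v tpi dv; have [->|v0] := eqVneq v 0; first by rewrite rnorm0 mulr0 rnorm_ge0.
  rewrite leNgt; apply/negP => lt; apply: nex.
  have n0 : 0 < rnorm v by rewrite rnorm_gt0.
  exists (t, (rnorm v)^-1%:C *: v) => /=; split=> //.
  - exact: op_domZ.
  - by rewrite rnormZ rnorm_real ger0_norm ?invr_ge0 ?rnorm_ge0 // mulVf // gt_eqF.
  rewrite op_funZ // scalerA mulrC -scalerA -scalerBr rnormZ rnorm_real.
  by rewrite ger0_norm ?invr_ge0 ?rnorm_ge0 // ltr_pdivrMl // mulrC.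
pose tv n := sval (cid (ex n)).
have tvP n : [/\ - pi <= (tv n).1 <= pi, op_dom T (tv n).2, rnorm (tv n).2 = 1 &
    rnorm (z (tv n).1 *: (tv n).2 - op_fun T (tv n).2) < n.+1%:R^-1].
  exact: svalP (cid (ex n)).
pose K := `[(- pi : R), pi]%classic `*` closure (Rs z0 @` [set x : H | rnorm x <= 1]).
have cK : compact K by apply: compact_setX => //; apply: segment_compact.
pose sq n : R * H := ((tv n).1, Rs z0 (tv n).2).
have [] := cK (sq @ \oo) _.
  exists 0%N => // n _; have [h1 h2 h3 h4] := tvP n; split; first by rewrite /= in_itv.
  by apply: subset_closure; exists (tv n).2 => //=; rewrite h3.
move=> [t u] [_ clu].
have approx (e : R) : 0 < e -> exists n, [/\ rnorm (z (tv n).1 - z t) < e,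
    rnorm (Rs z0 (tv n).2 - u) < e & n.+1%:R^-1 < e].
  move=> e0; have e0' : 0 < e%:C :> C by rewrite ltcR.
  have e1 : 0 < e / (`|r| + 1) by rewrite divr_gt0 // ltr_wpDl.
  have [d d0 Hd] := continuous_expi_approx t e1.
  have n0P : \forall n \near \oo, (Num.bound e^-1 <= n)%N by exists (Num.bound e^-1).
  have := clu _ _ (_ : (sq @ \oo) (sq @` [set n | (Num.bound e^-1 <= n)%N])) (_ : nbhs (t, u) (ball t d `*` ball u e%:C)).
  move=> /(_ _ _)/wrap[].
    by exists (Num.bound e^-1) => // n hn; exists n.
    by exists (ball t d, ball u e%:C) => //; split; apply: nbhsx_ballx.
  move=> [_ [[n hn <-] [/= bt bu]]]; exists n; split.
  - rewrite /z -mulrBr rnormM rnorm_real.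
    apply: le_lt_trans (_ : (`|r| + 1) * rnorm (expi (tv n).1 - expi t) < _).
      by rewrite ler_wpM2r ?rnorm_ge0 // lerDl.
    rewrite mulrC -ltr_pdivlMr ?ltr_wpDl //; apply: Hd.
    by rewrite distrC.
  - by move: bu; rewrite -ball_normE /= distrC normr_lt_rnorm.
  - rewrite -[ltRHS]invrK ltf_pV2 ?posrE ?invr_gt0 ?ltr0n //.
    apply: lt_le_trans (archi_boundP _) _; first by rewrite invr_ge0 ltW.
    by rewrite ler_nat leqW.
(* The value that the near-eigenvectors approach along the cluster point; [D] collects the constants
   of this approximation. *)
pose v := (z0 - z t) *: u.
pose D := rnorm (z0 - z t) + 1 + rnorm u + M.
have close (e : R) : 0 < e -> e <= 1 -> exists n, rnorm ((tv n).2 - v) <= e * D /\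
   rnorm (Rs z0 (tv n).2 - u) <= e.
  move=> e0 e1; have [n [h1 h2 h3]] := approx e e0; exists n; split; last exact: ltW.
  have [_ dv _ hf] := tvP n; move: (tv n).1 (tv n).2 h1 h2 dv hf => s w h1 h2 dv hf.
  set f := z s *: w - _ in hf.
  have E : w = (z0 - z s) *: Rs z0 w + Rs z0 f.
    rewrite -(linear_mapZ lS) -(linear_mapD lS); apply: resolvent_uniq => //; split=> //.
    by rewrite /f scalerBl addrA subrK.
  have -> : w - v = (z0 - z s) *: (Rs z0 w - u) - (z s - z t) *: u + Rs z0 f.
    have -> : v = (z0 - z s) *: u + (z s - z t) *: u by rewrite -scalerDl addrA subrK.
    by rewrite {1}E scalerBr opprD -!addrA; congr (_ + _); rewrite addrC -!addrA.
  have k1 : rnorm (z0 - z s) <= rnorm (z0 - z t) + 1.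
    have -> : z0 - z s = (z0 - z t) - (z s - z t) by ring.
    by apply: le_trans (rnormB _ _) _; rewrite lerD2l; lra.
  apply: le_trans (rnormD _ _) _; rewrite /D mulrDr lerD //.
    apply: le_trans (rnormB _ _) _; rewrite !rnormZ mulrDr lerD //.
      by rewrite mulrC ler_pM ?rnorm_ge0 // ltW.
    by rewrite ler_wpM2r ?rnorm_ge0 // ltW.
  apply: le_trans (HM _) _; rewrite mulrC ler_wpM2r ?(ltW M0) //.
  exact/ltW/(lt_trans hf).
have v1 : 1 - rnorm v <= 0.
  apply: (@le0_eps _ _ D) => e e0 e1; have [n [h _]] := close e e0 e1.
  have [_ _ n1 _] := tvP n; have := lerB_rnorm (tv n).2 v; lra.
have Sv : Rs z0 v = u.
  apply/eqP; rewrite -subr_eq0 -rnorm_eq0 eq_le rnorm_ge0 andbT.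
  apply: (@le0_eps _ _ (M * D + 1)) => e e0 e1; have [n [h1 h2]] := close e e0 e1.
  have -> : Rs z0 v - u = (Rs z0 (tv n).2 - u) - Rs z0 ((tv n).2 - v).
    by rewrite (linear_mapB lS) opprB [RHS]addrC addrA subrK.
  apply: le_trans (rnormB _ _) _; have := HM ((tv n).2 - v).
  have : M * rnorm ((tv n).2 - v) <= M * (e * D) by rewrite ler_pM2l.
  lra.
have [du Eu] := resolvent_sol v rz; rewrite Sv in du Eu.
have u0 : u = 0.
  apply: (noev t) => //; apply/eqP; rewrite eq_sym -subr_eq0.
  have -> : (r%:C * expi t) *: u - op_fun T u = (z0 *: u - op_fun T u) - v.
    by rewrite /v /z scalerBl opprB [RHS]addrC addrA subrK.
  by rewrite Eu subrr.
by move: v1; rewrite /v u0 scaler0 rnorm0 subr0 ler10.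
Qed.

End LowerBound.

Section LocalResolvent.
Context {R : realType} {H : normedModType R[i]} (dot : {dot H for Num.conj}).
Local Notation C := R[i].
Variable T : operator H.

(** The finite sum of [(T - l) ^ j x / (z - l) ^ (j + 1)], built by recursion on the order of the
    root vector. It solves the equation at every [z != l], in the spectrum or not. *)
Lemma local_resolvent (l : C) k x : ker_pow T l k x -> exists rho : C -> H,
  [/\ forall z, z != l -> resolves T z x (rho z),
      forall y z, z != l -> jet 3 (fun z => dot (rho z) y) z &
      exists2 B : R, 0 <= B & forall z, 2 * rnorm l + 1 <= rnorm z -> rnorm (rho z) <= B / rnorm z].
Proof.
elim: k x => [|k IH] x /=.
  move=> ->; exists (fun=> 0); split=> [z _|y z _|].
  - by split; [exact: op_dom0 | rewrite op_fun0 scaler0 subrr].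
  - by rewrite linear0l; apply: jet_cst.
  - by exists 0 => // z _; rewrite rnorm0 mul0r.
move=> [dx /IH[rho [sol J [B B0 HB]]]].
exists (fun z => (z - l)^-1 *: (x + rho z)); split=> [z zl|y z zl|].
- have [dr Er] := sol z zl; have zl0 : z - l != 0 by rewrite subr_eq0.
  split; first by apply/op_domZ/op_domD.
  rewrite op_funZ; last exact: op_domD.
  rewrite op_funD // scalerA [z * _]mulrC -scalerA -scalerBr [z *: (x + _)]scalerDr opprD addrACA Er.
  by rewrite addrA subrK -scalerBl scalerA mulVf // scale1r.
- have zl0 : z - l != 0 by rewrite subr_eq0.
  apply: (@jet_ext _ _ (fun z => (z - l)^-1 * (dot x y + dot (rho z) y))).
    by exists 1 => // t _; rewrite linearZl_LR /= linearDl.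
  apply: jetM; last by apply: jetD; [apply: jet_cst | apply: J].
  have Js k' : jet k' (fun u : C => u - l) z by apply: jetB; [apply: jet_id | apply: jet_cst].
  exact: (@jetV _ _ (fun u => u - l)).
exists (2 * (rnorm x + B)); first by rewrite mulr_ge0 // addr_ge0 // rnorm_ge0.
move=> z hz; have l0 := rnorm_ge0 l; have z1 : 1 <= rnorm z by lra.
have z0 : 0 < rnorm z by lra.
have zl : rnorm z / 2 <= rnorm (z - l) by have := lerB_rnorm z l; lra.
rewrite rnormZ rnormV mulrC.
have hx : rnorm (x + rho z) <= rnorm x + B.
  apply: le_trans (rnormD _ _) _; rewrite lerD2l (le_trans (HB _ hz)) //.
  by rewrite ler_pdivrMr // ler_peMr.
apply: le_trans (_ : (rnorm x + B) * (rnorm z / 2)^-1 <= _); last by rewrite invf_div mulrCA !mulrA.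
by rewrite ler_pM ?rnorm_ge0 ?invr_ge0 ?rnorm_ge0 // lef_pV2 ?posrE ?divr_gt0 // (lt_le_trans _ zl) // divr_gt0.
Qed.

End LocalResolvent.

(** * The Phragmén-Lindelöf argument *)

Section PhragmenLindelof.
Context {R : realType}.
Local Notation C := R[i].

(** In the coordinate [z = exp w] the estimated quantity is [|z g(z)|], and [thm] is the
    half-opening of the region. The constant [C1] may depend on the vector; it does not enter the
    conclusion. *)
Lemma strip_bound (f : C -> C) (thm : R -> R) (s1 s2 Th B C1 : R) :
  continuous thm -> (forall s, s1 <= s -> thm s <= Th) -> 0 <= s1 -> 0 <= B ->
  (forall s t, s1 <= s -> `|t| <= thm s -> jet 3 f (s +i* t)) ->
  (forall t, `|t| <= thm s1 -> expR s1 * rnorm (f (s1 +i* t)) <= B) ->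
  (forall s t, s1 <= s -> `|t| = thm s -> expR s * rnorm (f (s +i* t)) <= B) ->
  (forall s t, s1 <= s -> s2 <= s -> `|t| <= thm s -> expR s * rnorm (f (s +i* t)) <= C1) ->
  forall s t, s1 <= s -> `|t| <= thm s -> expR s * rnorm (f (s +i* t)) <= B.
Proof.
move=> cthm thmle s10 B0 Jf HL HE HI s0 t0 s01 t0t.
set a := expR s0 * _; rewrite -subr_le0.
have a0 : 0 <= a by rewrite mulr_ge0 ?expR_ge0 ?rnorm_ge0.
have s00 : 0 <= s0 by lra.
(* The maximum principle will give [exp (- e * s0) * a <= B + e], and [1 - e * s0 <= exp (- e * s0)]
   makes this linear in [e]. *)
apply: (@le0_eps _ _ (s0 * a + 1)) => e e0 e1.
(* The factor [exp (- e w)] makes the right end [Re w = S] negligible; then [e] tends to 0. *)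
pose S := Num.max (Num.max s0 s2) (`|C1| / e ^+ 2).
have Ss0 : s0 <= S by rewrite /S !le_max lexx.
have Ss2 : s2 <= S by rewrite /S !le_max lexx orbT.
have SC : `|C1| / e ^+ 2 <= S by rewrite /S !le_max lexx !orbT.
have tail : expR (- (e * S)) * C1 <= e.
  have S0 : 0 <= e * S by rewrite mulr_ge0 ?(ltW e0) //; lra.
  apply: le_trans (_ : expR (- (e * S)) * `|C1| <= _).
    by rewrite ler_wpM2l ?expR_ge0 ?ler_norm.
  rewrite expRN ler_pdivrMl ?expR_gt0 //.
  apply: le_trans (_ : (1 + e * S) * e <= _); last by rewrite ler_pM2r // expR_ge1Dx.
  move: SC; rewrite ler_pdivrMr ?exprn_gt0 // => SC.
  by apply: le_trans SC _; rewrite expr2; nra.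
pose u (q : R * R) := `|q.2| - thm q.1.
have cu : continuous u.
  move=> q; apply: cvgB; first by apply: cvg_norm; exact: cvg_snd.
  by apply: continuous_comp; [exact: cvg_fst | exact: cthm].
pose K := (`[s1, S]%classic `*` `[- Th, Th]%classic) `&` [set q | u q <= 0].
have KP s t : K (s, t) <-> [/\ s1 <= s, s <= S & `|t| <= thm s].
  rewrite /K /u /= !in_itv /= subr_le0; split.
    by move=> [[/andP[h1 h2] _] h3].
  move=> [h1 h2 h3]; split=> //; split; first by rewrite h1.
  by rewrite -ler_norml (le_trans h3) // thmle.
have cK : compact K.
  apply: compact_closedI.
    by apply: compact_setX; apply: segment_compact.
  by apply: (@closed_comp _ _ u [set x | x <= 0]) => //; exact: closed_le.
pose h (w : C) := cexp ((1 - e)%:C * w) * f w.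
have hE s t : rnorm (h (s +i* t)) = expR (- (e * s)) * (expR s * rnorm (f (s +i* t))).
  rewrite /h rnormM rnorm_cexp mulrA -expRD; congr (expR _ * _).
  by simpc => /=; ring.
have le1 s : s1 <= s -> expR (- (e * s)) <= 1.
  by move=> s1s; rewrite expR_le1 oppr_le0 mulr_ge0 ?(ltW e0) //; lra.
have hle s t : s1 <= s -> expR s * rnorm (f (s +i* t)) <= B -> rnorm (h (s +i* t)) <= B + e.
  move=> s1s le; rewrite hE; apply: le_trans (_ : 1 * B <= _); last by rewrite mul1r; lra.
  by rewrite ler_pM ?expR_ge0 ?le1 // mulr_ge0 ?expR_ge0 ?rnorm_ge0.
have := @max_principle _ K h (B + e) cK _ _ s0 t0.
move=> /(_ _ _ _)/wrap[].
- move=> s t /KP[h1 h2 h3]; apply: jetM; last exact: Jf.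
  have Jl k : jet k (fun w : C => (1 - e)%:C * w) (s +i* t) by apply/jetZ/jet_id.
  by apply: (@jet_comp _ 3 cexp) => //; apply: jet_cexp.
- move=> s t /KP[h1 h2 h3].
  have [s_1|s1s] := eqVneq s s1; first by left; apply: hle => //; rewrite s_1 HL // -s_1.
  have [tE|tNE] := eqVneq `|t| (thm s); first by left; apply: hle => //; apply: HE.
  have [s_S|sNS] := eqVneq s S.
    left; rewrite hE s_S; apply: le_trans (_ : e <= _); last by lra.
    apply: le_trans tail; rewrite ler_wpM2l ?expR_ge0 // HI //; first by rewrite -s_S.
    by rewrite -s_S.
  right; have s1lt : s1 < s by rewrite lt_neqAle eq_sym s1s.
  have sSlt : s < S by rewrite lt_neqAle sNS.
  have ult : u (s, t) < 0 by rewrite /u subr_lt0 lt_neqAle tNE.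
  have : \forall q \near (s, t), [/\ s1 < q.1, q.1 < S & u q < 0].
    near=> q; split; near: q.
    - by apply: (cvgr_gt s) => //; exact: cvg_fst.
    - by apply: (cvgr_lt s) => //; exact: cvg_fst.
    - by apply: (cvgr_lt (u (s, t))) => //; exact: cu.
  move=> /nbhs_ballP[r /= r0 Hr]; exists r => // z zr.
  have [] := Hr (s + complex.Re z, t + complex.Im z) _.
    split; rewrite /ball /= opprD addrA subrr add0r normrN.
      exact: le_lt_trans (Re_le_rnorm z) zr.
    exact: le_lt_trans (Im_le_rnorm z) zr.
  move=> /= k1 k2 k3; apply/KP; split; [exact: ltW | exact: ltW | ].
  by move: (ltW k3); rewrite /u /= subr_le0.
- by apply/KP.
rewrite hE -/a => le.
have : (1 - e * s0) * a <= expR (- (e * s0)) * a by rewrite ler_wpM2r // expR_ge1Dx.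
lra.
Unshelve. all: by end_near.
Qed.

(** With [x = exp s] this bounds [x ^ m * exp (- d * x ^ b)]: [exp (d * x ^ b)] is split into
    [k + 1] equal factors, each at least [c * x ^ b], where [(k + 1) * b >= |m|]. *)
Lemma powR_expR_bound (d b m : R) : 0 < d -> 0 < b ->
  exists2 A : R, 0 < A & forall s, 0 <= s -> expR (m * s) * expR (- (d * expR (b * s))) <= A.
Proof.
move=> d0 b0; pose k := Num.bound (`|m| / b).
have kb : `|m| <= k.+1%:R * b.
  rewrite -ler_pdivrMr //; apply: le_trans (ltW (archi_boundP _)) _.
    by rewrite divr_ge0 // ltW.
  by rewrite ler_nat.
pose c := d / k.+1%:R.
have c0 : 0 < c by rewrite divr_gt0.
exists (c ^- k.+1); first by rewrite invr_gt0 exprn_gt0.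
move=> s s0; rewrite expRN ler_pdivrMr ?expR_gt0 // ler_pdivlMl ?exprn_gt0 //.
have -> : d * expR (b * s) = k.+1%:R * (c * expR (b * s)).
  by rewrite mulrA /c mulrCA divff ?mulr1 // pnatr_eq0.
rewrite expRM_natl; apply: le_trans (_ : (c * expR (b * s)) ^+ k.+1 <= _); last first.
  have ce0 : 0 <= c * expR (b * s) by rewrite mulr_ge0 ?expR_ge0 ?(ltW c0).
  rewrite lerXn2r // ?nnegrE ?expR_ge0 //.
  by apply: le_trans (expR_ge1Dx _); rewrite lerDr.
rewrite [(c * _) ^+ _]exprMn ler_pM2l ?exprn_gt0 // -expRM_natl ler_expR mulrA.
by rewrite ler_wpM2r // (le_trans (ler_norm m)).
Qed.

End PhragmenLindelof.

(** * The damping factor and its divided difference *)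

Section Damping.
Context {R : realType}.
Local Notation C := R[i].
Variables (a q : R).

(* [exp (- a z ^ q)] in the logarithmic coordinate [z = exp w]. *)
Definition damp (w : C) : C := cexp (- (a%:C * cexp (q%:C * w))).

Lemma rnorm_damp s t :
  rnorm (damp (s +i* t)) = expR (- (a * (expR (q * s) * cos (q * t)))).
Proof.
rewrite /damp rnorm_cexp; congr expR; rewrite /cexp /expi; simpc => /=; ring.
Qed.

Lemma jet_damp k w : (k <= 3)%N -> jet k damp w.
Proof.
move=> k3; have Jq m : jet m (fun w : C => q%:C * w) w by apply/jetZ/jet_id.
have Je m : (m <= 3)%N -> jet m (fun w => - (a%:C * cexp (q%:C * w))) w.
  move=> m3; apply/jetN/jetZ; apply: (@jet_comp _ m cexp) => //; exact: jet_cexp.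
apply: (@jet_comp _ k cexp); [exact: jet_cexp | exact: Je | exact: Je].
Qed.

(* The divided difference [(damp w - damp w0) / (exp w - exp w0)], written with
   the entire function [(exp t - 1) / t] so that it makes sense at [w = w0]. *)
Definition damp_quotient (w0 w : C) : C :=
  let b := - (a%:C * cexp (q%:C * w0)) in
  cexp b * b * q%:C * expm1_div (q%:C * (w - w0)) *
    expm1_div (b * (q%:C * (w - w0) * expm1_div (q%:C * (w - w0)))) /
    (cexp w0 * expm1_div (w - w0)).

Lemma expm1_div_neq0 (t : C) : `|complex.Im t| < 2 * pi -> expm1_div t != 0.
Proof.
move=> ht; rewrite /expm1_div; case: (eqVneq t 0) => [_|t0]; first exact: oner_neq0.
rewrite mulf_neq0 ?invr_eq0 // subr_eq0; apply: contraNneq t0 => E.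
by apply/eqP/cexp_eq1.
Qed.

Lemma damp_quotientE (w0 w : C) : `|complex.Im (w - w0)| < 2 * pi ->
  (cexp w - cexp w0) * damp_quotient w0 w = damp w - damp w0.
Proof.
move=> h; have e0 := expm1_div_neq0 h.
(* Used three times: for the outer exponential of [damp], for its exponent, and for the
   denominator. *)
have shift (u v : C) : cexp u - cexp v = cexp v * ((u - v) * expm1_div (u - v)).
  have {1}-> : u = v + (u - v) by rewrite addrC subrK.
  by rewrite (cexpD v) (expm1_divE (u - v)); ring.
set b := - (a%:C * cexp (q%:C * w0)); pose B := - (a%:C * cexp (q%:C * w)).
have -> : damp w - damp w0 = cexp b * ((B - b) * expm1_div (B - b)) := shift B b.
have -> : B - b = b * (q%:C * (w - w0) * expm1_div (q%:C * (w - w0))).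
  rewrite /B /b opprK addrC -mulrBr -opprB mulrN shift -mulrBr; ring.
rewrite shift /damp_quotient -/b.
move: (expm1_div (w - w0)) e0 (cexp w0) (cexp_neq0 w0) => E E0 u u0.
by field; rewrite E0 u0.
Qed.

Lemma jet_damp_quotient (w0 w : C) : `|complex.Im (w - w0)| < 2 * pi ->
  jet 3 (damp_quotient w0) w.
Proof.
move=> h; have Js m : jet m (fun w : C => w - w0) w by apply: jetB; [apply: jet_id | apply: jet_cst].
have Jq m : jet m (fun w : C => q%:C * (w - w0)) w by apply: jetZ.
have J1 m : (m <= 3)%N -> jet m (fun w : C => expm1_div (q%:C * (w - w0))) w.
  by move=> m3; apply: (@jet_comp _ m expm1_div) => //; exact: jet_expm1_div.
have J2 m : (m <= 3)%N -> jet m (fun w : C => expm1_div (w - w0)) w.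
  by move=> m3; apply: (@jet_comp _ m expm1_div) => //; exact: jet_expm1_div.
rewrite /damp_quotient; set b := - _; apply: jetM.
  apply: jetM; first by apply: jetM; [exact: jet_cst | exact: J1].
  have J3 m : (m <= 3)%N -> jet m (fun w => b * (q%:C * (w - w0) * expm1_div (q%:C * (w - w0)))) w.
    by move=> m3; apply/jetZ/jetM => //; exact: J1.
  by apply: (@jet_comp _ 3 expm1_div); [exact: jet_expm1_div | exact: J3 | exact: J3].
apply: jetV; first by rewrite mulf_neq0 ?cexp_neq0 ?expm1_div_neq0.
  by apply/jetZ/J2.
by apply/jetZ/J2.
Qed.

End Damping.

(** * Separation of sectors and summation over eigenvalues *)

Section Estimates.
Context {R : realType}.
Local Notation C := R[i].

Lemma ler_cos (x y : R) : 0 <= x -> x <= y -> y <= pi -> cos y <= cos x.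
Proof.
move=> x0 xy ypi; rewrite leNgt; apply/negP.
have [h1 h2] : x \in `[0, pi] /\ y \in `[0, pi] by rewrite !in_itv /=; split; lra.
by rewrite ltr_cos //; lra.
Qed.

Lemma cos_le_away (e x : R) : 0 <= e -> e <= `|x| -> `|x| <= 2 * pi - e -> cos x <= cos e.
Proof.
move=> e0 ex xe; rewrite -cos_norm; have [xpi|pix] := leP `|x| pi; first exact: ler_cos.
have -> : cos `|x| = cos (2 * pi - `|x|).
  by rewrite -[RHS]cosN opprB -[RHS]cosD2pi mulr_natl subrK.
by apply: ler_cos; lra.
Qed.

(** Law of cosines with the clipped cosine [m]: [r ^ 2 + l ^ 2 - 2 * m * r * l = (1 - m) * (r ^ 2 +
    l ^ 2) + m * (r - l) ^ 2], where both coefficients are nonnegative because [m] lies in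
    [[0, 1]]. *)
Lemma sector_separation (e r l s t : R) : 0 <= e -> 0 <= r -> 0 <= l ->
  e <= `|s - t| -> `|s - t| <= 2 * pi - e ->
  (1 - Num.max (cos e) 0) * r <= rnorm (r%:C * expi s - l%:C * expi t).
Proof.
move=> e0 r0 l0 h1 h2; have hc := cos_le_away e0 h1 h2; set m := Num.max _ _.
have m0 : 0 <= m by rewrite le_max lexx orbT.
have cm : cos (s - t) <= m by rewrite le_max hc.
have m1 : m <= 1 by rewrite ge_max cos_le1 ler01.
rewrite -(@ler_pXn2r _ 2) ?nnegrE ?mulr_ge0 ?rnorm_ge0 ?subr_ge0 // rnorm_polar.
have rl : 0 <= r * l by rewrite mulr_ge0.
have : r * l * cos (s - t) <= r * l * m by rewrite ler_wpM2l.
have := sqr_ge0 (r - l); have := sqr_ge0 l; have := sqr_ge0 r => r2 l2 rl2.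
have : (1 - m) ^+ 2 * r ^+ 2 <= (1 - m) * r ^+ 2.
  by rewrite ler_wpM2r // expr2 ler_piMr ?subr_ge0 // gerBl.
have : 0 <= (1 - m) * l ^+ 2 by rewrite mulr_ge0 ?subr_ge0.
have : 0 <= m * (r - l) ^+ 2 by rewrite mulr_ge0.
rewrite exprMn; nra.
Qed.

Lemma sum_inv_sq_le (n : nat) : \sum_(i < n) (i.+1%:R ^- 2 : R) <= 2.
Proof.
suff : \sum_(i < n.+1) (i.+1%:R ^- 2 : R) <= 2 - n.+1%:R^-1.
  rewrite big_ord_recr /= => h; have : 0 <= n.+1%:R ^- 2 :> R by rewrite invr_ge0 exprn_ge0.
  have : 0 <= n.+1%:R^-1 :> R by rewrite invr_ge0.
  by move: (n.+1%:R ^- 2) (n.+1%:R^-1) (\sum_(i < n) _) h => u v w; lra.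
elim: n => [|n IH]; first by rewrite big_ord1 expr1n invr1; lra.
rewrite big_ord_recr /=; apply: le_trans (lerD IH (lexx _)) _.
have n0 : 0 < n.+1%:R :> R by rewrite ltr0n.
rewrite -addrA lerD2l -[n.+2%:R]natr1 lerNr opprD opprK.
have n1 : n.+1%:R != 0 :> R by rewrite pnatr_eq0.
move: (n.+1%:R) n0 n1 => x x0 _.
have -> : x^-1 - (x + 1) ^- 2 = (x + 1)^-1 + (x * (x + 1) ^+ 2)^-1.
  by field; rewrite !gt_eqF //; lra.
by rewrite lerDl invr_ge0 mulr_ge0 ?sqr_ge0 // ltW.
Qed.

Lemma uniq_sum_le (s : seq nat) (f : nat -> R) (B : R) : uniq s -> (forall n, 0 <= f n) ->
  (forall m, \sum_(i < m) f i <= B) -> \sum_(i <- s) f i <= B.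
Proof.
move=> us f0 HB; pose m := (\max_(i <- s) i).+1.
apply: le_trans (HB m); rewrite -(big_mkord xpredT f) /index_iota subn0.
have -> : \sum_(i <- s) f i = \sum_(i <- [seq i <- iota 0 m | i \in s]) f i.
  apply: perm_big; apply: uniq_perm => //; first by rewrite filter_uniq // iota_uniq.
  move=> i; rewrite mem_filter mem_iota /= add0n ltnS.
  by case: (boolP (i \in s)) => //= si; rewrite (@leq_bigmax_seq _ s xpredT (fun k => k) i si).
rewrite big_filter big_mkcond; apply: ler_sum => i _.
by case: ifP.
Qed.

(** Comparison with [n ^ -2]. The bound covers arbitrary finite sets of indices, because the
    eigenvalues involved change with the vector. *)
Lemma sub_exponential_sum (d b : R) : 0 < d -> 0 < b -> exists2 B : R, 0 < B &
  forall s : seq nat, uniq s -> \sum_(n <- s) expR (- (d * n.+1%:R `^ b)) <= B.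
Proof.
move=> d0 b0; have [A A0 HA] := powR_expR_bound 2 d0 b0.
exists (A * 2) => [|s us]; first by rewrite mulr_gt0.
apply: (@uniq_sum_le s (fun n => expR (- (d * n.+1%:R `^ b)))) => // m.
apply: le_trans (_ : A * \sum_(i < m) (i.+1%:R ^- 2) <= _).
  rewrite mulr_sumr; apply: ler_sum => i _.
  have i0 : 0 < i.+1%:R :> R by rewrite ltr0n.
  rewrite ler_pdivlMr ?exprn_gt0 //.
  have := HA (ln i.+1%:R) _; rewrite /powR gt_eqF // => /(_ _)/wrap[].
    by rewrite ln_ge0 // ler1n.
  by rewrite expRM_natl lnK ?posrE // mulrC.
by rewrite ler_wpM2l ?(ltW A0) // sum_inv_sq_le.
Qed.

End Estimates.

(** * Cancelling the poles at the large eigenvalues *)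

Section DampedResolvent.
Context {R : realType} {H : normedModType R[i]} (dot : {dot H for Num.conj}).
Local Notation C := R[i].
Variables (T : operator H) (a q Om r1 : R).
Hypotheses (hH : forall x : H, `|x| ^+ 2 = dot x x) (a0 : 0 <= a) (r10 : 0 < r1)
  (Ompi : Om <= pi) (cosq : forall t, `|t| <= Om -> 0 <= cos (q * t)).
Local Notation damp := (damp a q).
Local Notation P := (riesz_proj T).

Definition in_sector (w : C) := ln r1 <= complex.Re w /\ `|complex.Im w| <= Om.

(** Weaker than membership in the resolvent set, and what a lower bound for [z - T] provides on the
    boundary of the region. *)
Definition not_eigenvalue (z : C) := forall v, op_dom T v -> op_fun T v = z *: v -> v = 0.

Lemma root_vector_eigenvalue l x : root_space T l x -> x != 0 -> ~ not_eigenvalue l.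
Proof.
move=> [k _]; elim: k x => [|k IH] x /=; first by move=> ->; rewrite eqxx.
move=> [dx kx] x0 ne; have [E|E] := eqVneq (op_fun T x - l *: x) 0.
  by move/eqP: x0; apply; apply: ne => //; apply/eqP; rewrite -subr_eq0 E.
exact: (IH _ kx E ne).
Qed.

Lemma rnorm_damp_le1 (w : C) : `|complex.Im w| <= Om -> rnorm (damp w) <= 1.
Proof.
case: w => s t /= tOm; rewrite rnorm_damp expR_le1 oppr_le0.
by rewrite mulr_ge0 // mulr_ge0 ?expR_ge0 ?cosq.
Qed.

Definition damping_coef (l : C) : C := if r1 < rnorm l then damp (clog l) else 0.

(* [g] is [exp (- a z ^ q) (z - T)^-1 x - exp (- a l ^ q) x / (z - l)] for a large
   eigenvalue [l] and [exp (- a z ^ q) (z - T)^-1 x] for a small one; in both cases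
   it has no singularity in the sector. *)
Lemma damped_root_vector l x : root_space T l x ->
  (x != 0 -> rnorm l < r1 \/
     [/\ r1 < rnorm l, `|arg l| < pi & op_dom T x /\ op_fun T x = l *: x]) ->
  exists (g : C -> H) (B s2 : R),
  [/\ forall w, in_sector w -> not_eigenvalue (cexp w) ->
        exists2 v, resolves T (cexp w) x v &
          g w = damp w *: v - (damping_coef l / (cexp w - l)) *: x,
      forall y w, in_sector w -> jet 3 (fun w => dot (g w) y) w &
      forall w, in_sector w -> s2 <= complex.Re w -> expR (complex.Re w) * rnorm (g w) <= B].
Proof.
move=> rx; have [-> _|x0 /(_ isT) hl] := eqVneq x 0.
  exists (fun=> 0), 0, 0; split=> [w _ _|y w _|w _ _].
  - exists 0; last by rewrite !scaler0 subrr.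
    by split; [exact: op_dom0 | rewrite op_fun0 scaler0 subrr].
  - by rewrite linear0l; apply: jet_cst.
  - by rewrite rnorm0 mulr0.
have ne w : not_eigenvalue (cexp w) -> cexp w != l.
  by move=> h; apply/eqP => E; rewrite E in h; apply: root_vector_eigenvalue rx x0 h.
have l1 : 0 < 2 * rnorm l + 1 by rewrite ltr_wpDl // mulr_ge0 // rnorm_ge0.
have big w : ln (2 * rnorm l + 1) <= complex.Re w -> 2 * rnorm l + 1 <= rnorm (cexp w).
  by rewrite rnorm_cexp -ler_expR lnK ?posrE.
case: hl => [lr1|[lr1 argl [dx ex]]].
  (* A small eigenvalue lies outside the region, so a pole of any order there is harmless and
     nothing is subtracted. *)
  have [k _ kx] := rx; have [rho [sol J [B B0 HB]]] := local_resolvent dot kx.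
  have wl w : in_sector w -> cexp w != l.
    move=> [sw _]; apply/eqP => E; move: lr1; rewrite -E rnorm_cexp.
    by rewrite -(lnK (r10 : r1 \is Num.pos)) ltr_expR ltNge sw.
  exists (fun w => damp w *: rho (cexp w)), B, (ln (2 * rnorm l + 1)); split=> [w Dw _|y w Dw|w Dw sw].
  - exists (rho (cexp w)); first exact/sol/wl.
    by rewrite /damping_coef ltNge ltW //= mul0r scale0r subr0.
  - apply: (@jet_ext _ _ (fun w => damp w * ((fun z => dot (rho z) y) \o cexp) w)).
      by exists 1 => // t _; rewrite linearZl_LR.
    apply: jetM; first exact: jet_damp.
    by apply: jet_comp; [apply/J/wl | exact: jet_cexp | exact: jet_cexp].
  - have z0 : 0 < rnorm (cexp w) by rewrite rnorm_cexp expR_gt0.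
    rewrite rnormZ -rnorm_cexp mulrCA mulrC -[leRHS]mulr1.
    rewrite ler_pM ?rnorm_ge0 ?mulr_ge0 ?rnorm_ge0 //; last by apply: rnorm_damp_le1; case: Dw.
    by rewrite mulrC -ler_pdivlMr // HB // big.
have l0 : l != 0 by rewrite -rnorm_gt0; apply: lt_trans lr1.
have lE := clogK l0.
(* The strict bound [|arg l| < pi] keeps the difference of the imaginary parts below [2 * pi] even
   for [|Im w| = pi]. *)
have imw w : in_sector w -> `|complex.Im (w - clog l)| < 2 * pi.
  move=> [_ h]; have -> : complex.Im (w - clog l) = complex.Im w - arg l by case: (w).
  apply: le_lt_trans (ler_normB _ _) _; rewrite mulr_natl mulr2n.
  by apply: ler_ltD => //; apply: le_trans h Ompi.
have Q w : in_sector w -> cexp w != l ->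
    damp_quotient a q (clog l) w = (damp w - damp (clog l)) / (cexp w - l).
  move=> Dw wl; rewrite -(damp_quotientE a q (imw _ Dw)) lE mulrAC divff ?mul1r //.
  by rewrite subr_eq0.
exists (fun w => damp_quotient a q (clog l) w *: x), ((1 + rnorm (damp (clog l))) * 2 * rnorm x), (ln (2 * rnorm l + 1)).
split=> [w Dw /ne wl|y w Dw|w Dw sw].
- exists ((cexp w - l)^-1 *: x).
    split; first exact: op_domZ.
    by rewrite op_funZ // ex scalerA mulrC -scalerA -scalerBr -scalerBl scalerA mulVf ?scale1r // subr_eq0.
  by rewrite Q // /damping_coef lr1 mulrBl scalerBl scalerA.
- apply: (@jet_ext _ _ (fun w => damp_quotient a q (clog l) w * dot x y)).
    by exists 1 => // t _; rewrite [dot (_ *: x) y]linearZl_LR.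
  by apply: jetM; [apply/jet_damp_quotient/imw | apply: jet_cst].
have hb := big _ sw; have ln0 := rnorm_ge0 l.
have z0 : 0 < rnorm (cexp w) by lra.
have zl : rnorm (cexp w) / 2 <= rnorm (cexp w - l) by have := lerB_rnorm (cexp w) l; lra.
have wl : cexp w != l by rewrite -subr_eq0 -rnorm_gt0; lra.
rewrite Q // -rnorm_cexp rnormZ mulrA ler_wpM2r ?rnorm_ge0 // rnormM rnormV mulrCA.
apply: ler_pM; rewrite ?rnorm_ge0 ?divr_ge0 ?rnorm_ge0 //.
  apply: le_trans (rnormB _ _) _; rewrite lerD2r; apply: rnorm_damp_le1; by case: Dw.
by rewrite ler_pdivrMr; lra.
Qed.

Variables (z0 : C) (lam : nat -> C).
Hypotheses (rz0 : resolvent_set T z0) (cz0 : compact_operator (resolvent T z0))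
  (hlam : eigenvalue_seq T lam) (lam_r1 : forall n, rnorm (lam n) != r1)
  (large : forall l, spectrum T l -> r1 < rnorm l ->
     `|arg l| < pi /\ root_space T l `<=` eigenspace_of T l).

(** The last clause supplies an index, through which the growth of the eigenvalue sequence
    enters. *)
Definition large_eigenvalue (l : C) :=
  [/\ spectrum T l, r1 < rnorm l & exists n, lam n = l].

Definition damped_projections (F : seq C) (z : C) (x : H) : H :=
  \sum_(l <- F) (damp (clog l) / (z - l)) *: P l x.

Lemma span_decomposition x :
  linear_span (\bigcup_(l in spectrum T) range (P l)) x ->
  exists n (l : 'I_n -> C) (y : 'I_n -> H),
    (forall i, spectrum T (l i) /\ P (l i) (y i) = y i) /\ x = \sum_i y i.
Proof.
move=> [n [b [v [hv ->]]]].
have hl i : exists l, spectrum T l /\ P l (b i *: v i) = b i *: v i.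
  have [l sl [u _ uv]] := hv i; exists l; split=> //.
  have [lP Pid _ _] := riesz_proj_facts hH rz0 cz0 sl.
  by rewrite (linear_mapZ lP) -uv Pid.
exists n, (fun i => sval (cid (hl i))), (fun i => b i *: v i); split=> // i.
exact: svalP (cid (hl i)).
Qed.

(** The functions belonging to the components of [x] are added up. Each Riesz projection keeps the
    components at its own eigenvalue and kills the others, so the subtracted terms regroup into
    multiples of [P l x]. These can be bounded in terms of [rnorm x], unlike the components of an
    arbitrary decomposition. *)
Lemma damped_span x : linear_span (\bigcup_(l in spectrum T) range (P l)) x ->
  exists (g : C -> H) (F : seq C) (B s2 : R),
  [/\ uniq F /\ (forall l, l \in F -> large_eigenvalue l),
      forall w, in_sector w -> not_eigenvalue (cexp w) ->
        exists2 v, resolves T (cexp w) x v &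
          g w = damp w *: v - damped_projections F (cexp w) x,
      forall y w, in_sector w -> jet 3 (fun w => dot (g w) y) w &
      forall w, in_sector w -> s2 <= complex.Re w -> expR (complex.Re w) * rnorm (g w) <= B].
Proof.
move=> /span_decomposition[n [l [y [hy ->]]]].
have rooty i : root_space T (l i) (y i).
  have [sl <-] := hy i; have [_ _ h _] := riesz_proj_facts hH rz0 cz0 sl; exact: h.
have inlam i : y i != 0 -> exists k, lam k = l i := root_vector_in_seq hlam (rooty i).
have hi i : exists gBs : (C -> H) * R * R,
  [/\ forall w, in_sector w -> not_eigenvalue (cexp w) ->
        exists2 v, resolves T (cexp w) (y i) v &
          gBs.1.1 w = damp w *: v - (damping_coef (l i) / (cexp w - l i)) *: y i,
      forall y w, in_sector w -> jet 3 (fun w => dot (gBs.1.1 w) y) w &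
      forall w, in_sector w -> gBs.2 <= complex.Re w -> expR (complex.Re w) * rnorm (gBs.1.1 w) <= gBs.1.2].
  suff hl : y i != 0 -> rnorm (l i) < r1 \/
     [/\ r1 < rnorm (l i), `|arg (l i)| < pi & op_dom T (y i) /\ op_fun T (y i) = l i *: y i].
    by have [g [B [s2 hg]]] := damped_root_vector (rooty i) hl; exists (g, B, s2).
  move=> y0; have [k E] := inlam i y0.
  have [h|h|h] := ltgtP (rnorm (l i)) r1; [by left | right | ].
    have [sl _] := hy i; have [h1 h2] := large sl h.
    by split=> //; have := h2 _ (rooty i).
  by have := lam_r1 k; rewrite E h eqxx.
pose gBs i := sval (cid (hi i)).
have hg i := svalP (cid (hi i)).
(* Several components may share an eigenvalue, hence [undup]; the condition [y i != 0] ensures that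
   the eigenvalue occurs in [lam]. *)
pose F := undup [seq l i | i <- enum 'I_n & (r1 < rnorm (l i)) && (y i != 0)].
have FP (m : C) : m \in F -> exists i, [/\ m = l i, r1 < rnorm (l i) & y i != 0].
  rewrite mem_undup => hm; have [ i ] := mapP hm.
  by rewrite mem_filter => /andP[/andP[h1 h2] _] ->; exists i.
have lF i : r1 < rnorm (l i) -> y i != 0 -> l i \in F.
  by move=> h1 h2; rewrite mem_undup; apply/map_f; rewrite mem_filter h1 h2 mem_enum.
have PF m i : m \in F -> P m (y i) = if l i == m then y i else 0.
  move=> /FP[j [-> _ _]]; case: eqP => [<-|ne]; first by case: (hy i).
  have [sj _] := hy j; have [_ _ _ h] := riesz_proj_facts hH rz0 cz0 sj.
  by apply: h (rooty i); apply/eqP.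
exists (fun w => \sum_i (gBs i).1.1 w), F, (\sum_i (gBs i).1.2), (\big[Num.max/0]_i (gBs i).2).
split=> [|w Dw hw|u w Dw|w Dw sw].
- split; first exact: undup_uniq.
  move=> m /FP[i [-> h1 h2]]; split=> //; first by case: (hy i).
  exact: inlam.
- have vi i : exists v, resolves T (cexp w) (y i) v /\
      (gBs i).1.1 w = damp w *: v - (damping_coef (l i) / (cexp w - l i)) *: y i.
    by have [h _ _] := hg i; have [v h1 h2] := h w Dw hw; exists v.
  exists (\sum_i sval (cid (vi i))).
    elim/big_rec2: _ => [|i u v _ [du Eu]].
      by split; [exact: op_dom0 | rewrite op_fun0 scaler0 subrr].
    have [[dv Ev] _] := svalP (cid (vi i)); split; first exact: op_domD.
    by rewrite op_funD // scalerDr opprD addrACA Ev Eu.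
  have -> : damped_projections F (cexp w) (\sum_i y i) =
      \sum_i (damping_coef (l i) / (cexp w - l i)) *: y i.
    transitivity (\sum_(m <- F) \sum_i (if l i == m then (damp (clog m) / (cexp w - m)) *: y i else 0)).
      rewrite /damped_projections big_seq [RHS]big_seq; apply: eq_bigr => m mF.
      have [j [mE _ _]] := FP m mF; have [sj _] := hy j.
      have [lP _ _ _] := riesz_proj_facts hH rz0 cz0 sj.
      rewrite mE (linear_map_sum lP) scaler_sumr -mE; apply: eq_bigr => i _.
      by rewrite PF //; case: ifP => // _; rewrite scaler0.
    rewrite exchange_big; apply: eq_bigr => i _; rewrite -big_mkcond /=.
    have [y0|y0] := eqVneq (y i) 0.
      by rewrite y0 scaler0 big1 // => m _; rewrite scaler0.
    rewrite /damping_coef; case: ifP => [h|h].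
      under eq_bigl => m do rewrite eq_sym.
      by rewrite -big_filter filter_pred1_uniq ?undup_uniq ?lF // big_seq1.
    rewrite mul0r scale0r big_seq_cond big1 // => m /andP[/FP[j [-> h1 _]] /eqP E].
    by rewrite E h1 in h.
  rewrite scaler_sumr -sumrB; apply: eq_bigr => i _.
  by have [_ E] := svalP (cid (vi i)); exact: E.
- apply: (@jet_ext _ _ (fun w => \sum_(i <- index_enum 'I_n) dot ((gBs i).1.1 w) u)).
    by exists 1 => // t _; rewrite linear_sumlz.
  by apply: jet_sum => i; have [_ h _] := hg i; apply: h.
- apply: le_trans (_ : \sum_i expR (complex.Re w) * rnorm ((gBs i).1.1 w) <= _).
    by rewrite -mulr_sumr ler_wpM2l ?expR_ge0 // rnorm_sum.
  apply: ler_sum => i _; have [_ _ h] := hg i; apply: h => //.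
  by apply: le_trans sw; apply: le_bigmax.
Qed.

End DampedResolvent.

Section ResolventSetOpen.
Context {R : realType} {H : completeNormedModType R[i]}.
Local Notation C := R[i].

Lemma neumann_solution (G : H -> H) (y : H) : linear G ->
  (forall x, rnorm (G x) <= rnorm x / 2) -> exists x, x = y + G x.
Proof.
move=> lG hG; pose u n := iter n (fun x => y + G x) 0.
have ub n : rnorm (u n) <= 2 * rnorm y.
  elim: n => [|n IH]; first by rewrite rnorm0 mulr_ge0 ?rnorm_ge0.
  by rewrite /= (le_trans (rnormD _ _)) //; have := hG (u n); lra.
have ud n k : rnorm (u (n + k)%N - u n) <= 2^-1 ^+ n * (2 * rnorm y).
  elim: n => [|n IH]; first by rewrite add0n subr0 expr0 mul1r.
  rewrite addSn /= opprD addrACA subrr add0r -(linear_mapB lG).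
  apply: le_trans (hG _) _; rewrite exprS -mulrA.
  by rewrite mulrC ler_pM2l // invr_gt0.
have small (e : R) : 0 < e -> exists n, 2^-1 ^+ n * (2 * rnorm y) < e.
  move=> e0; have D0 : 0 < 2 * rnorm y + 1 by rewrite ltr_wpDl // mulr_ge0 ?rnorm_ge0.
  exists (Num.bound ((2 * rnorm y + 1) / e)).
  set n := Num.bound _.
  have h : (2 * rnorm y + 1) / e < n%:R by apply: archi_boundP; rewrite divr_ge0 ?ltW.
  have n2 : n%:R <= 2 ^+ n :> R by rewrite -natrX ler_nat ltnW // ltn_expl.
  rewrite exprVn mulrC ltr_pdivrMr ?exprn_gt0 //.
  have k1 : (2 * rnorm y + 1) < e * n%:R by rewrite [e * _]mulrC -ltr_pdivrMr.
  have k2 : e * n%:R <= e * 2 ^+ n by rewrite ler_pM2l.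
  by apply: lt_le_trans k2; apply: lt_trans k1; rewrite ltrDl.
have : cvg (u @ \oo).
  apply: cauchy_cvg; apply: cauchy_exP => e; rewrite ltcE /= => /andP[/eqP ei e0].
  have [n hn] := small (complex.Re e) e0; exists (u n); exists n => // m /= nm.
  have eE : e = (complex.Re e)%:C by case: e ei {e0 hn} => ? ? /= ->.
  rewrite -ball_normE /= eE normr_lt_rnorm rdistC.
  by apply: le_lt_trans hn; rewrite -(subnKC nm).
move=> /cvg_ex[p up]; exists p; apply/eqP; rewrite -subr_eq0 -rnorm_eq0 eq_le rnorm_ge0 andbT.
apply: (@le0_eps _ _ 2) => e e0 _.
have e0' : 0 < e%:C :> C by rewrite ltcR.
have /cvgrPdist_lt /(_ _ e0') [n _ hn] := up.
have h1 := hn n (leqnn _); have h2 := hn n.+1 (leqnSn _).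
rewrite /= normr_lt_rnorm in h1; rewrite /= normr_lt_rnorm in h2.
have -> : p - (y + G p) = (p - (y + G (u n))) - G (p - u n).
  by rewrite (linear_mapB lG) opprB !opprD !addrA subrK.
apply: le_trans (rnormB _ _) _; have := hG (p - u n); lra.
Qed.

Variable T : operator H.

Lemma resolvent_set_open z : resolvent_set T z ->
  exists2 e : R, 0 < e & forall z', rnorm (z' - z) < e -> resolvent_set T z'.
Proof.
move=> rz; have lS := resolvent_linear rz; have [M M0 HM] := resolvent_bound rz.
exists (2 * M)^-1; first by rewrite invr_gt0 mulr_gt0.
move=> z' zz'; pose G x := (z - z') *: resolvent T z x.
have lG : linear G by move=> a x y; rewrite /G lS scalerDr !scalerA mulrC.
have hG x : rnorm (G x) <= rnorm x / 2.
  rewrite /G rnormZ rdistC; apply: le_trans (_ : (2 * M)^-1 * (M * rnorm x) <= _).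
    by rewrite ler_pM ?rnorm_ge0 // ltW.
  by rewrite invfM mulrA mulfVK ?gt_eqF // mulrC.
have fixP y x : resolves T z' y x <-> x = resolvent T z y + G x.
  have Ge : resolvent T z y + G x = resolvent T z (y + (z - z') *: x).
    by rewrite /G (linear_mapD lS) (linear_mapZ lS).
  rewrite Ge; split.
    move=> [dx Ex]; apply: resolvent_uniq => //; split=> //.
    by rewrite -Ex scalerBl [RHS]addrC addrA subrK.
  move=> E; have := resolvent_sol (y + (z - z') *: x) rz; rewrite -E => -[dx Ex]; split=> //.
  have -> : z' *: x - op_fun T x = (z *: x - op_fun T x) - (z - z') *: x.
    by rewrite scalerBl opprB [RHS]addrC addrA subrK.
  by rewrite Ex addrK.
have ex y : exists x, resolves T z' y x.
  by have [x /fixP h] := neumann_solution (resolvent T z y) lG hG; exists x.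
have bound y x : resolves T z' y x -> rnorm x <= 2 * M * rnorm y.
  move=> /fixP E; have := rnormD (resolvent T z y) (G x); rewrite -E.
  have := HM y; have := hG x; lra.
split.
  move=> y; have [x hx] := ex y; exists x; split=> // x' hx'.
  apply/eqP; rewrite -subr_eq0 -rnorm_eq0 eq_le rnorm_ge0 andbT.
  have : resolves T z' 0 (x - x').
    have := resolvesP (-1) hx' hx; rewrite !scaleN1r addNr.
    by rewrite [- x' + x]addrC.
  by move=> /bound; rewrite rnorm0 mulr0.
apply: le_lt_trans (_ : ((2 * M)%:E < +oo)%E); last exact: ltry.
apply: opnorm_le_fin => y y1.
have /bound h : resolves T z' y (resolvent T z' y).
  by have [x hx] := ex y; apply: (@xgetPex _ _ [set x | resolves T z' y x]); exists x.
by apply: le_trans h _; rewrite ler_piMr // mulr_ge0 // ltW.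
Qed.

Lemma dist_spectrum_gt0 z : spectrum T !=set0 -> resolvent_set T z -> 0 < dist z (spectrum T).
Proof.
move=> [l sl] /resolvent_set_open[e e0 he]; apply: lt_le_trans e0 _.
apply: lb_le_inf; first by exists (rnorm (z - l)), l.
move=> _ [w sw <-]; rewrite leNgt; apply/negP => lt; apply: sw; apply: he.
by rewrite rdistC.
Qed.

End ResolventSetOpen.

Section EigenvalueSequence.
Context {R : realType} {H : normedModType R[i]} (T : operator H) (lam : nat -> R[i]).
Hypothesis hlam : eigenvalue_seq T lam.

Lemma lam_spectrum n : spectrum T (lam n).
Proof.
have [/(_ (lam n))[m [b [bfree bE]] card] _] := hlam.
case: m b bfree bE card => [|m] b bfree bE card.
  have : [set k | lam k = lam n] n by [].
  by move: card; rewrite II0 card_eq0 => /eqP ->.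
have b0 : b ord0 != 0.
  apply/eqP => b0; have := bfree (fun i => (i == ord0)%:R) _ ord0.
  rewrite eqxx => /(_ _)/wrap[|/eqP]; last by rewrite oner_eq0.
  by rewrite (bigD1 ord0) //= b0 scaler0 add0r big1 // => i /negPf ->; rewrite scale0r.
have rb : root_space T (lam n) (b ord0).
  rewrite bE; exists (fun j => (j == ord0)%:R); rewrite (bigD1 ord0) // eqxx scale1r /=.
  by rewrite big1 ?addr0 // => j /negPf ->; rewrite scale0r.
apply: contrapT => nsp; apply: (root_vector_eigenvalue rb b0) => v dv ev.
apply/eqP; apply: contrapT => /negP v0; apply: nsp.
exact: eigenvector_spectrum v0 dv ev.
Qed.

(** [r2] is the first modulus above [r0], and [r1] lies halfway. The circle [|z| = r1] then carries
    no eigenvalue and has distance at least [r2 - r1] from the larger ones. *)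
Lemma modulus_gap (r0 : R) : (forall A : R, exists n, A < rnorm (lam n)) ->
  exists r1 r2 : R, [/\ r0 < r1, r1 < r2 & forall n, rnorm (lam n) < r1 \/ r2 <= rnorm (lam n)].
Proof.
move=> /(_ r0)/cid[n0 hn0]; have [_ mono] := hlam.
have mon m n : (m <= n)%N -> rnorm (lam m) <= rnorm (lam n).
  elim: n => [|n IH]; first by rewrite leqn0 => /eqP ->.
  by rewrite leq_eqVlt => /orP[/eqP -> //|/IH h]; apply: le_trans (mono n).
have [n hn nmin] := ex_minnP (ex_intro (fun n => r0 < rnorm (lam n)) n0 hn0).
exists ((r0 + rnorm (lam n)) / 2), (rnorm (lam n)); split; [lra | lra |] => k.
have [nk|kn] := leqP n k; first by right; apply: mon.
left; have : rnorm (lam k) <= r0.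
  by rewrite leNgt; apply/negP => /nmin; rewrite leqNgt kn.
lra.
Qed.

End EigenvalueSequence.

(** * From boundary estimates to a bound uniform in the vector *)

Section DampedBound.
Context {R : realType} {H : normedModType R[i]} (dot : {dot H for Num.conj}).
Local Notation C := R[i].
Variables (T : operator H) (a q Om r1 : R).
Hypotheses (hH : forall x : H, `|x| ^+ 2 = dot x x) (a0 : 0 <= a) (r11 : 1 <= r1)
  (Ompi : Om <= pi) (cosq : forall t, `|t| <= Om -> 0 <= cos (q * t)).
Variables (z0 : C) (lam : nat -> C).
Hypotheses (rz0 : resolvent_set T z0) (cz0 : compact_operator (resolvent T z0))
  (hlam : eigenvalue_seq T lam) (lam_r1 : forall n, rnorm (lam n) != r1)
  (large : forall l, spectrum T l -> r1 < rnorm l ->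
     `|arg l| < pi /\ root_space T l `<=` eigenspace_of T l).
Variables (thm : R -> R) (C0 A1 c1 c2 c3 : R).
Hypotheses (cthm : continuous thm) (thmOm : forall s, ln r1 <= s -> thm s <= Om)
  (C00 : 0 <= C0) (A10 : 0 <= A1) (c10 : 0 < c1) (c20 : 0 < c2) (c30 : 0 < c3)
  (hC0 : forall F, uniq F -> (forall l, l \in F -> large_eigenvalue T r1 lam l) ->
     forall x d z, 0 < d -> (forall l, l \in F -> d <= rnorm (z - l)) ->
       rnorm (damped_projections T a q F z x) <= C0 / d * rnorm x)
  (left_res : forall t v, `|t| <= Om -> op_dom T v ->
     c1 * rnorm v <= rnorm (cexp (ln r1 +i* t) *: v - op_fun T v))
  (left_dist : forall t l, large_eigenvalue T r1 lam l -> c2 <= rnorm (cexp (ln r1 +i* t) - l))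
  (edge_dist : forall s t l, ln r1 <= s -> `|t| = thm s -> large_eigenvalue T r1 lam l ->
     c3 * expR s <= rnorm (cexp (s +i* t) - l))
  (edge_res : forall s t, ln r1 <= s -> `|t| = thm s -> exists m : R, [/\ 0 < m,
     expR s * rnorm (damp a q (s +i* t)) / m <= A1 &
     forall v, op_dom T v -> m * rnorm v <= rnorm (cexp (s +i* t) *: v - op_fun T v)]).

(** The first summand bounds [z g(z)] on the arc [|z| = r1], the second on the two edges, both
    relative to [rnorm x]. *)
Let B0 := r1 * (c1^-1 + C0 / c2) + (A1 + C0 / c3).

(** [strip_bound] is applied to the pairing of [g] with each [y]. The growth constants [B] and [s2]
    of [g] depend on [x], but only the boundary constants survive, so [B0] is uniform. *)
Lemma damped_bound x : linear_span (\bigcup_(l in spectrum T) range (riesz_proj T l)) x ->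
  exists F, [/\ uniq F, forall l, l \in F -> large_eigenvalue T r1 lam l &
    forall s t, ln r1 <= s -> `|t| <= thm s -> not_eigenvalue T (cexp (s +i* t)) ->
    exists2 v, resolves T (cexp (s +i* t)) x v &
      rnorm (damp a q (s +i* t) *: v - damped_projections T a q F (cexp (s +i* t)) x)
        <= B0 / expR s * rnorm x].
Proof.
move=> xs; have r10 : 0 < r1 := lt_le_trans ltr01 r11.
have [g [F [B [s2 [[uF lF] gE gJ gB]]]]] :=
  damped_span hH a0 r10 Ompi cosq rz0 cz0 hlam lam_r1 large xs.
exists F; split=> // s t s1 tt ne.
have sect s' t' : ln r1 <= s' -> `|t'| <= thm s' -> in_sector Om r1 (s' +i* t').
  by move=> h1 h2; split=> //=; apply: le_trans h2 (thmOm h1).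
have [v hv vE] := gE _ (sect _ _ s1 tt) ne; exists v => //; rewrite -vE.
have B00 : 0 <= B0.
  by rewrite addr_ge0 ?mulr_ge0 ?addr_ge0 ?mulr_ge0 ?invr_ge0 ?(ltW c10) ?(ltW c20) ?(ltW c30) // ltW.
(* A positive lower bound excludes eigenvectors, which is what identifies [g] at a boundary
   point. *)
have noev (z : C) (m : R) : 0 < m ->
    (forall v, op_dom T v -> m * rnorm v <= rnorm (z *: v - op_fun T v)) -> not_eigenvalue T z.
  move=> m0 hm u du eu; apply/eqP; rewrite -rnorm_eq0 eq_le rnorm_ge0 andbT.
  by have := hm u du; rewrite eu subrr rnorm0 pmulr_rle0.
have edge s' t' (m K' : R) : in_sector Om r1 (s' +i* t') -> 0 < m -> 
    (forall v, op_dom T v -> m * rnorm v <= rnorm (cexp (s' +i* t') *: v - op_fun T v)) ->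
    0 < K' -> (forall l, l \in F -> K' <= rnorm (cexp (s' +i* t') - l)) ->
    rnorm (g (s' +i* t')) <= (rnorm (damp a q (s' +i* t')) / m + C0 / K') * rnorm x.
  move=> D' m0 hm K'0 hK'; have [u [du Eu] ->] := gE _ D' (noev _ _ m0 hm).
  apply: le_trans (rnormB _ _) _; rewrite mulrDl lerD ?hC0 // rnormZ -mulrA.
  rewrite ler_wpM2l ?rnorm_ge0 // mulrC ler_pdivlMr // mulrC.
  by apply: le_trans (hm u du) _; rewrite Eu.
rewrite mulrAC ler_pdivlMr ?expR_gt0 // mulrC.
rewrite -ler_pdivlMl ?expR_gt0 //.
apply: (rnorm_le_dot hH).
  by rewrite mulr_ge0 ?invr_ge0 ?expR_ge0 // mulr_ge0 ?rnorm_ge0.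
move=> y; rewrite -mulrA ler_pdivlMl ?expR_gt0 //.
apply: (@strip_bound _ (fun w => dot (g w) y) thm (ln r1) s2 Om _ (B * rnorm y)) => //.
- by rewrite ln_ge0.
- by rewrite mulr_ge0 ?rnorm_ge0 // mulr_ge0 ?rnorm_ge0.
- by move=> s' t' h1 h2; apply/gJ/sect.
- move=> t' ht'; have D' := sect _ _ (lexx (ln r1)) ht'.
  have tOm : `|t'| <= Om by case: D'.
  apply: le_trans (_ : expR (ln r1) * (rnorm (g (ln r1 +i* t')) * rnorm y) <= _).
    by rewrite ler_wpM2l ?expR_ge0 // (cauchy_schwarz hH).
  rewrite mulrA ler_wpM2r ?rnorm_ge0 // lnK ?posrE //.
  have h := edge _ _ _ _ D' c10 (fun v => @left_res t' v tOm) c20 (fun l lin => left_dist t' (lF l lin)).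
  apply: le_trans (_ : r1 * ((c1^-1 + C0 / c2) * rnorm x) <= _).
    rewrite ler_pM2l //; apply: le_trans h _; rewrite ler_wpM2r ?rnorm_ge0 // lerD2r.
    rewrite ler_piMl ?invr_ge0 ?(ltW c10) //; exact: (rnorm_damp_le1 a0 cosq (w := ln r1 +i* t')).
  by rewrite mulrA ler_wpM2r ?rnorm_ge0 // lerDl addr_ge0 ?divr_ge0 ?(ltW c30).
- move=> s' t' h1 h2; have D' : in_sector Om r1 (s' +i* t') by apply: sect; rewrite ?h2.
  have [m [m0 hA hm]] := edge_res h1 h2.
  apply: le_trans (_ : expR s' * (rnorm (g (s' +i* t')) * rnorm y) <= _).
    by rewrite ler_wpM2l ?expR_ge0 // (cauchy_schwarz hH).
  rewrite mulrA ler_wpM2r ?rnorm_ge0 //.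
  have K0 : 0 < c3 * expR s' by rewrite mulr_gt0 ?expR_gt0.
  have h := edge _ _ _ _ D' m0 hm K0 (fun l lin => edge_dist h1 h2 (lF l lin)).
  apply: le_trans (_ : (A1 + C0 / c3) * rnorm x <= _); last first.
    rewrite ler_wpM2r ?rnorm_ge0 // lerDr mulr_ge0 ?(ltW r10) // addr_ge0 ?invr_ge0 ?(ltW c10) //.
    by rewrite divr_ge0 // ltW.
  apply: le_trans (_ : expR s' * ((rnorm (damp a q (s' +i* t')) / m + C0 / (c3 * expR s')) * rnorm x) <= _).
    by rewrite ler_wpM2l ?expR_ge0.
  rewrite mulrA ler_wpM2r ?rnorm_ge0 // mulrDr lerD //; first by rewrite mulrA.
  rewrite invfM mulrCA !mulrA.
  by rewrite mulrAC [C0 * _ / _]mulfK // gt_eqF ?expR_gt0.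
- move=> s' t' h1 h2 h3; rewrite mulrC.
  apply: le_trans (_ : rnorm (g (s' +i* t')) * rnorm y * expR s' <= _).
    by rewrite ler_wpM2r ?expR_ge0 // (cauchy_schwarz hH).
  rewrite mulrAC ler_wpM2r ?rnorm_ge0 // mulrC.
  exact: (gB _ (sect _ _ h1 h3) h2).
Qed.

End DampedBound.

(** * The damping on the edges of the sector *)

Section EdgeEstimates.
Context {R : realType}.

Lemma norm_sin_le (x : R) : `|x| <= 1 -> `|sin x| <= `|x|.
Proof.
move=> x1; have := @le_pow_integral _ sin cos 1 0 (@sin0 R) (@is_derive_sin R) _ x x1.
by rewrite mul1r expr1; apply => y _; rewrite expr0 mulr1 cos_max.
Qed.

Lemma sin_ge_half (y : R) : 0 <= y -> y <= 1 / 2 -> y / 2 <= sin y.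
Proof.
move=> y0 y1; have yn : `|y| <= 1 by rewrite ger0_norm //; lra.
have [_] := sin_cos_taylor yn; rewrite (ger0_norm y0) ler_norml => /andP[h _].
have y2 : y ^+ 2 <= 1 / 4 by rewrite expr2; nra.
have y20 := sqr_ge0 y.
have y3 : y ^+ 3 <= y / 4 by rewrite exprS; nra.
have y5 : y ^+ 5 <= y / 16.
  by have -> : y ^+ 5 = y * (y ^+ 2 * y ^+ 2) by [ring]; nra.
lra.
Qed.

Lemma rnorm_expiB (s t : R) : `|s - t| <= 1 -> rnorm (expi s - expi t) <= `|s - t|.
Proof.
move=> st; rewrite -(@ler_pXn2r _ 2) ?nnegrE ?rnorm_ge0 //.
have := rnorm_polar 1 1 s t; rewrite !mul1r => ->.
have h2 : `|(s - t) / 2| <= 1 by rewrite normrM (@ger0_norm _ 2^-1) //; have := normr_ge0 (s - t); lra.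
have hs : sin ((s - t) / 2) ^+ 2 <= ((s - t) / 2) ^+ 2.
  by rewrite -[leLHS]real_normK ?num_real // -[leRHS]real_normK ?num_real // lerXn2r ?nnegrE // norm_sin_le.
rewrite real_normK ?num_real //; move: hs; rewrite sin2cos2 expr1n.
have := cos_mulr2n ((s - t) / 2); rewrite -[_ / 2 *+ 2]mulr_natr divfK ?pnatr_eq0 // => ->.
by rewrite exprMn exprVn; lra.
Qed.

(** For [rho < 1 / 2] the angle [q * |t|] stays below [rho * pi < pi / 2], so the cosine has a
    positive lower bound and [b = q]. For [rho = 1 / 2] the bent edge gives [q * |t| = pi / 2 - y]
    with [y] a multiple of [exp (- (N + 1) * s)]; the cosine is [sin y >= y / 2], which costs only
    that power and leaves [b = p / 2 - (N + 1)]. *)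
Lemma edge_damping (p : nat) (rho N c0 : R) : (0 < p)%N -> 0 < rho -> 0 < c0 ->
  c0 * p%:R <= 1 -> -1 <= N ->
  rho < 1 / 2 \/ (rho = 1 / 2 /\ N < -1 + 1 / (2 * p%:R)) ->
  exists b c2 : R, [/\ 0 < b, 0 < c2 & forall s t, 0 <= s ->
    `|t| = pi / p%:R - c0 * expR (- ((N + 1) * s)) ->
    c2 * expR (b * s) <= expR (p%:R * rho * s) * cos (p%:R * rho * t)].
Proof.
move=> p0 rho0 c00 c0p hN hcase.
have pR : 0 < p%:R :> R by rewrite ltr0n.
have pi0 := pi_gt0 R.
have p1 : 1 <= p%:R :> R by rewrite ler1n.
have cosE t : cos (p%:R * rho * t) = cos (p%:R * rho * `|t|).
  by rewrite -cos_norm normrM ger0_norm // mulr_ge0 // ltW.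
case: hcase => [h|[rhoE hN1]].
  exists (p%:R * rho), (cos (rho * pi)); split; first exact: mulr_gt0.
    by rewrite cos_gt0_pihalf //; apply/andP; split; nra.
  move=> s t s0 tE; rewrite mulrC ler_pM2l ?expR_gt0 // cosE tE.
  have -> : p%:R * rho * (pi / p%:R - c0 * expR (- ((N + 1) * s))) =
     rho * pi - p%:R * rho * (c0 * expR (- ((N + 1) * s))) by field; rewrite gt_eqF.
  have e0 : 0 <= p%:R * rho * (c0 * expR (- ((N + 1) * s))).
    by rewrite !mulr_ge0 ?expR_ge0 ?(ltW rho0) ?(ltW c00).
  apply: ler_cos; [|lra|nra].
  have -> : rho * pi - p%:R * rho * (c0 * expR (- ((N + 1) * s))) = p%:R * rho * `|t|.
    by rewrite tE; field; rewrite gt_eqF.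
  by rewrite !mulr_ge0 ?(ltW rho0).
rewrite rhoE in cosE *; exists (p%:R * (1 / 2) - (N + 1)), (p%:R * c0 / 4); split.
(* This turns the bound on [N] into [N + 1 < p / 2], that is [b > 0]. *)
- have : 1 / (2 * p%:R) <= p%:R * (1 / 2) :> R.
    rewrite ler_pdivrMr ?mulr_gt0 //; nra.
  lra.
- by rewrite !mulr_gt0.
move=> s t s0 tE; rewrite cosE tE; set e := expR (- _).
have e0 : 0 < e by exact: expR_gt0.
have e1 : e <= 1 by rewrite expR_le1 oppr_le0 mulr_ge0 //; lra.
pose y := p%:R * c0 / 2 * e.
have -> : p%:R * (1 / 2) * (pi / p%:R - c0 * e) = - (y - pi / 2).
  by rewrite /y; field; rewrite gt_eqF.
rewrite cosN cosBpihalf.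
have y0 : 0 <= y by rewrite /y !mulr_ge0 ?(ltW c00) ?(ltW e0).
have y12 : y <= 1 / 2.
  have : p%:R * c0 * e <= 1 by rewrite mulr_ile1 ?mulr_ge0 ?(ltW c00) ?(ltW e0) // mulrC.
  by rewrite /y; lra.
have := sin_ge_half y0 y12 => hs.
rewrite mulrBl expRB -expRN -/e.
apply: le_trans (_ : expR (p%:R * (1 / 2) * s) * (y / 2) <= _).
  by rewrite le_eqVlt; apply/orP; left; apply/eqP; rewrite /y; field.
by rewrite ler_pM2l ?expR_gt0.
Qed.

End EdgeEstimates.

Section RayBound.
Context {R : realType} {H : normedModType R[i]} (T : operator H).
Local Notation C := R[i].

Lemma resolvent_lower_bound (z : C) (M : R) : 0 < M -> resolvent_set T z ->
  (opnorm (resolvent T z) <= M%:E)%E ->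
  forall v, op_dom T v -> M^-1 * rnorm v <= rnorm (z *: v - op_fun T v).
Proof.
move=> M0 rz hM v dv; rewrite ler_pdivrMl //.
have {1}-> : v = resolvent T z (z *: v - op_fun T v) by apply: resolvent_uniq.
exact: (opnorm_leP (linear_mapZ (resolvent_linear rz)) hM).
Qed.

Lemma lower_bound_shift (z z' : C) (m e : R) :
  (forall v, op_dom T v -> m * rnorm v <= rnorm (z *: v - op_fun T v)) ->
  rnorm (z' - z) <= e ->
  forall v, op_dom T v -> (m - e) * rnorm v <= rnorm (z' *: v - op_fun T v).
Proof.
move=> hm he v dv; have -> : z' *: v - op_fun T v = (z *: v - op_fun T v) + (z' - z) *: v.
  by rewrite scalerBl [RHS]addrC addrA subrK.
have := lerB_rnorm (z *: v - op_fun T v) (- ((z' - z) *: v)); rewrite opprK rnormN rnormZ.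
have := hm v dv; have : rnorm (z' - z) * rnorm v <= e * rnorm v by rewrite ler_wpM2r ?rnorm_ge0.
rewrite mulrBl; lra.
Qed.

(** The first and the last ray are the ones that bound the sector; the last has angle
    [2 * pi - pi / p]. For [p = 1] they coincide, and the angle is recorded as [pi]. *)
Lemma expi_rays (p k : nat) : (0 < p)%N -> k = 0%N \/ k = p.-1 ->
  expi (pi / p%:R * (1 + 2 * k%:R) : R) = expi (if k == 0%N then pi / p%:R else - (pi / p%:R)).
Proof.
move=> p0 hk; have pR : p%:R != 0 :> R by rewrite pnatr_eq0 -lt0n.
case: eqVneq => [->|k0]; first by rewrite mulr0 addr0 mulr1.
case: hk => [k00|->]; first by rewrite k00 eqxx in k0.
rewrite -[in RHS]expiD2pi; congr expi.
have -> : p.-1%:R = p%:R - 1 :> R by rewrite -[p in RHS](prednK p0) -natr1 addrK.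
by field.
Qed.

End RayBound.

(** * Summability of the damped projections *)

Section DampedProjections.
Context {R : realType} {H : normedModType R[i]} (T : operator H).
Local Notation C := R[i].

(** The damping exponent is at least [(1 + delta) * gamma * |l| ^ q], against the growth
    [(1 + o) * gamma * |l| ^ q] of the projection. Half of [delta] absorbs [o]; the other half
    remains as decay. *)
Lemma damped_riesz_bound (a q gamma delta kap o : R) (l : C) x : 
  linear (riesz_proj T l) -> l != 0 -> 0 <= a -> 0 <= gamma ->
  a * kap = (1 + delta) * gamma -> kap <= cos (q * arg l) -> `|o| <= delta / 2 ->
  (opnorm (riesz_proj T l) <= (expR (gamma * rnorm l `^ q * (1 + o)))%:E)%E ->
  rnorm (damp a q (clog l)) * rnorm (riesz_proj T l x) <=
    expR (- (delta / 2 * gamma * rnorm l `^ q)) * rnorm x.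
Proof.
move=> lP l0 a0 g0 aE hk ho hP.
have n0 : 0 < rnorm l by rewrite rnorm_gt0.
have hx := opnorm_leP (linear_mapZ lP) hP x.
apply: le_trans (_ : rnorm (damp a q (clog l)) *
  (expR (gamma * rnorm l `^ q * (1 + o)) * rnorm x) <= _).
  by rewrite ler_wpM2l ?rnorm_ge0.
rewrite mulrA ler_wpM2r ?rnorm_ge0 // rnorm_damp -expRD ler_expR.
have -> : expR (q * ln (rnorm l)) = rnorm l `^ q by rewrite /powR gt_eqF.
have : 0 <= rnorm l `^ q by exact: powR_ge0.
move: (rnorm l `^ q) => L L0.
have h1 : a * (L * kap) <= a * (L * cos (q * arg l)) by rewrite ler_wpM2l // ler_wpM2l.
have h2 : gamma * L * o <= gamma * L * (delta / 2).
  by rewrite ler_wpM2l ?mulr_ge0 // (le_trans (ler_norm _)).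
have h3 : a * (L * kap) = (1 + delta) * gamma * L by rewrite -aE; ring.
rewrite mulrDr mulr1; move: h1 h2; rewrite h3; lra.
Qed.

(** Distinct eigenvalues have distinct indices in [lam], so the sum over [F] is dominated by a sum
    over distinct indices, whatever the size of [F]. *)
Lemma damped_projections_bound (lam : nat -> C) (a q r1 d b : R) : 0 < d -> 0 < b ->
  (forall n x, large_eigenvalue T r1 lam (lam n) ->
     rnorm (damp a q (clog (lam n))) * rnorm (riesz_proj T (lam n) x) <=
       expR (- (d * n.+1%:R `^ b)) * rnorm x) ->
  exists2 C0 : R, 0 < C0 &
    forall F, uniq F -> (forall l, l \in F -> large_eigenvalue T r1 lam l) ->
    forall x e z, 0 < e -> (forall l, l \in F -> e <= rnorm (z - l)) ->
      rnorm (damped_projections T a q F z x) <= C0 / e * rnorm x.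
Proof.
move=> d0 b0 hP; have [C0 C00 HC0] := sub_exponential_sum d0 b0.
exists C0 => // F uF lF x e z e0 he.
have [idx hidx] : exists idx : C -> nat, forall l, l \in F -> lam (idx l) = l.
  exists (fun l => xget 0%N [set n | lam n = l]) => l /lF[_ _ [n hn]].
  by apply: (@xgetPex _ 0%N [set k | lam k = l]); exists n.
have uI : uniq (map idx F).
  by rewrite map_inj_in_uniq // => l m lF' mF' E; rewrite -(hidx _ lF') E hidx.
apply: le_trans (rnorm_sum _ _ _) _.
apply: le_trans (_ : \sum_(l <- F) expR (- (d * (idx l).+1%:R `^ b)) * (rnorm x / e) <= _).
  rewrite big_seq [leRHS]big_seq; apply: ler_sum => l lF'.
  rewrite rnormZ rnormM rnormV mulrAC mulrA.
  have h := hP (idx l) x; rewrite (hidx _ lF') in h.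
  rewrite ler_pM ?mulr_ge0 ?rnorm_ge0 ?invr_ge0 ?rnorm_ge0 //; first exact/h/lF.
  by rewrite lef_pV2 ?posrE ?he // (lt_le_trans e0) ?he.
rewrite -mulr_suml mulrAC -mulrA ler_wpM2r ?mulr_ge0 ?rnorm_ge0 ?invr_ge0 ?(ltW e0) //.
by have := HC0 _ uI; rewrite big_map.
Qed.

End DampedProjections.

Section EdgeResolvent.
Context {R : realType} {H : normedModType R[i]} (T : operator H).
Local Notation C := R[i].

(* Moving from a ray where the resolvent is at most [K r ^ N] by the angle
   [c0 r ^ - (N + 1)] changes [z - T] by [c0 r ^ - N], at most half its lower bound. *)
Lemma edge_lower_bound (p : nat) (K N Rad c0 : R) : (0 < p)%N -> 0 < K ->
  0 < c0 -> c0 <= 1 -> c0 <= 1 / (2 * K) -> -1 <= N -> c0 <= pi / p%:R ->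
  (forall (r : R) (k : nat), Rad + 1 <= r -> (k < p)%N ->
     let z := r%:C * expi (pi / p%:R * (1 + 2 * k%:R)) in
     resolvent_set T z /\ (opnorm (resolvent T z) <= (K * r `^ N)%:E)%E) ->
  forall s t v, 0 <= s -> Rad + 1 <= expR s ->
    `|t| = pi / p%:R - c0 * expR (- ((N + 1) * s)) -> op_dom T v ->
    expR (- (N * s)) / (2 * K) * rnorm v <= rnorm (cexp (s +i* t) *: v - op_fun T v).
Proof.
move=> p0 K0 c00 c01 cK hN cp rays s t v s0 hs tE dv.
set e := expR (- _) in tE.
have e0 : 0 < e by exact: expR_gt0.
have e1 : e <= 1 by rewrite expR_le1 oppr_le0 mulr_ge0 //; lra.
have ce : c0 * e <= 1 by rewrite mulr_ile1 // ltW.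
have pp : 0 < pi / p%:R :> R by rewrite divr_gt0 ?pi_gt0 ?ltr0n.
pose k := if 0 <= t then 0%N else p.-1.
have kp : (k < p)%N by rewrite /k; case: ifP => // _; rewrite ltn_predL.
pose Th : R := if k == 0%N then pi / p%:R else - (pi / p%:R).
have kE : expi (pi / p%:R * (1 + 2 * k%:R)) = expi Th :> C.
  by apply: expi_rays => //; rewrite /k; case: ifP; [left | right].
have [rz hz] := rays _ _ hs kp; rewrite kE in rz hz.
have M0 : 0 < K * expR s `^ N by rewrite mulr_gt0 ?powR_gt0 ?expR_gt0.
have hd : rnorm (expi t - expi Th : C) <= c0 * e.
  have [t0|t0] := leP 0 t.
    have -> : Th = pi / p%:R by rewrite /Th /k t0 eqxx.
    have h : `|t - pi / p%:R| = c0 * e.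
      rewrite (ger0_norm t0) in tE; rewrite tE addrAC subrr sub0r normrN ger0_norm //.
      by rewrite mulr_ge0 ?ltW.
    by rewrite -h rnorm_expiB // h.
  (* A negative [t] lies near the lower ray; for [p = 1] the recorded angle [pi] gives the same
     point as [- pi]. *)
  have -> : expi Th = expi (- (pi / p%:R)) :> C.
    rewrite -kE /k leNgt t0 /=; rewrite (@expi_rays _ p p.-1) //; last by right.
    case: eqVneq => // p1; have -> : p = 1%N by rewrite -(prednK p0) p1.
    by rewrite divr1 -[in RHS]expiD2pi; congr expi; ring.
  have h : `|t - - (pi / p%:R)| = c0 * e.
    rewrite (ltr0_norm t0) in tE; rewrite opprK -[t]opprK tE opprB subrK ger0_norm //.
    by rewrite mulr_ge0 ?ltW.
  by rewrite -h rnorm_expiB // h.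
have hshift : rnorm (cexp (s +i* t) - (expR s)%:C * expi Th : C) <= c0 * expR (- (N * s)).
  rewrite /cexp /= -mulrBr rnormM rnorm_real ger0_norm ?expR_ge0 //.
  apply: le_trans (_ : expR s * (c0 * e) <= _); first by rewrite ler_wpM2l ?expR_ge0.
  rewrite mulrCA /e -expRD; have -> // : s + - ((N + 1) * s) = - (N * s) by ring.
have lb u (du : op_dom T u) := resolvent_lower_bound M0 rz hz du.
apply: le_trans (lower_bound_shift lb hshift dv); rewrite ler_wpM2r ?rnorm_ge0 //.
have -> : (K * expR s `^ N)^-1 = expR (- (N * s)) / K.
  by rewrite invfM mulrC /powR gt_eqF ?expR_gt0 // expRK -expRN.
have -> : expR (- (N * s)) / K - c0 * expR (- (N * s)) = expR (- (N * s)) * (K^-1 - c0) by ring.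
rewrite ler_pM2l ?expR_gt0 //.
have -> : K^-1 = 2 * (1 / (2 * K)) :> R by field; rewrite gt_eqF.
have -> : (2 * K)^-1 = 1 / (2 * K) by rewrite div1r.
lra.
Qed.

End EdgeResolvent.

(** * The resolvent estimate *)

Section Density.
Context {R : realType} {H : normedModType R[i]} (T : operator H).
Local Notation C := R[i].

Lemma opnorm_resolvent_dense (z : C) (A : set H) (M : R) : resolvent_set T z -> dense A ->
  0 <= M -> (forall x, A x -> rnorm (resolvent T z x) <= M * rnorm x) ->
  (opnorm (resolvent T z) <= M%:E)%E.
Proof.
move=> rz dA M0 hA; have [M' M'0 HM'] := resolvent_bound rz.
have lS := resolvent_linear rz.
apply: opnorm_le_fin => x x1; rewrite -subr_le0; apply: (@le0_eps _ _ (M + M')) => e e0 _.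
have e0' : 0 < e%:C :> C by rewrite ltcR.
have [y [xy Ay]] := dA (ball x e%:C) (ex_intro _ x (ballxx x e0')) (ball_open x _).
rewrite -ball_normE /= normr_lt_rnorm in xy.
have h1 := hA y Ay; have h2 := HM' (x - y); rewrite (linear_mapB lS) in h2.
have h3 := rnormD (resolvent T z x - resolvent T z y) (resolvent T z y); rewrite subrK in h3.
have h4 := rnormB x (x - y); rewrite subKr in h4.
have h5 : M * rnorm y <= M * (1 + e) by rewrite ler_wpM2l //; lra.
have h6 : M' * rnorm (x - y) <= M' * e by rewrite ler_pM2l // ltW.
lra.
Qed.

End Density.

Section Assembly.
Context {R : realType}.

Lemma powR_unbounded (c b A : R) : 0 < c -> 0 < b -> exists n : nat, A < c * n.+1%:R `^ b.
Proof.
move=> c0 b0; pose X := (`|A| + 1) / c.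
have X0 : 0 < X by rewrite divr_gt0 // ltr_wpDl.
have Y0 : 0 <= X `^ b^-1 by exact: powR_ge0.
exists (Num.bound (X `^ b^-1)).
have h : X `^ b^-1 < (Num.bound (X `^ b^-1)).+1%:R.
  by apply: lt_trans (archi_boundP Y0) _; rewrite ltr_nat.
have h2 : X < (Num.bound (X `^ b^-1)).+1%:R `^ b.
  have {1}-> : X = (X `^ b^-1) `^ b by rewrite -powRrM mulVf ?gt_eqF // powRr1 // ltW.
  by rewrite gt0_ltr_powR // nnegrE.
have : X * c < c * (Num.bound (X `^ b^-1)).+1%:R `^ b by rewrite mulrC ltr_pM2l.
rewrite /X divfK ?gt_eqF // => h3; apply: lt_trans h3.
by rewrite (le_lt_trans (ler_norm A)) // ltrDl.
Qed.

(** Two bounds, since separation on the circle is modulo [2 * pi]: for [p = 1] an upper edge also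
    comes near points of negative argument across the negative axis. *)
Lemma opposite_arg_bounds (s t e Om : R) : 0 <= e -> Om <= pi -> `|s| <= Om - 2 * e ->
  Om - e <= `|t| -> `|t| <= Om -> e <= `|t - s| /\ `|t - s| <= 2 * pi - e.
Proof.
move=> e0 Opi hs ht hO; have h1 := ler_normB t s; have h2 := lerB_normD t (- s).
rewrite normrN in h2; split; lra.
Qed.

End Assembly.

Section SectorBound.
Context {R : realType} {H : completeNormedModType R[i]}.
Local Notation C := R[i].
Variables (T : operator H) (lam : nat -> C) (a q r1 B : R) (thm : R -> R).
Hypotheses (hlam : eigenvalue_seq T lam) (r10 : 0 < r1)
  (hcomplete : complete_projections T).

Lemma resolvent_sector_bound (z : C) (C0 : R) : 0 <= B -> 0 <= C0 ->
  (forall F, uniq F -> (forall l, l \in F -> large_eigenvalue T r1 lam l) ->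
     forall x e z, 0 < e -> (forall l, l \in F -> e <= rnorm (z - l)) ->
       rnorm (damped_projections T a q F z x) <= C0 / e * rnorm x) ->
  (forall x, linear_span (\bigcup_(l in spectrum T) range (riesz_proj T l)) x ->
    exists F, [/\ uniq F, forall l, l \in F -> large_eigenvalue T r1 lam l &
      forall s t, ln r1 <= s -> `|t| <= thm s -> not_eigenvalue T (cexp (s +i* t)) ->
      exists2 v, resolves T (cexp (s +i* t)) x v &
        rnorm (damp a q (s +i* t) *: v - damped_projections T a q F (cexp (s +i* t)) x)
          <= B / expR s * rnorm x]) ->
  resolvent_set T z -> r1 < rnorm z -> 1 <= r1 -> `|arg z| <= thm (ln (rnorm z)) ->
  (opnorm (resolvent T z) <=
    ((B * (1 + rnorm (lam 0%N)) + C0) / dist z (spectrum T) *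
      expR (a * (rnorm z `^ q * cos (q * arg z))))%:E)%E.
Proof.
move=> B0 C00 hC0 hB rz r1z r11 az.
have sp : spectrum T !=set0 by exists (lam 0%N); apply: lam_spectrum.
have D0 := dist_spectrum_gt0 sp rz; set D := dist _ _ in D0 *.
have n0 : 0 < rnorm z by exact: lt_trans r1z.
have z0 : z != 0 by rewrite -rnorm_gt0.
(* A fixed eigenvalue and [|z| >= 1] bound the distance by a multiple of [|z|]; this later turns
   [B / |z|] into a multiple of [1 / D]. *)
have Dz : D <= rnorm z * (1 + rnorm (lam 0%N)).
  have := @dist_le _ z _ _ (lam_spectrum hlam (n := 0%N)); rewrite -/D => h; apply: le_trans h _.
  apply: le_trans (rnormB _ _) _; rewrite mulrDr mulr1 lerD2l.
  by rewrite ler_peMl ?rnorm_ge0 // (le_trans r11) // ltW.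
apply: (opnorm_resolvent_dense rz hcomplete).
  rewrite mulr_ge0 ?expR_ge0 // divr_ge0 ?(ltW D0) // addr_ge0 // mulr_ge0 //.
  by rewrite addr_ge0 ?rnorm_ge0.
move=> x xs; have [F [uF lF hF]] := hB x xs.
have cz : cexp (ln (rnorm z) +i* arg z) = z by exact: clogK.
have := hF (ln (rnorm z)) (arg z); rewrite cz => /(_ _ az).
have h1 : ln r1 <= ln (rnorm z) by rewrite ler_ln ?posrE // ltW.
have ne : not_eigenvalue T z.
  move=> v dv ev; apply/eqP; apply: contrapT => /negP v0.
  exact: (eigenvector_spectrum v0 dv ev).
move=> /(_ h1 ne)[v hv hb].
rewrite -(resolvent_uniq rz hv); rewrite lnK ?posrE // in hb.
have hp := hC0 F uF lF x D z D0 (fun l lin => dist_le _ (let: And3 h _ _ := lF l lin in h)).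
have hd : rnorm (damp a q (ln (rnorm z) +i* arg z)) = expR (- (a * (rnorm z `^ q * cos (q * arg z)))).
  by rewrite rnorm_damp /powR gt_eqF.
have h2 := rnormD (damp a q (ln (rnorm z) +i* arg z) *: v - damped_projections T a q F z x)
  (damped_projections T a q F z x); rewrite subrK rnormZ hd in h2.
rewrite mulrAC -ler_pdivrMr ?expR_gt0 // -expRN mulrC.
apply: le_trans h2 _; apply: le_trans (lerD hb hp) _.
rewrite -mulrDl ler_wpM2r ?rnorm_ge0 // mulrDl lerD2r -mulrA ler_wpM2l //.
by rewrite ler_pdivlMr // mulrC ler_pdivrMr // mulrC.
Qed.

End SectorBound.

Lemma continuous_exp_approach (R : realType) (A c m : R) :
  continuous (fun s : R => A - c * expR (- (m * s))).
Proof.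
move=> s; apply: cvgB; first exact: cvg_cst.
apply: cvgM; first exact: cvg_cst.
apply: (@continuous_comp _ _ _ (fun s : R => - (m * s)) (@expR R)); last exact: continuous_expR.
by apply: cvgN; apply: cvgM; [exact: cvg_cst | exact: cvg_id].
Qed.

Theorem theorem4p3 (R : realType)
  (H : completeNormedModType R[i]) (dot : {dot H for Num.conj})
  (p : nat) (T : operator H) (lam : nat -> R[i])
  (Rad eps0 K N Rad0 c kappa gamma rho : R)
  (hH : is_hilbert dot)
  (hsep : separable H)
  (hp : (0 < p)%N)
  (hclosed : closed_operator T)
  (hcompact : has_compact_resolvent T)
  (hlam : eigenvalue_seq T lam)
  (hRad : 0 < Rad)
  (heps0 : 0 < eps0 <= 1)
  (hsector : forall z, spectrum T z ->
     rnorm z < Rad \/ `|arg z| <= (1 - eps0) * (pi / p%:R))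
  (hK : 1 <= K)
  (hN : -1 <= N)
  (hrays : forall (r : R) (k : nat), Rad + 1 <= r -> (k < p)%N ->
     let z := r%:C * expi (pi / p%:R * (1 + 2 * k%:R)) in
     resolvent_set T z /\ (opnorm (resolvent T z) <= (K * r `^ N)%:E)%E)
  (hRad0 : Rad < Rad0)
  (hmult : forall l, spectrum T l -> Rad0 < rnorm l ->
     exists2 m, geom_mult T l m & alg_mult T l m)
  (hcomplete : complete_projections T)
  (hc : 0 < c)
  (hkappa : 0 < kappa)
  (hgrowth : forall n, c * n.+1%:R `^ kappa <= rnorm (lam n))
  (hgamma : 0 < gamma)
  (hrho : 0 < rho)
  (hriesz : exists o1 : R[i] -> R,
     (forall e : R, 0 < e -> exists M : R,
        forall l, spectrum T l -> M < rnorm l -> `|o1 l| <= e) /\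
     (exists M : R, forall l, spectrum T l -> M < rnorm l ->
        (opnorm (riesz_proj T l) <=
         (expR (gamma * rnorm l `^ (p%:R * rho) * (1 + o1 l)))%:E)%E))
  (hcase : rho < 1 / 2 \/ (rho = 1 / 2 /\ N < -1 + 1 / (2 * p%:R))) :
  forall eps1 delta : R, 0 < eps1 <= 1 -> 0 < delta ->
  exists C r : R, 0 < C /\ 0 < r /\
    forall z : R[i], resolvent_set T z -> r < rnorm z ->
      `|arg z| <= (1 - eps1) * pi / p%:R ->
      (opnorm (resolvent T z) <=
       (C / dist z (spectrum T) *
        expR ((1 + delta) * gamma *
              (cos (p%:R * rho * arg z) / cos ((1 - eps0) * pi * rho)) *
              rnorm z `^ (p%:R * rho)))%:E)%E.
Proof.
move=> eps1 delta heps1 hdelta.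
have pR : 0 < p%:R :> R by rewrite ltr0n.
have p1 : 1 <= p%:R :> R by rewrite ler1n.
have pi0 := pi_gt0 R.
have [e00 e01] := andP heps0; have [e10 e11] := andP heps1.
have K0 : 0 < K by lra.
have rho12 : rho <= 1 / 2 by case: hcase => [|[]]; lra.
pose Om : R := pi / p%:R; pose q := p%:R * rho.
have Om0 : 0 < Om by rewrite divr_gt0.
have OmE : p%:R * Om = pi by rewrite /Om mulrC divfK ?gt_eqF.
have Ompi : Om <= pi by rewrite -OmE ler_peMl // ltW.
have q0 : 0 < q by rewrite mulr_gt0.
have qOm : q * Om = rho * pi by rewrite /q mulrAC OmE mulrC.
have rpi : rho * pi <= pi / 2 by rewrite mulrC ler_pM2l //; lra.
have cosq (t : R) : `|t| <= Om -> 0 <= cos (q * t).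
  move=> ht; apply: cos_ge0_pihalf; rewrite -ler_norml normrM gtr0_norm //.
  by apply: le_trans rpi; rewrite -qOm ler_pM2l.
pose kap := cos ((1 - eps0) * pi * rho).
have kap0 : 0 < kap.
  have h1 : 0 < eps0 * (rho * pi) by rewrite !mulr_gt0.
  have h2 : 0 <= (1 - eps0) * (rho * pi) by rewrite mulr_ge0 ?subr_ge0 // mulr_ge0 ?(ltW hrho) ?(ltW pi0).
  have -> : kap = cos ((1 - eps0) * (rho * pi)) by rewrite /kap; congr cos; ring.
  by rewrite cos_gt0_pihalf //; apply/andP; split; lra.
have kapq (t : R) : `|t| <= (1 - eps0) * Om -> kap <= cos (q * t).
  move=> ht; rewrite -(cos_norm (q * t)) normrM gtr0_norm //.
  have -> : kap = cos (q * ((1 - eps0) * Om)) by rewrite mulrCA qOm /kap; congr cos; ring.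
  have h1 : q * `|t| <= q * ((1 - eps0) * Om) by rewrite ler_pM2l.
  have h2 : q * ((1 - eps0) * Om) <= q * Om by rewrite ler_pM2l // ler_piMl ?(ltW Om0) //; lra.
  by apply: ler_cos => //; [rewrite mulr_ge0 ?(ltW q0) | lra].
pose a := (1 + delta) * gamma / kap.
have a0 : 0 < a by rewrite divr_gt0 // mulr_gt0 //; lra.
have aE : a * kap = (1 + delta) * gamma by rewrite divfK ?gt_eqF.
have [z0 rz0 cz0] := hcompact.
have d20 : 0 < delta / 2 by rewrite divr_gt0.
have [ o1 [ho [M2 hP]]] := hriesz; have [M1 ho1] := ho _ d20.
(* Beyond [r0] the sector condition, the equality of multiplicities, the ray bounds and the Riesz
   bound with [|o1| <= delta / 2] all hold. *)
pose r0 := Num.max (Rad + 1) (Num.max Rad0 (Num.max M1 M2)).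
have unb A : exists n, A < rnorm (lam n).
  have [n hn] := powR_unbounded A hc hkappa.
  by exists n; apply: lt_le_trans hn (hgrowth n).
have [r1 [r2 [r01 r12 gap]]] := modulus_gap hlam r0 unb.
have [rRad rRad0 rM1 rM2] : [/\ Rad + 1 < r1, Rad0 < r1, M1 < r1 & M2 < r1].
  by move: r01; rewrite !gt_max => /and4P.
have r1gt1 : 1 <= r1 by lra.
have r1gt0 : 0 < r1 by lra.
have lam_r1 n : rnorm (lam n) != r1.
  by have [h|h] := gap n; [rewrite lt_eqF | rewrite gt_eqF //; lra].
have large_arg l : spectrum T l -> r1 < rnorm l -> `|arg l| <= (1 - eps0) * Om.
  by move=> sl rl; have [h|//] := hsector l sl; exfalso; lra.
have large l : spectrum T l -> r1 < rnorm l ->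
    `|arg l| < pi /\ root_space T l `<=` eigenspace_of T l.
  move=> sl rl; split.
    have h := large_arg l sl rl; apply: le_lt_trans h _.
    have : 0 < eps0 * Om by rewrite mulr_gt0.
    lra.
  have [m hg ha] := hmult l sl (lt_trans rRad0 rl).
  exact: equal_mult_eigenspace hg ha.
have lP l : spectrum T l -> linear (riesz_proj T l).
  by move=> sl; have [] := riesz_proj_facts hH rz0 cz0 sl.
have [C0 C00 hC0] : exists2 C0 : R, 0 < C0 &
    forall F, uniq F -> (forall l, l \in F -> large_eigenvalue T r1 lam l) ->
    forall x e z, 0 < e -> (forall l, l \in F -> e <= rnorm (z - l)) ->
      rnorm (damped_projections T a q F z x) <= C0 / e * rnorm x.
  (* Since [|lam n| ^ q >= c ^ q * (n + 1) ^ (kappa * q)], decay in the modulus becomes decay in the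
     index. *)
  have d0 : 0 < delta / 2 * gamma * c `^ q by rewrite !mulr_gt0 ?powR_gt0 // divr_gt0.
  apply: (damped_projections_bound d0 (mulr_gt0 hkappa q0)) => n x [sl rl _].
  have l0 : lam n != 0 by rewrite -rnorm_gt0; lra.
  apply: le_trans (damped_riesz_bound x (lP _ sl) l0 (ltW a0) (ltW hgamma) aE
    (kapq _ (large_arg _ sl rl)) (ho1 _ sl (lt_trans rM1 rl)) (hP _ sl (lt_trans rM2 rl))) _.
  rewrite ler_wpM2r ?rnorm_ge0 // ler_expR lerN2 -mulrA.
  rewrite ler_wpM2l ?mulr_ge0 ?divr_ge0 ?(ltW hdelta) ?(ltW hgamma) //.
  rewrite (powRrM _ kappa) -powRM ?(ltW hc) ?powR_ge0 //.
  by rewrite ge0_ler_powR ?(ltW q0) ?nnegrE ?rnorm_ge0 ?mulr_ge0 ?powR_ge0 ?(ltW hc).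
(* Half the angle between the rays and the spectral sector: large spectral points have argument at
   most [Om - 2 * eta], while the edges will stay beyond [Om - eta]. *)
pose eta := eps0 * Om / 2.
have eta0 : 0 < eta by rewrite divr_gt0 // mulr_gt0.
(* [eta] keeps the bent edges away from the spectrum, [eps1 * Om] keeps the sector of the claim
   between them, [1 / (2 * K)] saves half of the ray bound, [1 / p] keeps the argument of the sine
   in [edge_damping] at most [1 / 2], and [Om / 2] keeps the angle [thm] positive. *)
pose c0 := Num.min (Num.min eta (eps1 * Om)) (Num.min (1 / (2 * K)) (Num.min (1 / p%:R) (Om / 2))).
have c00 : 0 < c0 by rewrite !lt_min !mulr_gt0 ?invr_gt0 ?mulr_gt0.
have [c0eta c0eps c0K c0p c0Om] : [/\ c0 <= eta, c0 <= eps1 * Om, c0 <= 1 / (2 * K),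
    c0 <= 1 / p%:R & c0 <= Om / 2].
  by have := lexx c0; rewrite {2}/c0 !le_min => /andP[/andP[? ?] /and3P[? ? ?]].
have c01 : c0 <= 1 by apply: le_trans c0p _; rewrite div1r invf_le1.
pose thm s := Om - c0 * expR (- ((N + 1) * s)).
have thm_le s : thm s <= Om by rewrite lerBlDr lerDl mulr_ge0 ?expR_ge0 // ltW.
have thm_ge s : 0 <= s -> Om - c0 <= thm s.
  move=> s0; rewrite lerD2l lerN2 ler_piMr ?(ltW c00) // expR_le1 oppr_le0 mulr_ge0 //; lra.
have cthm : continuous thm by exact: continuous_exp_approach.
have ln0 : 0 <= ln r1 by rewrite ln_ge0.
have [c1 c10 hc1] : exists2 c1 : R, 0 < c1 & forall t v, - pi <= t <= pi -> op_dom T v ->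
    c1 * rnorm v <= rnorm ((r1%:C * expi t) *: v - op_fun T v).
  apply: (circle_lower_bound rz0 cz0) => t v dv ev; apply/eqP; apply: contrapT => /negP v0.
  have rv : root_space T (r1%:C * expi t) v.
    by exists 1%N => //=; rewrite ev subrr.
  have [n hn] := root_vector_in_seq hlam rv v0; have /eqP := lam_r1 n; apply.
  by rewrite hn rnormM rnorm_expi mulr1 rnorm_real gtr0_norm.
have left_res (t : R) v : `|t| <= Om -> op_dom T v ->
    c1 * rnorm v <= rnorm (cexp (ln r1 +i* t) *: v - op_fun T v).
  move=> ht; rewrite /cexp /= lnK ?posrE //; apply: hc1.
  by rewrite -ler_norml (le_trans ht).
have left_dist t l : large_eigenvalue T r1 lam l -> r2 - r1 <= rnorm (cexp (ln r1 +i* t) - l).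
  move=> [_ rl [n hn]]; have rcE : rnorm (cexp (ln r1 +i* t)) = r1 by rewrite rnorm_cexp /= lnK ?posrE.
  have := lerB_rnorm l (cexp (ln r1 +i* t)); rewrite rcE rdistC; apply: le_trans.
  by rewrite lerD2r -hn; have [h|//] := gap n; move: h; rewrite hn ltNge (ltW rl).
have eta_pi : eta <= pi / 2.
  by rewrite ler_pM2r ?invr_gt0 // (le_trans _ Ompi) // ler_piMl // ltW.
have eta_le : eta <= pi by apply: le_trans eta_pi _; rewrite ler_pdivrMr // ler_peMr ?(ltW pi0) // ler1n.
have c30 : 0 < 1 - Num.max (cos eta) 0.
  by rewrite subr_gt0 gt_max ltr01 andbT -[ltRHS](@cos0 R) ltr_cos ?in_itv /= ?lexx ?(ltW pi0) ?(ltW eta0) ?eta_le.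
have thm0_ge (s t : R) : ln r1 <= s -> `|t| = thm s -> Om - eta <= `|t| <= Om.
  move=> h ->; rewrite thm_le andbT; apply: le_trans (thm_ge s (le_trans ln0 h)).
  by rewrite lerD2l lerN2.
have edge_dist (s t : R) l : ln r1 <= s -> `|t| = thm s -> large_eigenvalue T r1 lam l ->
    (1 - Num.max (cos eta) 0) * expR s <= rnorm (cexp (s +i* t) - l).
  move=> hs ht [sl rl _]; have /andP[t1 t2] := thm0_ge s t hs ht.
  have l0 : l != 0 by rewrite -rnorm_gt0 (lt_trans r1gt0).
  have ha : `|arg l| <= Om - 2 * eta.
    have -> : Om - 2 * eta = (1 - eps0) * Om by rewrite /eta; field.
    exact: large_arg.
  have [h1 h2] := opposite_arg_bounds (ltW eta0) Ompi ha t1 t2.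
  by rewrite [l in leRHS]polar_arg // /cexp /=; apply: sector_separation;
    rewrite ?expR_ge0 ?rnorm_ge0 // ltW.
have c0p1 : c0 * p%:R <= 1 by rewrite -ler_pdivlMr.
have [b [c2 [b0 c20 hdamp]]] := edge_damping hp hrho c00 c0p1 hN hcase.
(* On the edges [|z|] times the resolvent bound has order [|z| ^ (N + 1)], hence the exponent
   [N + 1]. *)
have [A A0 hA] := powR_expR_bound (N + 1) (mulr_gt0 a0 c20) b0.
have edge_res (s t : R) : ln r1 <= s -> `|t| = thm s -> exists m : R, [/\ 0 < m,
    expR s * rnorm (damp a q (s +i* t)) / m <= 2 * K * A &
    forall v, op_dom T v -> m * rnorm v <= rnorm (cexp (s +i* t) *: v - op_fun T v)].
  move=> hs ht; have s0 := le_trans ln0 hs.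
  have m0 : 0 < expR (- (N * s)) / (2 * K) by rewrite divr_gt0 ?expR_gt0 // mulr_gt0.
  exists (expR (- (N * s)) / (2 * K)); split=> //; last first.
    move=> v dv; apply: (edge_lower_bound hp K0 c00 c01 c0K hN _ hrays s0 _ ht dv).
      by apply: le_trans c0Om _; rewrite ler_pdivrMr // ler_peMr ?(ltW Om0) // ler1n.
    by apply: ltW; apply: lt_le_trans rRad _; rewrite -[leLHS]lnK ?posrE // ler_expR.
  have -> : expR s * rnorm (damp a q (s +i* t)) / (expR (- (N * s)) / (2 * K)) =
     2 * K * (expR ((N + 1) * s) * rnorm (damp a q (s +i* t))).
    have -> : (N + 1) * s = N * s + s by ring.
    by rewrite expRD expRN; field; rewrite !gt_eqF ?expR_gt0.
  rewrite ler_pM2l ?mulr_gt0 //; apply: le_trans (hA s s0).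
  rewrite ler_pM2l ?expR_gt0 // rnorm_damp ler_expR lerN2 -mulrA ler_pM2l //.
  exact: hdamp.
have A10 : 0 <= 2 * K * A by rewrite !mulr_ge0 // ltW.
have c2'0 : 0 < r2 - r1 by rewrite subr_gt0.
have main := damped_bound hH (ltW a0) r1gt1 Ompi cosq rz0 cz0 hlam lam_r1 large cthm
  (fun s _ => thm_le s) (ltW C00) A10 c10 c2'0 c30 hC0 left_res left_dist edge_dist edge_res.
set B0 := r1 * _ + _ in main.
have B00 : 0 <= B0.
  by rewrite addr_ge0 ?mulr_ge0 ?addr_ge0 ?mulr_ge0 ?invr_ge0 ?(ltW c10) ?(ltW c2'0) ?(ltW c30)
    ?(ltW r1gt0) ?(ltW C00) ?(ltW K0) ?(ltW A0).
exists (B0 * (1 + rnorm (lam 0%N)) + C0), r1; split; [|split] => //.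
  by rewrite ltr_wpDl // mulr_ge0 // addr_ge0 ?rnorm_ge0.
move=> z rz r1z az.
have sz : 0 <= ln (rnorm z) by rewrite ln_ge0 // (le_trans r1gt1) // ltW.
have az' : `|arg z| <= thm (ln (rnorm z)).
  apply: le_trans az _; apply: le_trans (thm_ge _ sz).
  have -> : (1 - eps1) * pi / p%:R = Om - eps1 * Om by rewrite /Om; ring.
  by rewrite lerD2l lerN2.
have := resolvent_sector_bound hlam r1gt0 hcomplete B00 (ltW C00) hC0 main rz r1z r1gt1 az'.
have -> // : a * (rnorm z `^ q * cos (q * arg z)) = (1 + delta) * gamma *
  (cos (p%:R * rho * arg z) / cos ((1 - eps0) * pi * rho)) * rnorm z `^ (p%:R * rho).
by rewrite /a /kap /q; field; rewrite gt_eqF.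
Qed.
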